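(* Let $\mathfrak{A}$ be a uniform algebra. The following are equivalent: (i) $\min \mathfrak{A}$ is operator amenable. (ii) $\mathfrak{A}$ is operator amenable for any (i.e. every) operator space structure on $\mathfrak{A}$ turning $\mathfrak{A}$ into a completely contractive Banach algebra. (iii) $\mathfrak{A}$ is amenable. (iv) $\mathfrak{A}$ is a commutative $C^\ast$-algebra.
   Context: All algebras and spaces are over $\mathbb{C}$. A uniform algebra is a (norm-)closed subalgebra $\mathfrak{A}$ of a commutative $C^\ast$-algebra, with the inherited norm; it is not assumed to be unital. ''$\mathfrak{A}$ is a commutative $C^\ast$-algebra'' means that the Banach algebra $\mathfrak{A}$ is, with its given norm and multiplication and some involution, a commutative $C^\ast$-algebra, i.e. it is isometrically isomorphic as a Banach algebra to $C_0(X)$ for some locally compact Hausdorff space $X$. A Banach algebra $\mathfrak{A}$ is amenable (in the sense of B. E. Johnson) if for every Banach $\mathfrak{A}$-bimodule $E$, every bounded derivation $D : \mathfrak{A} \to E^\ast$ is inner. Here $E^\ast$ has the dual bimodule structure $\langle x, a\cdot\varphi\rangle = \langle x\cdot a, \varphi\rangle$, $\langle x, \varphi\cdot a\rangle = \langle a\cdot x, \varphi\rangle$; a derivation is a linear map with $D(ab) = a\cdot D(b) + D(a)\cdot b$; it is inner if $D(a) = a\cdot\varphi - \varphi\cdot a$ for some $\varphi \in E^\ast$. An operator space is a complex Banach space $E$ together with norms on the matrix spaces $M_n(E)$, $n \in \mathbb{N}$, satisfying Ruan's axioms; equivalently, $E$ is realized as a closed subspace of $B(H)$ for some Hilbert space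 $H$, with $M_n(E)$ normed as a subspace of $M_n(B(H)) = B(H^n)$. An operator space structure on a Banach space $E$ is such a family of matrix norms for which the norm on $M_1(E) = E$ is the given norm of $E$. A linear map $T : E \to F$ between operator spaces is completely bounded if $\|T\|_{cb} := \sup_n \|T^{(n)} : M_n(E) \to M_n(F)\| < \infty$, where $T^{(n)}$ applies $T$ entrywise. A bilinear map $\phi : E \times F \to G$ between operator spaces is completely bounded if the maps $M_p(E) \times M_q(F) \to M_{pq}(G)$, $([x_{ij}],[y_{kl}]) \mapsto [\phi(x_{ij},y_{kl})]$, are bounded uniformly in $p,q$, and completely contractive if these maps all have norm at most $1$. The dual $E^\ast$ of an operator space carries the operator space structure given by identifying $M_n(E^\ast)$ with the space $CB(E, M_n)$ of completely bounded maps from $E$ to $M_n = M_n(\mathbb{C})$. For a Banach space $E$, $\min E$ denotes $E$ with its minimal operator space structure: $\|[x_{ij}]\|_{M_n(\min E)} = \sup\{ \|[\varphi(x_{ij})]\|_{M_n} : \varphi \in E^\ast, \|\varphi\| \le 1\}$. For a uniform algebra $\mathfrak{A}$, $\min \mathfrak{A}$ coincides with the operator space structure that $\mathfrak{A}$ inherits from the ambient commutative $C^\ast$-algebra. A completely contractive Banach algebra is a Banach algebra that is also an operator space such that multiplication is a completely contractive bilinear map. For a uniform algebra $\mathfrak{A}$, $\min \mathfrak{A}$ is a completely contractive Banach algebra. For a completely contractive Banach algebra $\mathfrak{B}$, an operator $\mathfrak{B}$-bimodule is an operator space $E$ which is a $\mathfrak{B}$-bimodule such that the left and right module actions are completely bounded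 bilinear maps; then $E^\ast$, with the dual bimodule structure, is again an operator $\mathfrak{B}$-bimodule. $\mathfrak{B}$ is operator amenable if for every operator $\mathfrak{B}$-bimodule $E$, every completely bounded derivation $D : \mathfrak{B} \to E^\ast$ is inner. *)

(* Defs.v *)
(* A complex Banach space is a completeNormedModType R[i], for R : realType.
   Algebras need not be unital, whence a product is a plain binary operation on
   a Banach space rather than a ring structure. *)
From HB Require Import structures.
From mathcomp Require Import all_boot all_order all_algebra.
From mathcomp Require Import complex mxtens.
From mathcomp Require Import classical_sets reals topology normedtype.

Set Implicit Arguments.
Unset Strict Implicit.
Unset Printing Implicit Defensive.

Import Order.TTheory GRing.Theory Num.Theory.
Import numFieldNormedType.Exports.

Local Open Scope classical_set_scope.
Local Open Scope complex_scope.
Local Open Scope ring_scope.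

(* The library's norm on a space over R[i] takes values in R[i]; its values are
   nonnegative reals, so that taking the real part loses nothing. *)
Definition rnorm (R : realType) (E : normedModType R[i]) (x : E) : R :=
  complex.Re `|x|.

Definition bilinear_map (R : realType) (E F G : lmodType R[i])
    (phi : E -> F -> G) : Prop :=
  (forall x, linear (phi x)) /\ (forall y, linear (phi^~ y)).

Record is_banach_algebra (R : realType) (A : completeNormedModType R[i])
    (mul : A -> A -> A) : Prop := {
  ba_bilinear : bilinear_map mul;
  ba_assoc : associative mul;
  ba_submult : forall a b, `|mul a b| <= `|a| * `|b| }.

Record is_cstar_involution (R : realType) (A : completeNormedModType R[i])
    (mul : A -> A -> A) (star : A -> A) : Prop := {
  star_conjlinear : forall (c : R[i]) a b,
    star (c *: a + b) = c^* *: star a + star b;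
  star_involutive : involutive star;
  star_antimult : forall a b, star (mul a b) = mul (star b) (star a);
  star_cstar : forall a, `|mul (star a) a| = `|a| ^+ 2 }.

Definition commutative_cstar_algebra (R : realType)
    (A : completeNormedModType R[i]) (mul : A -> A -> A) : Prop :=
  [/\ is_banach_algebra mul, commutative mul
    & exists star : A -> A, is_cstar_involution mul star].

(* Since A is complete, the range of the isometry j is a closed subalgebra of
   the commutative C*-algebra B. *)
Definition uniform_algebra (R : realType) (A : completeNormedModType R[i])
    (mul : A -> A -> A) : Prop :=
  exists (B : completeNormedModType R[i]) (mulB : B -> B -> B)
         (j : {linear A -> B}),
    [/\ commutative_cstar_algebra mulB,
        (forall a, `|j a| = `|a|)
      & (forall a b, j (mul a b) = mulB (j a) (j b))].

Definition dual (R : realType) (E : normedModType R[i]) : set (E -> R[i]) :=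
  [set phi | scalar phi /\ exists M : R, forall x, `|phi x| <= M%:C * `|x|].

(* On [dual E] the set below is bounded, so that [sup] is the supremum. *)
Definition dual_norm (R : realType) (E : normedModType R[i])
    (phi : E -> R[i]) : R :=
  sup [set r | exists2 x : E, rnorm x <= 1 & r = complex.Re `|phi x|].

Record is_bimodule (R : realType) (A E : lmodType R[i]) (mul : A -> A -> A)
    (lact : A -> E -> E) (ract : E -> A -> E) : Prop := {
  lact_bilinear : bilinear_map lact;
  ract_bilinear : bilinear_map ract;
  lact_mul : forall a b x, lact (mul a b) x = lact a (lact b x);
  ract_mul : forall x a b, ract x (mul a b) = ract (ract x a) b;
  lact_ract : forall a x b, lact a (ract x b) = ract (lact a x) b }.

Definition bounded_bilinear (R : realType) (E F G : normedModType R[i])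
    (phi : E -> F -> G) : Prop :=
  exists M : R, forall x y, `|phi x y| <= M%:C * `|x| * `|y|.

Definition is_banach_bimodule (R : realType)
    (A E : completeNormedModType R[i]) (mul : A -> A -> A)
    (lact : A -> E -> E) (ract : E -> A -> E) : Prop :=
  [/\ is_bimodule mul lact ract, bounded_bilinear lact
    & bounded_bilinear ract].

Definition dual_lact (R : realType) (A E : normedModType R[i])
    (ract : E -> A -> E) (a : A) (phi : E -> R[i]) : E -> R[i] :=
  fun x => phi (ract x a).

Definition dual_ract (R : realType) (A E : normedModType R[i])
    (lact : A -> E -> E) (phi : E -> R[i]) (a : A) : E -> R[i] :=
  fun x => phi (lact a x).

Record is_dual_derivation (R : realType) (A E : completeNormedModType R[i])
    (mul : A -> A -> A) (lact : A -> E -> E) (ract : E -> A -> E)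
    (D : A -> E -> R[i]) : Prop := {
  deriv_dual : forall a, dual (D a);
  deriv_linear : forall x, scalar (D^~ x);
  deriv_mul : forall a b x,
    D (mul a b) x = dual_lact ract a (D b) x + dual_ract lact (D a) b x }.

Definition inner_derivation (R : realType) (A E : completeNormedModType R[i])
    (lact : A -> E -> E) (ract : E -> A -> E) (D : A -> E -> R[i]) : Prop :=
  exists2 phi : E -> R[i], dual phi &
    forall a x, D a x = dual_lact ract a phi x - dual_ract lact phi a x.

Definition amenable (R : realType) (A : completeNormedModType R[i])
    (mul : A -> A -> A) : Prop :=
  forall (E : completeNormedModType R[i])
         (lact : A -> E -> E) (ract : E -> A -> E),
    is_banach_bimodule mul lact ract ->
    forall D : A -> E -> R[i],
      is_dual_derivation mul lact ract D ->
      (exists M : R, forall a, dual_norm (D a) <= M * rnorm a) ->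
      inner_derivation lact ract D.

Definition euclidean_norm (R : realType) (n : nat) (v : 'cV[R[i]]_n) : R :=
  Num.sqrt (\sum_(i < n) (complex.Re `|v i 0|) ^+ 2).

Definition mx_opnorm (R : realType) (m n : nat) (X : 'M[R[i]]_(m, n)) : R :=
  sup [set r | exists2 v : 'cV[R[i]]_n,
         euclidean_norm v <= 1 & r = euclidean_norm (X *m v)].

(* A family of candidate norms on all the matrix spaces over V; the size n = 0,
   where the space is trivial, is harmlessly included. *)
Definition matrix_norms (R : realType) (V : Type) : Type :=
  forall n : nat, 'M[V]_n -> R.

Definition mx_bimul (R : realType) (E : lmodType R[i]) (m n : nat)
    (X : 'M[R[i]]_(m, n)) (x : 'M[E]_n) (Y : 'M[R[i]]_(n, m)) : 'M[E]_m :=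
  \matrix_(i, j) \sum_(k < n) \sum_(l < n) (X i k * Y l j) *: x k l.

Record is_operator_space (R : realType) (E : completeNormedModType R[i])
    (nu : matrix_norms R E) : Prop := {
  os_triangle : forall n (x y : 'M[E]_n), nu n (x + y) <= nu n x + nu n y;
  os_homog : forall n (c : R[i]) (x : 'M[E]_n),
    nu n (map_mx ( *:%R c) x) = complex.Re `|c| * nu n x;
  os_definite : forall n (x : 'M[E]_n), nu n x = 0 -> x = 0;
  os_norm1 : forall x : E, nu 1 (const_mx x) = rnorm x;
  os_ruan_sum : forall m n (x : 'M[E]_m) (y : 'M[E]_n),
    nu (m + n) (block_mx x 0 0 y) = Num.max (nu m x) (nu n y);
  os_ruan_mul : forall m n (X : 'M[R[i]]_(m, n)) (x : 'M[E]_n)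
                       (Y : 'M[R[i]]_(n, m)),
    nu m (mx_bimul X x Y) <= mx_opnorm X * nu n x * mx_opnorm Y }.

(* The identification of M_m(M_n(V)) with M_{mn}(V). *)
Definition mx_flatten (V : Type) (m n : nat) (X : 'M['M[V]_n]_m) :
    'M[V]_(m * n) :=
  \matrix_(r, s) X (mxtens_unindex r).1 (mxtens_unindex s).1
                   (mxtens_unindex r).2 (mxtens_unindex s).2.

Definition cb_norm (R : realType) (V W : Type)
    (nuV : matrix_norms R V) (nuW : matrix_norms R W) (T : V -> W) : R :=
  sup [set r | exists n (x : 'M[V]_n),
         nuV n x <= 1 /\ r = nuW n (map_mx T x)].

Definition completely_bounded (R : realType) (V W : Type)
    (nuV : matrix_norms R V) (nuW : matrix_norms R W) (T : V -> W) : Prop :=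
  exists M : R, forall n (x : 'M[V]_n), nuW n (map_mx T x) <= M * nuV n x.

Definition bilinear_amplification (U V W : Type) (phi : U -> V -> W)
    (p q : nat) (x : 'M[U]_p) (y : 'M[V]_q) : 'M[W]_(p * q) :=
  mx_flatten (map_mx (fun u => map_mx (phi u) y) x).

Definition cb_bilinear_le (R : realType) (U V W : Type)
    (nuU : matrix_norms R U) (nuV : matrix_norms R V) (nuW : matrix_norms R W)
    (phi : U -> V -> W) (M : R) : Prop :=
  forall p q (x : 'M[U]_p) (y : 'M[V]_q),
    nuW (p * q)%N (bilinear_amplification phi x y) <= M * nuU p x * nuV q y.

Definition completely_bounded_bilinear (R : realType) (U V W : Type)
    (nuU : matrix_norms R U) (nuV : matrix_norms R V) (nuW : matrix_norms R W)
    (phi : U -> V -> W) : Prop :=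
  exists M : R, cb_bilinear_le nuU nuV nuW phi M.

Definition completely_contractive_bilinear (R : realType) (U V W : Type)
    (nuU : matrix_norms R U) (nuV : matrix_norms R V) (nuW : matrix_norms R W)
    (phi : U -> V -> W) : Prop :=
  cb_bilinear_le nuU nuV nuW phi 1.

(* The operator space structure of M_n = B(C^n). *)
Definition Mn_norms (R : realType) (n : nat) : matrix_norms R 'M[R[i]]_n :=
  fun m X => mx_opnorm (mx_flatten X).

(* M_n of the dual of E is normed as CB(E, M_n).  Only matrices with entries in [dual E]
   matter; for an operator space E these give completely bounded maps, so that
   the [sup] in [cb_norm] is the supremum. *)
Definition dual_norms (R : realType) (E : normedModType R[i])
    (nu : matrix_norms R E) : matrix_norms R (E -> R[i]) :=
  fun n F => cb_norm nu (@Mn_norms R n)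
               (fun x => map_mx (fun f : E -> R[i] => f x) F).

Definition min_norms (R : realType) (E : normedModType R[i]) :
    matrix_norms R E :=
  fun n x => sup [set r | exists phi : E -> R[i],
    [/\ dual phi, dual_norm phi <= 1 & r = mx_opnorm (map_mx phi x)]].

Definition is_cc_banach_algebra (R : realType) (A : completeNormedModType R[i])
    (mul : A -> A -> A) (nu : matrix_norms R A) : Prop :=
  [/\ is_banach_algebra mul, is_operator_space nu
    & completely_contractive_bilinear nu nu nu mul].

Definition is_operator_bimodule (R : realType)
    (A E : completeNormedModType R[i]) (mul : A -> A -> A)
    (nuA : matrix_norms R A) (nuE : matrix_norms R E)
    (lact : A -> E -> E) (ract : E -> A -> E) : Prop :=
  [/\ is_operator_space nuE, is_bimodule mul lact ract,
      completely_bounded_bilinear nuA nuE nuE lact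
    & completely_bounded_bilinear nuE nuA nuE ract].

Definition operator_amenable (R : realType) (A : completeNormedModType R[i])
    (mul : A -> A -> A) (nuA : matrix_norms R A) : Prop :=
  forall (E : completeNormedModType R[i]) (nuE : matrix_norms R E)
         (lact : A -> E -> E) (ract : E -> A -> E),
    is_operator_bimodule mul nuA nuE lact ract ->
    forall D : A -> E -> R[i],
      is_dual_derivation mul lact ract D ->
      completely_bounded nuA (dual_norms nuE) D ->
      inner_derivation lact ract D.

(* Main.v *)
(* (iv) => (iii).  The elements b such that 1 + b is unitary in the unitization
   form an abelian group under a + b + ab and span A; averaging D(b) acted upon by
   1 + b^* over an invariant mean on this group gives the implementing functional.

   (iii) => (ii).  Bounded functionals on an operator space are completely bounded
   with the same norm, so that operator bimodules are Banach bimodules and completely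
   bounded derivations are bounded.

   (i) => (iv).  Minimal power-multiplicative seminorms on A yield norming
   characters, hence a Gelfand transform, and it suffices to show that its range is
   closed under conjugation.  If the conjugate of some a0 is missing, it has positive
   distance to A + C, and Hahn-Banach gives a mean m and a unimodular function w such
   that m(w f) = 0 on W = A + C but m(w conj(a0)) <> 0.  On the space V of bounded
   functions with the L^2-seminorm of m, the form I(x, y) = m(w x y) vanishes on
   W x W.  Let P be the orthogonal projection onto the closure of W and let
   Q0(x, y) = I(x - Px, y): it vanishes on W x V and agrees with I on V x W.  The
   forms Q0(x, ay) - Q0(ax, y) vanish on W x V and on V x W; evaluation at
   them is a derivation of min A into the dual of the operator bimodule E of bounded
   functionals on the space of such bounded forms, completely bounded because A acts
   on V by row and column contractions.  A functional on E that implements it, restricted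
   to the elementary tensors F |-> F(x, y), corrects Q0 by a form vanishing on W x V and
   V x W to a bounded form Q with Q(ax, y) = Q(x, ay).  As in Fuglede's theorem,
   Q also commutes with multiplication by conj(a0), whence
   m(w conj(a0)) = Q(conj(a0), 1) = Q(1, conj(a0)) = 0. *)
From HB Require Import structures.
Require Import Defs.
From mathcomp Require Import all_boot all_order all_algebra.
From mathcomp Require Import complex mxtens.
From mathcomp Require Import boolp classical_sets functions reals topology normedtype.
From mathcomp Require Import ring lra.

Set Implicit Arguments.
Unset Strict Implicit.
Unset Printing Implicit Defensive.

Import Order.TTheory GRing.Theory Num.Theory.
Import numFieldNormedType.Exports.

Local Open Scope classical_set_scope.
Local Open Scope complex_scope.
Local Open Scope ring_scope.

(** In (i) => (iv) the orthogonal projection onto the closure of W does not commute with A, because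
    multiplication by A is not closed under adjoints; amenability trades it for a complement that
    does. Everything is said with forms such as I(x - Px, y), so that neither L^2 nor the closure of
    W has to be formed. The admissible corrections vanish on both W x V and V x W, since they must
    leave untouched the two properties of Q0 that produce the contradiction. Q0 itself is not of
    this kind, which is why its defect is a derivation that is not inner for trivial reasons.
    Minimality of the operator space structure enters through commutativity: a matrix over A acts on
    V^n by a scalar matrix at each point, so that it and its transpose are both bounded by the min
    norm. As A need not have a unit, scalars are adjoined in W only, and the zero functional counts
    as a character. Characters norm A, which also shows that min A is a completely contractive
    Banach algebra; (ii) => (i) rests on this. *)

Lemma le_of_eq (R : numDomainType) (x y : R) : x = y -> x <= y.
Proof. by move=> ->. Qed.

(** * Complex absolute values, and matrices as bilinear forms on finite l2 spaces *)

Section ComplexNorm.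
Variable R : realType.
Implicit Types (z w : R[i]) (r : R).

Definition cn z : R := complex.Re `|z|.

Lemma real_complexM (a b : R) : (a * b)%:C = a%:C * b%:C.
Proof. exact: rmorphM. Qed.

Lemma real_complexD (a b : R) : (a + b)%:C = a%:C + b%:C.
Proof. exact: rmorphD. Qed.

Lemma real_complexV (a : R) : (a^-1)%:C = a%:C^-1.
Proof. exact: fmorphV. Qed.

Lemma cnE z : `|z| = (cn z)%:C.
Proof. by rewrite /cn normc_def. Qed.

Lemma cn_ge0 z : 0 <= cn z.
Proof. by rewrite -ler0c -cnE. Qed.
Hint Resolve cn_ge0 : core.

Lemma cnM z w : cn (z * w) = cn z * cn w.
Proof. by apply: complexI; rewrite real_complexM -!cnE normrM. Qed.

Lemma cnD z w : cn (z + w) <= cn z + cn w.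
Proof. by rewrite -lecR real_complexD -!cnE ler_normD. Qed.

Lemma cn0 : cn 0 = 0. Proof. by rewrite /cn normr0. Qed.
Lemma cn1 : cn 1 = 1. Proof. by rewrite /cn normr1. Qed.
Lemma cnN z : cn (- z) = cn z. Proof. by rewrite /cn normrN. Qed.

Lemma cnB z w : cn (z - w) <= cn z + cn w.
Proof. by rewrite (le_trans (cnD _ _))// cnN. Qed.

Lemma cn_eq0 z : (cn z == 0) = (z == 0).
Proof. by rewrite -(inj_eq (@complexI R)) -cnE normr_eq0. Qed.

Lemma cn0_eq0 z : cn z = 0 -> z = 0.
Proof. by move/eqP; rewrite cn_eq0 => /eqP. Qed.

Lemma cn_real r : cn r%:C = `|r|.
Proof. by rewrite /cn normc_def /= expr0n /= addr0 sqrtr_sqr. Qed.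

Lemma cn_conj z : cn z^* = cn z.
Proof. by rewrite /cn normcJ. Qed.

Lemma cnV z : cn z^-1 = (cn z)^-1.
Proof. by apply: complexI; rewrite real_complexV -!cnE normfV. Qed.

Lemma cnX z n : cn (z ^+ n) = cn z ^+ n.
Proof. by elim: n => [|n ih]; rewrite ?expr0 ?cn1// !exprS cnM ih. Qed.

Lemma cni : cn 'i = 1.
Proof. by rewrite /cn normc_def /= expr0n expr1n /= add0r sqrtr1. Qed.

Lemma cn_sqr z : cn z ^+ 2 = complex.Re z ^+ 2 + complex.Im z ^+ 2.
Proof. by apply: complexI; rewrite expr2 real_complexM -cnE -expr2 -add_Re2_Im2. Qed.

Lemma cn_sqrE z : (cn z ^+ 2)%:C = z * z^*.
Proof. by rewrite expr2 real_complexM -cnE -expr2 sqr_normc. Qed.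

Lemma Re_le_cn z : complex.Re z <= cn z.
Proof.
apply: le_trans (ler_norm _) _.
by rewrite -(ler_pXn2r (ltn0Sn 1)) ?nnegrE// cn_sqr real_normK ?num_real// lerDl sqr_ge0.
Qed.

Lemma Im_le_cn z : complex.Im z <= cn z.
Proof.
apply: le_trans (ler_norm _) _.
by rewrite -(ler_pXn2r (ltn0Sn 1)) ?nnegrE// cn_sqr real_normK ?num_real// lerDr sqr_ge0.
Qed.

Lemma cn_sum (I : Type) (r : seq I) (P : pred I) (F : I -> R[i]) :
  cn (\sum_(i <- r | P i) F i) <= \sum_(i <- r | P i) cn (F i).
Proof.
elim/big_rec2: _ => [|i y x _ le_yx]; first by rewrite cn0.
by apply: le_trans (cnD _ _) _; rewrite lerD2l.
Qed.

(** The value 1 at 0 keeps it unimodular everywhere, as [phase] requires later. *)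
Definition csgn z : R[i] := if z == 0 then 1 else (cn z)%:C / z.

Lemma cn_csgn z : cn (csgn z) = 1.
Proof.
rewrite /csgn; case: eqP => [_|/eqP z0]; first exact: cn1.
by rewrite cnM cn_real cnV ger0_norm// divff// cn_eq0.
Qed.

Lemma csgnM z : csgn z * z = (cn z)%:C.
Proof.
rewrite /csgn; case: eqP => [->|/eqP z0]; first by rewrite mulr0 cn0.
by rewrite divfK.
Qed.

End ComplexNorm.
#[export] Hint Extern 0 (is_true (0 <= cn _)) => exact: cn_ge0 : core.

Section RealNorm.
Variables (R : realType) (E : normedModType R[i]).
Implicit Types x y : E.

Lemma rnormE x : `|x| = (rnorm x)%:C.
Proof.
by rewrite /rnorm; have := normr_ge0 x; rewrite lecE => /andP[/eqP/= h _];
   rewrite [LHS]complexE h /= mulr0 addr0.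
Qed.

Lemma rnorm_ge0 x : 0 <= rnorm x.
Proof. by rewrite -ler0c -rnormE. Qed.

Lemma rnormD x y : rnorm (x + y) <= rnorm x + rnorm y.
Proof. by rewrite -lecR real_complexD -!rnormE ler_normD. Qed.

Lemma rnormZ c x : rnorm (c *: x) = cn c * rnorm x.
Proof. by apply: complexI; rewrite real_complexM -cnE -!rnormE normrZ. Qed.

Lemma rnorm0 : rnorm (0 : E) = 0. Proof. by rewrite /rnorm normr0. Qed.
Lemma rnormN x : rnorm (- x) = rnorm x. Proof. by rewrite /rnorm normrN. Qed.

Lemma rnormB x y : rnorm (x - y) <= rnorm x + rnorm y.
Proof. by rewrite (le_trans (rnormD _ _))// rnormN. Qed.

Lemma rnorm_distC x y : rnorm (x - y) = rnorm (y - x).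
Proof. by rewrite -rnormN opprB. Qed.

Lemma rnorm_eq0 x : (rnorm x == 0) = (x == 0).
Proof. by rewrite -(inj_eq (@complexI R)) -rnormE normr_eq0. Qed.

Lemma rnorm0_eq0 x : rnorm x = 0 -> x = 0.
Proof. by move/eqP; rewrite rnorm_eq0 => /eqP. Qed.

End RealNorm.
#[export] Hint Extern 0 (is_true (0 <= rnorm _)) => exact: rnorm_ge0 : core.

(** The vertex t = - b / c settles c > 0; for c = 0 a nonconstant affine function takes the value -
    1. Source of the Cauchy-Schwarz inequalities for sums and means, and of the near orthogonality
    in [exists_near_projection]. *)
Lemma quadratic_discr (R : realType) (a b c : R) : 0 <= c ->
  (forall t, 0 <= a + 2 * b * t + c * t ^+ 2) -> b ^+ 2 <= a * c.
Proof.
rewrite le_eqVlt => /orP[/eqP <-|c0] h.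
  have [-> |b0] := eqVneq b 0; first by rewrite mulr0 expr0n.
  have := h (- (a + 1) / (2 * b)).
  rewrite mul0r addr0 mulrC divfK ?mulf_neq0 ?pnatr_eq0// => ?; exfalso; lra.
have := h (- b / c); rewrite expr_div_n sqrrN.
have -> : a + 2 * b * (- b / c) + c * (b ^+ 2 / c ^+ 2) = (a * c - b ^+ 2) / c.
  by field; rewrite gt_eqF.
by rewrite pmulr_lge0 ?invr_gt0// subr_ge0.
Qed.

Lemma le_sqrtM (R : realType) (a b c : R) : 0 <= a -> 0 <= c ->
  b ^+ 2 <= a * c -> b <= Num.sqrt a * Num.sqrt c.
Proof.
move=> a0 c0 h; rewrite -sqrtrM//; apply: le_trans (ler_norm _) _.
by rewrite -sqrtr_sqr ler_wsqrtr.
Qed.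

Lemma cauchy_schwarz_sum (R : realType) (I : finType) (a b : I -> R) :
  \sum_i a i * b i <= Num.sqrt (\sum_i a i ^+ 2) * Num.sqrt (\sum_i b i ^+ 2).
Proof.
have s0 (f : I -> R) : 0 <= \sum_i f i ^+ 2 by apply: sumr_ge0 => i _; rewrite sqr_ge0.
apply: le_sqrtM => //; apply: quadratic_discr => // t.
rewrite [2 * _ * t](_ : _ = \sum_i 2 * t * (a i * b i)); last by rewrite -mulr_sumr; ring.
rewrite mulr_suml -!big_split /=; apply: sumr_ge0 => i _.
by rewrite (_ : _ + _ = (a i + t * b i) ^+ 2) ?sqr_ge0//; ring.
Qed.

Section L2.
Variable R : realType.
Implicit Types I J K : finType.

Definition l2 I (u : I -> R[i]) : R := Num.sqrt (\sum_i cn (u i) ^+ 2).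

Lemma l2_ge0 I (u : I -> R[i]) : 0 <= l2 u.
Proof. exact: sqrtr_ge0. Qed.
Hint Extern 0 (is_true (0 <= l2 _)) => exact: l2_ge0 : core.

Lemma l2_sqr I (u : I -> R[i]) : l2 u ^+ 2 = \sum_i cn (u i) ^+ 2.
Proof. by rewrite sqr_sqrtr// sumr_ge0// => i _; rewrite sqr_ge0. Qed.

Lemma eq_l2 I (u v : I -> R[i]) : u =1 v -> l2 u = l2 v.
Proof. by move=> e; congr Num.sqrt; apply: eq_bigr => i _; rewrite e. Qed.

Lemma l2Z I c (u : I -> R[i]) : l2 (fun i => c * u i) = cn c * l2 u.
Proof.
rewrite /l2; under eq_bigr do rewrite cnM exprMn.
by rewrite -mulr_sumr sqrtrM ?sqr_ge0// sqrtr_sqr ger0_norm.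
Qed.

Lemma l2_conj I (u : I -> R[i]) : l2 (fun i => (u i)^*) = l2 u.
Proof. by congr Num.sqrt; apply: eq_bigr => i _; rewrite cn_conj. Qed.

Lemma l2_eq0 I (u : I -> R[i]) : l2 u = 0 -> forall i, u i = 0.
Proof.
move=> u0 i; apply: cn0_eq0; apply/eqP; rewrite -sqrf_eq0.
have := l2_sqr u; rewrite u0 expr0n /= => /esym/eqP; rewrite psumr_eq0 => [/allP h|j _]; last by rewrite sqr_ge0.
exact: (h i (mem_index_enum _)).
Qed.

Lemma l2_reindex I J (h : J -> I) (u : I -> R[i]) : bijective h ->
  l2 (fun j => u (h j)) = l2 u.
Proof. by move=> bh; rewrite /l2 (reindex h) //; exact: onW_bij. Qed.

Lemma l2_delta I (i : I) : l2 (fun j => (j == i)%:R) = 1.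
Proof.
rewrite /l2 (bigD1 i)//= eqxx cn1 expr1n big1 ?addr0 ?sqrtr1// => j /negPf ->.
by rewrite cn0 expr0n.
Qed.

Lemma cn_sum_l2 I (u v : I -> R[i]) : cn (\sum_i u i * v i) <= l2 u * l2 v.
Proof.
apply: le_trans (cn_sum _ _ _) _; under eq_bigr do rewrite cnM.
exact: cauchy_schwarz_sum.
Qed.

Lemma sum_l2_l2 I J K (u : I -> J -> R[i]) (v : I -> K -> R[i]) :
  \sum_i l2 (u i) * l2 (v i) <=
  l2 (fun p : I * J => u p.1 p.2) * l2 (fun p : I * K => v p.1 p.2).
Proof.
have h (L : finType) (w : I -> L -> R[i]) : \sum_i l2 (w i) ^+ 2 = \sum_p cn (w p.1 p.2) ^+ 2.
  under eq_bigr do rewrite l2_sqr.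
  by rewrite pair_big.
by apply: le_trans (cauchy_schwarz_sum _ _) _; rewrite !h.
Qed.

Definition bil I J (X : I -> J -> R[i]) (v : I -> R[i]) (u : J -> R[i]) : R[i] :=
  \sum_i \sum_j v i * X i j * u j.

(** An operator norm bound through the pairing with vectors, without conjugation, which [l2] does
    not see. Arbitrary finite index types let product indices do without flattening. *)
Definition opb I J (X : I -> J -> R[i]) (C : R) : Prop :=
  forall v u, cn (bil X v u) <= C * l2 v * l2 u.

Lemma bilE I J (X : I -> J -> R[i]) v u :
  bil X v u = \sum_i v i * \sum_j X i j * u j.
Proof. by apply: eq_bigr => i _; rewrite mulr_sumr; apply: eq_bigr => j _; rewrite mulrA. Qed.

Lemma bil_tr I J (X : I -> J -> R[i]) v u :
  bil X v u = bil (fun j i => X i j) u v.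
Proof.
rewrite /bil exchange_big; apply: eq_bigr => i _; apply: eq_bigr => j _; ring.
Qed.

Lemma opb_tr I J (X : I -> J -> R[i]) C : opb X C -> opb (fun j i => X i j) C.
Proof. by move=> h v u; rewrite bil_tr (le_trans (h _ _))// mulrAC. Qed.

Lemma opb_le I J (X : I -> J -> R[i]) C C' : C <= C' -> opb X C -> opb X C'.
Proof.
move=> le h v u; apply: le_trans (h v u) _.
by rewrite -!mulrA ler_wpM2r// mulr_ge0.
Qed.

(** Testing the form against the conjugate of the image w = X u gives |w|^2 <= C |w| |u|, and |w|
    cancels. *)
Lemma opb_vec I J (X : I -> J -> R[i]) C u : 0 <= C -> opb X C ->
  l2 (fun i => \sum_j X i j * u j) <= C * l2 u.
Proof.
move=> C0 h; set w := fun i => _.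
have [w0|w0] := eqVneq (l2 w) 0; first by rewrite w0 mulr_ge0.
have wp : 0 < l2 w by rewrite lt_def w0 l2_ge0.
rewrite -(ler_pM2l wp) -expr2.
apply: le_trans (_ : cn (bil X (fun i => (w i)^*) u) <= _).
  rewrite bilE l2_sqr; apply: le_trans (Re_le_cn _); rewrite raddf_sum.
  by apply: ler_sum => i _; rewrite mulrC -[\sum_j _]/(w i) -cn_sqrE.
by apply: le_trans (h _ _) _; rewrite l2_conj mulrCA mulrA.
Qed.

Lemma opb_vecl I J (X : I -> J -> R[i]) C v : 0 <= C -> opb X C ->
  l2 (fun j => \sum_i v i * X i j) <= C * l2 v.
Proof.
move=> C0 h; apply: le_trans (opb_vec v C0 (opb_tr h)).
by apply/le_of_eq/eq_l2 => j; apply: eq_bigr => i _; rewrite mulrC.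
Qed.

Lemma opb_reindex I J I' J' (f : I' -> I) (g : J' -> J) (X : I -> J -> R[i]) C :
  bijective f -> bijective g ->
  opb (fun i j => X (f i) (g j)) C -> opb X C.
Proof.
move=> bf bg h v u; have := h (v \o f) (u \o g).
rewrite !(l2_reindex _ bf) !(l2_reindex _ bg); congr (cn _ <= _).
rewrite /bil (reindex f) /=; last exact: onW_bij.
by apply: eq_bigr => i _; rewrite (reindex g)//; exact: onW_bij.
Qed.

(** The witness is the Hilbert-Schmidt norm; any finite bound would do, as it only serves to make
    the supremum in [mx_opnorm] a genuine one. *)
Lemma opb_ex I J (X : I -> J -> R[i]) : exists2 C, 0 <= C & opb X C.
Proof.
exists (l2 (fun p : I * J => X p.1 p.2)) => // v u.
rewrite bilE; apply: le_trans (cn_sum_l2 _ _) _.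
rewrite mulrAC mulrC ler_wpM2r//.
rewrite -(ler_pXn2r (ltn0Sn 1)) ?nnegrE ?mulr_ge0// exprMn !l2_sqr.
rewrite -(pair_big xpredT xpredT (fun i j => cn (X i j) ^+ 2)) /= mulr_suml.
apply: ler_sum => i _; rewrite -!l2_sqr -exprMn ler_pXn2r ?nnegrE ?mulr_ge0//.
exact: cn_sum_l2.
Qed.

Lemma euclidean_norm_l2 n (v : 'cV[R[i]]_n) : euclidean_norm v = l2 (fun i => v i 0).
Proof. by []. Qed.

Lemma l2_mulmx m n (X : 'M[R[i]]_(m, n)) (v : 'cV[R[i]]_n) :
  euclidean_norm (X *m v) = l2 (fun i => \sum_j X i j * v j 0).
Proof. by rewrite euclidean_norm_l2; apply: eq_l2 => i; rewrite mxE. Qed.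

Lemma mx_opnorm_le m n (X : 'M[R[i]]_(m, n)) C : 0 <= C -> opb X C -> mx_opnorm X <= C.
Proof.
move=> C0 h; apply: ge_sup => [|_ [v v1 ->]].
  exists (euclidean_norm (X *m 0)), 0 => //.
  by rewrite euclidean_norm_l2 /l2 big1 ?sqrtr0// => i _; rewrite mxE cn0 expr0n.
rewrite l2_mulmx; apply: le_trans (opb_vec _ C0 h) _.
by rewrite -[leRHS]mulr1 ler_wpM2l.
Qed.

Lemma mx_opnorm_ub m n (X : 'M[R[i]]_(m, n)) v :
  euclidean_norm v <= 1 -> euclidean_norm (X *m v) <= mx_opnorm X.
Proof.
move=> v1; apply: ub_le_sup; last by exists v.
have [C C0 h] := opb_ex X; exists C => _ [w w1 ->].
by rewrite l2_mulmx; apply: le_trans (opb_vec _ C0 h) _; rewrite -[leRHS]mulr1 ler_wpM2l.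
Qed.

Lemma mx_opnorm_ge0 m n (X : 'M[R[i]]_(m, n)) : 0 <= mx_opnorm X.
Proof.
apply: le_trans (@mx_opnorm_ub _ _ X 0 _); first exact: l2_ge0.
by rewrite euclidean_norm_l2 /l2 big1 ?sqrtr0// => i _; rewrite mxE cn0 expr0n.
Qed.
Hint Extern 0 (is_true (0 <= mx_opnorm _)) => exact: mx_opnorm_ge0 : core.

Lemma mx_opnormP m n (X : 'M[R[i]]_(m, n)) : opb X (mx_opnorm X).
Proof.
move=> v u; rewrite bilE; apply: le_trans (cn_sum_l2 _ _) _.
rewrite mulrAC [X in _ <= X]mulrC ler_wpM2l//.
have [u0|u0] := eqVneq (l2 u) 0.
  rewrite u0 mulr0 /l2 big1 ?sqrtr0// => i _; rewrite big1 ?cn0 ?expr0n// => j _.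
  by rewrite (l2_eq0 u0) mulr0.
have up : 0 < l2 u by rewrite lt_def u0 l2_ge0.
have := @mx_opnorm_ub _ _ X (\col_j (((l2 u)^-1)%:C * u j)).
rewrite euclidean_norm_l2 l2_mulmx.
under eq_l2 do rewrite mxE.
rewrite l2Z cn_real ger0_norm ?invr_ge0// mulVf// => /(_ (lexx _)).
have -> : l2 (fun i => \sum_j X i j * (\col_j (((l2 u)^-1)%:C * u j)) j 0) =
          l2 (fun i => ((l2 u)^-1)%:C * \sum_j X i j * u j).
  by apply: eq_l2 => i; rewrite mulr_sumr; apply: eq_bigr => j _; rewrite mxE; ring.
by rewrite l2Z cn_real ger0_norm ?invr_ge0// mulrC ler_pdivrMr.
Qed.

Lemma opb_le_opnorm m n (X : 'M[R[i]]_(m, n)) C : 0 <= C ->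
  mx_opnorm X <= C <-> opb X C.
Proof.
move=> C0; split=> [le|]; last exact: mx_opnorm_le.
exact: opb_le le (mx_opnormP X).
Qed.

End L2.
#[export] Hint Extern 0 (is_true (0 <= l2 _)) => exact: l2_ge0 : core.
#[export] Hint Extern 0 (is_true (0 <= mx_opnorm _)) => exact: mx_opnorm_ge0 : core.

(* The real and imaginary parts of the limit are suprema of lower bounds. *)
Lemma complex_limit (R : realType) (I : Type) (z : I -> R[i]) (d : I -> R) :
  I -> (forall i j, cn (z i - z j) <= d i + d j) ->
  exists l, forall i, cn (l - z i) <= 2 * d i.
Proof.
move=> i0 h.
have real_limit (f : I -> R) : (forall i j, f i - f j <= d i + d j) ->
    exists l, forall i, `|l - f i| <= d i.
  move=> hf; pose S := [set f i - d i | i in setT].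
  have ubS i : ubound S (f i + d i).
    by move=> _ [j _ <-]; have := hf j i; lra.
  exists (sup S) => i; rewrite ler_distl; apply/andP; split.
    by apply: ub_le_sup; [exists (f i0 + d i0) | exists i].
  by apply: ge_sup => //; exists (f i0 - d i0), i0.
have [a ha] : exists a, forall i, `|a - complex.Re (z i)| <= d i.
  by apply: real_limit => i j; rewrite -raddfB; exact: le_trans (Re_le_cn _) (h i j).
have [b hb] : exists b, forall i, `|b - complex.Im (z i)| <= d i.
  by apply: real_limit => i j; rewrite -raddfB; exact: le_trans (Im_le_cn _) (h i j).
exists (a%:C + 'i * b%:C) => i; rewrite {1}[z i]complexE opprD addrACA -mulrBr.
apply: le_trans (cnD _ _) _; rewrite cnM cni mul1r -!raddfB /= !cn_real.
by rewrite mulr_natl mulr2n lerD.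
Qed.

(** * Norming characters *)

Section Infimum.
Variables (R : realType) (I : Type) (D : set I).
Implicit Types (f g : I -> R) (a c : R).

Definition infv f : R := inf (f @` D).

Hypothesis D0 : D !=set0.

Lemma infv_le f i : (forall i, 0 <= f i) -> D i -> infv f <= f i.
Proof.
by move=> f0 Di; apply: ge_inf; [exists 0 => _ [j _ <-] | exists i].
Qed.

Lemma le_infv f c : (forall i, D i -> c <= f i) -> c <= infv f.
Proof.
move=> h; apply: lb_le_inf; first by case: D0 => i Di; exists (f i), i.
by move=> _ [i Di <-]; exact: h.
Qed.

Lemma infv_ge0 f : (forall i, 0 <= f i) -> 0 <= infv f.
Proof. by move=> f0; apply: le_infv => i _. Qed.

Lemma eq_infv f g : f =1 g -> infv f = infv g.
Proof. by move=> /funext ->. Qed.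

Lemma le_add_infv f g c : (forall i j, D i -> D j -> c <= f i + g j) ->
  c <= infv f + infv g.
Proof.
move=> h; rewrite -lerBlDr; apply: le_infv => i Di; rewrite lerBlDr -lerBlDl.
by apply: le_infv => j Dj; rewrite lerBlDl h.
Qed.

Lemma le_mulr_infv f a c : 0 <= a -> (forall i, D i -> c <= a * f i) ->
  c <= a * infv f.
Proof.
rewrite le_eqVlt => /orP[/eqP <- h|a0 h].
  by case: D0 => i /h; rewrite !mul0r.
by rewrite -ler_pdivrMl//; apply: le_infv => i Di; rewrite ler_pdivrMl// h.
Qed.

Lemma le_mul_infv f g c : (forall i, 0 <= f i) -> (forall i, 0 <= g i) ->
  (forall i j, D i -> D j -> c <= f i * g j) -> c <= infv f * infv g.
Proof.
move=> f0 g0 h; apply: le_mulr_infv; first exact: infv_ge0.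
move=> j Dj; rewrite mulrC; apply: le_mulr_infv => // i Di.
by rewrite mulrC h.
Qed.

Lemma infvZ f a : 0 <= a -> (forall i, 0 <= f i) ->
  infv (fun i => a * f i) = a * infv f.
Proof.
move=> a0 f0; apply/le_anti/andP; split; last first.
  by apply: le_infv => i Di; rewrite ler_wpM2l// infv_le.
apply: le_mulr_infv => // i Di.
by apply: (@infv_le (fun i => a * f i)) => // j; rewrite mulr_ge0.
Qed.

End Infimum.

Section Characters.
Variables (R : realType) (A : normedModType R[i]) (mul : A -> A -> A).
Hypothesis mulB : bilinear_map mul.
Hypothesis mulA : associative mul.
Hypothesis mulC : commutative mul.
Hypothesis mul_le : forall a b, rnorm (mul a b) <= rnorm a * rnorm b.
Hypothesis norm_sq : forall a, rnorm (mul a a) = rnorm a ^+ 2.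
Implicit Types (x y a b c : A) (p q : A -> R).

Let mulDl x y z : mul (x + y) z = mul x z + mul y z.
Proof. by have := mulB.2 z 1 x y; rewrite !scale1r. Qed.
Let mulDr x y z : mul z (x + y) = mul z x + mul z y.
Proof. by rewrite mulC mulDl ![mul z _]mulC. Qed.
Let mulZl k x z : mul (k *: x) z = k *: mul x z.
Proof.
have m0 : mul 0 z = 0 by apply: (addrI (mul 0 z)); rewrite -mulDl !addr0.
by have := mulB.2 z k x 0; rewrite m0 !addr0.
Qed.
Let mulZr k x z : mul z (k *: x) = k *: mul z x.
Proof. by rewrite mulC mulZl mulC. Qed.
Let mulACA x y z t : mul (mul x y) (mul z t) = mul (mul x z) (mul y t).
Proof. by rewrite -!mulA; congr (mul x _); rewrite !mulA (mulC y). Qed.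

Record power_seminorm p : Prop := {
  psn_ge0 : forall x, 0 <= p x;
  psn_D : forall x y, p (x + y) <= p x + p y;
  psn_Z : forall k x, p (k *: x) = cn k * p x;
  psn_M : forall x y, p (mul x y) <= p x * p y;
  psn_sq : forall x, p (mul x x) = p x ^+ 2;
  psn_le : forall x, p x <= rnorm x }.

Lemma rnorm_power_seminorm : power_seminorm (@rnorm R A).
Proof.
split=> //; [exact: rnormD | exact: rnormZ].
Qed.

(** The power x^(2^n): [psn_sq] controls squares only, and starting at x itself avoids a unit. *)
Definition sqn n x : A := iter n (fun y => mul y y) x.

Lemma sqnS n x : sqn n.+1 x = mul (sqn n x) (sqn n x).
Proof. by []. Qed.

Lemma psn_sqn p n x : power_seminorm p -> p (sqn n x) = p x ^+ (2 ^ n).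
Proof.
move=> ps; elim: n => [|n ih]; first by rewrite expr1.
by rewrite sqnS psn_sq// ih -exprM expnSr.
Qed.

Section Localization.
Variables (p : A -> R) (c : A).
Hypotheses (ps : power_seminorm p) (pc : 0 < p c).

Let f x n : R := p (mul x (sqn n c)) / p c ^+ (2 ^ n).

(* [local_seminorm] is again power-multiplicative, lies below [p], and
   satisfies [local_seminorm x * p c <= p (mul x c)]; hence a seminorm
   that is minimal subject to [p b = 1] is multiplicative. *)
Definition local_seminorm x : R := infv setT (f x).

Let N0 : [set: nat] !=set0. Proof. by exists 0. Qed.

Let f0 x n : 0 <= f x n.
Proof. by rewrite divr_ge0 ?psn_ge0// exprn_ge0// ltW. Qed.

Let pcn n : 0 < p c ^+ (2 ^ n). Proof. exact: exprn_gt0. Qed.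

Let fS x n : f x n.+1 <= f x n.
Proof.
rewrite /f ler_pdivrMr// mulrAC ler_pdivlMr// expnS mul2n -addnn exprD.
rewrite [leRHS]mulrA ler_wpM2r ?(ltW (pcn _))// -(psn_sqn n c ps) sqnS mulA.
exact: psn_M.
Qed.

Let f_homo x m n : (m <= n)%N -> f x n <= f x m.
Proof.
move=> /subnK <-; elim: (n - m)%N => // k ih.
by rewrite addSn; exact: le_trans (fS _ _) ih.
Qed.

Lemma local_seminorm_le1 x : local_seminorm x <= p (mul x c) / p c.
Proof. exact: (@infv_le _ _ _ (f x) 0%N). Qed.

Lemma local_seminorm_le x : local_seminorm x <= p x.
Proof.
apply: le_trans (local_seminorm_le1 _) _.
by rewrite ler_pdivrMr//; exact: psn_M.
Qed.

Let fM x y n : f (mul x y) n.+1 <= f x n * f y n.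
Proof.
rewrite /f mulf_div expnS mul2n -addnn exprD ler_wpM2r ?invr_ge0 ?mulr_ge0 ?(ltW (pcn _))//.
by rewrite sqnS mulACA; exact: psn_M.
Qed.

Let f_sq x n : f (mul x x) n.+1 = f x n ^+ 2.
Proof.
rewrite /f expr_div_n -exprM -expnSr; congr (_ / _).
by rewrite sqnS mulACA psn_sq.
Qed.

(** The quotients [f x n] decrease in n, so that the infimum behaves as a limit and two indices may
    be replaced by their maximum. Splitting c^(2^(n+1)) into two equal factors gives
    submultiplicativity, with equality for squares. *)
Lemma local_power_seminorm : power_seminorm local_seminorm.
Proof.
have M x y : local_seminorm (mul x y) <= local_seminorm x * local_seminorm y.
  apply: le_mul_infv => // m n _ _.
  apply: (@le_trans _ _ (f (mul x y) (maxn m n).+1)); first exact: infv_le.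
  by apply: le_trans (fM _ _ _) _; rewrite ler_pM// f_homo// ?leq_maxl ?leq_maxr.
split=> //.
- by move=> x; exact: infv_ge0.
- move=> x y; apply: le_add_infv => // m n _ _.
  apply: (@le_trans _ _ (f (x + y) (maxn m n))); first exact: infv_le.
  apply: (@le_trans _ _ (f x (maxn m n) + f y (maxn m n))).
    rewrite /f -mulrDl ler_wpM2r ?invr_ge0 ?(ltW (pcn _))// mulDl; exact: psn_D.
  by rewrite lerD// f_homo// ?leq_maxl ?leq_maxr.
- move=> k x; rewrite /local_seminorm -infvZ//.
  by apply: eq_infv => n; rewrite /f mulZl psn_Z// mulrA.
- move=> x; apply/le_anti; rewrite [X in X && _]M /=.
  apply: le_infv => // n _; apply: le_trans (fS _ _); rewrite f_sq.
  by rewrite ler_pXn2r ?nnegrE ?infv_ge0 ?f0//; exact: infv_le.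
- by move=> x; apply: le_trans (local_seminorm_le x) (psn_le ps x).
Qed.

Lemma local_seminorm_eq b : (forall n, p (mul b (sqn n c)) = p c ^+ (2 ^ n)) ->
  local_seminorm b = 1.
Proof.
move=> h; have e n : f b n = 1 by rewrite /f h divff// gt_eqF.
apply/le_anti/andP; split; first by rewrite -(e 0%N); exact: infv_le.
by apply: le_infv => // n _; rewrite e.
Qed.

End Localization.

(** Zorn's lemma: a chain is directed, so that its pointwise infimum is again a power-multiplicative
    seminorm, and the normalization at b survives because every member has the value 1 there. *)
Lemma exists_minimal_seminorm b : rnorm b = 1 -> exists p,
  [/\ power_seminorm p, p b = 1 &
      forall q, power_seminorm q -> q b = 1 -> (forall x, q x <= p x) ->
        forall x, p x <= q x].
Proof.
move=> b1; pose T := {p | power_seminorm p /\ p b = 1}.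
pose le_sn (p q : T) := `[< forall x, sval q x <= sval p x >].
pose t0 : T := exist _ _ (conj rnorm_power_seminorm b1).
have [| | |[p [ps pb]] pmax] := @ZL_preorder T t0 le_sn.
- by move=> t; apply/asboolP.
- move=> r s t /asboolP rs /asboolP st; apply/asboolP => x.
  exact: le_trans (st x) (rs x).
- move=> C Ctot; have [C0|C0] := pselect (C = set0).
    by exists t0 => s; rewrite C0 => -[].
  have {}C0 : C !=set0 by apply/set0P/eqP.
  have ps0 x (t : T) : 0 <= sval t x by case: t => p [ps ?]; exact: psn_ge0.
  pose g x := infv C (fun t : T => sval t x).
  have gle x (t : T) : C t -> g x <= sval t x by move=> Ct; exact: infv_le.
  have two (s t : T) : C s -> C t ->
      exists2 r, C r & forall x, sval r x <= sval s x /\ sval r x <= sval t x.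
    move=> Cs Ct; have [/asboolP h|/asboolP h] := Ctot _ _ Cs Ct.
      by exists t => // x; rewrite h lexx.
    by exists s => // x; rewrite h lexx.
  have gM x y : g (mul x y) <= g x * g y.
    apply: le_mul_infv => // s t Cs Ct; have [r Cr h] := two _ _ Cs Ct.
    apply: le_trans (gle _ _ Cr) _; case: (svalP r) => rs _.
    by apply: le_trans (psn_M rs _ _) _; rewrite ler_pM//; case: (h x); case: (h y).
  have gs : power_seminorm g.
    split=> //.
    - by move=> x; exact: infv_ge0.
    - move=> x y; apply: le_add_infv => // s t Cs Ct.
      have [r Cr h] := two _ _ Cs Ct.
      apply: le_trans (gle _ _ Cr) _; case: (svalP r) => rs _.
      by apply: le_trans (psn_D rs _ _) _; rewrite lerD//; case: (h x); case: (h y).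
    - move=> k x; rewrite /g -infvZ//; apply: eq_infv => t.
      by case: (svalP t) => ts _; rewrite psn_Z.
    - move=> x; apply/le_anti; rewrite [X in X && _]gM /=.
      apply: le_infv => // t Ct; case: (svalP t) => ts _; rewrite psn_sq//.
      by rewrite ler_pXn2r ?nnegrE ?infv_ge0//; exact: gle.
    - move=> x; case: C0 => t Ct; apply: le_trans (gle _ _ Ct) _.
      by case: (svalP t) => ts _; exact: psn_le.
  have gb : g b = 1.
    apply/le_anti/andP; split.
      by case: C0 => t Ct; case: (svalP t) => _ <-; exact: gle.
    by apply: le_infv => // t Ct; case: (svalP t) => _ ->.
  exists (exist _ g (conj gs gb)) => s Cs; apply/asboolP => x; exact: gle.
exists p; split=> // q qs qb qp x.
by have /asboolP := pmax (exist _ q (conj qs qb)) (asboolT qp); exact.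
Qed.

Lemma exists_multiplicative_seminorm b : rnorm b = 1 -> exists p,
  [/\ power_seminorm p, p b = 1 & forall x y, p (mul x y) = p x * p y].
Proof.
move=> /exists_minimal_seminorm[p [ps pb pmin]]; exists p; split=> //.
(* Localization at c stays below p and, under this hypothesis, is still 1 at b. By minimality it is
   at least p, which is the missing inequality p x * p c <= p (x c). *)
have key c : 0 < p c -> (forall n, p (mul b (sqn n c)) = p c ^+ (2 ^ n)) ->
    forall x, p x * p c = p (mul x c).
  move=> pc h x; apply/le_anti; rewrite psn_M// andbT -ler_pdivlMr//.
  apply: le_trans (pmin _ (local_power_seminorm ps pc) _ _ x) _.
  - exact: local_seminorm_eq.
  - exact: local_seminorm_le.
  exact: local_seminorm_le1.
(* Localizing at b itself comes first: afterwards b behaves as a unit for p, which verifies the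
   hypothesis of [key] for every c with p c > 0. *)
have pbx x : p (mul b x) = p x.
  suff h : p x * p b = p (mul x b) by rewrite mulC -h pb mulr1.
  apply: key => [|n]; first by rewrite pb.
  rewrite pb expr1n; apply/le_anti/andP; split.
    by apply: le_trans (psn_M ps _ _) _; rewrite psn_sqn// pb expr1n mulr1.
  case: n => [|n]; first by rewrite psn_sq// pb expr1n.
  (* Here y is b^(2^(n+1) - 1), which completes b^(2^(n+1) + 1) to the power b^(2^(n+2)), of
     seminorm 1. *)
  have [y py ey] : exists2 y, p y <= 1 & sqn n.+1 b = mul b y.
    elim: n => [|n [y py ey]]; first by exists b; rewrite ?pb.
    exists (mul y (sqn n.+1 b)); last by rewrite mulA -ey.
    apply: le_trans (psn_M ps _ _) _.
    by rewrite psn_sqn// pb expr1n mulr1.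
  have : p (mul (mul b (sqn n.+1 b)) y) = 1.
    by rewrite mulC mulA (mulC y) -ey psn_sq// psn_sqn// pb !expr1n.
  move=> <-; apply: le_trans (psn_M ps _ _) _.
  by rewrite ler_piMr// psn_ge0.
move=> x y; have := psn_ge0 ps y; rewrite le_eqVlt => /orP[/eqP y0|y0].
  apply/le_anti; rewrite psn_M//= -y0 mulr0; exact: psn_ge0.
by rewrite key// => n; rewrite pbx psn_sqn.
Qed.

Section GelfandMazur.
Variables (p : A -> R) (b : A).
Hypotheses (ps : power_seminorm p) (pb : p b = 1).
Hypothesis pM : forall x y, p (mul x y) = p x * p y.

Lemma psn_N x : p (- x) = p x.
Proof. by rewrite -scaleN1r psn_Z// cnN cn1 mul1r. Qed.

Lemma psn_B x y : p (x - y) <= p x + p y.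
Proof. by rewrite (le_trans (psn_D ps _ _))// psn_N. Qed.

Lemma mul_diff_squares (s : R[i]) x y :
  mul (x - s *: y) (x + s *: y) = mul x x - s ^+ 2 *: mul y y.
Proof.
rewrite mulDl !mulDr -scaleNr !mulZl !mulZr (mulC y x) scalerA mulNr -expr2.
by rewrite addrA -(addrA (mul x x)) -scalerDl subrr scale0r addr0 scaleNr.
Qed.

Lemma psn_eigen x l : p (x - l *: b) = 0 -> p x = cn l.
Proof.
move=> e; apply/le_anti/andP; split.
  rewrite -[x](subrK (l *: b)); apply: le_trans (psn_D ps _ _) _.
  by rewrite e add0r psn_Z// pb mulr1.
have -> : cn l = p (l *: b) by rewrite psn_Z// pb mulr1.
have -> : l *: b = x - (x - l *: b) by rewrite opprB addrC subrK.
by apply: le_trans (psn_B _ _) _; rewrite e addr0.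
Qed.

Let N0 : [set: R[i]] !=set0. Proof. by exists 0. Qed.

Variable x : A.
Let g l : R := p (x - l *: b).
Let mu := infv setT g.

Let g0 l : 0 <= g l. Proof. exact: psn_ge0. Qed.
Let mu_le l : mu <= g l. Proof. exact: infv_le. Qed.
Let mu0 : 0 <= mu. Proof. exact: infv_ge0. Qed.

(* Gelfand-Mazur without function theory: a positive infimum [mu] of [g] would
   propagate near-minimality of [l] to every [l + t] with [|t| <= mu / 2],
   because [(x - l b)^(2^k) - (t b)^(2^k)] has the factor [x - (l + t) b] and
   the remaining factors multiply to at least [mu^(2^k - 1)]; but [g] tends to
   infinity. *)
Lemma psn_pencil_ge l s k :
  mu ^+ (2 ^ k) <= p (sqn k (x - l *: b) - s *: sqn k b).
Proof.
elim: k s => [|k ih] s.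
  by rewrite expr1 /sqn /= -addrA -opprD -scalerDl; exact: mu_le.
rewrite !sqnS -[s]sqr_sqrtc -mul_diff_squares pM expnS mul2n -addnn exprD.
rewrite ler_pM ?exprn_ge0//.
by have := ih (- sqrtc s); rewrite scaleNr opprK.
Qed.

Lemma psn_pencil_le l t k :
  g (l + t) * mu ^+ (2 ^ k).-1 <= g l ^+ (2 ^ k) + cn t ^+ (2 ^ k).
Proof.
apply: (@le_trans _ _ (p (sqn k (x - l *: b) - t ^+ (2 ^ k) *: sqn k b))).
  elim: k => [|k ih].
    by rewrite mulr1 /sqn /= expr1 -addrA -opprD -scalerDl.
  have -> : (2 ^ k.+1).-1 = ((2 ^ k).-1 + 2 ^ k)%N.
    by rewrite expnS mul2n -addnn -[X in (X + _).-1]prednK ?expn_gt0.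
  rewrite !sqnS expnSr exprM -mul_diff_squares pM exprD mulrA.
  rewrite ler_pM ?mulr_ge0 ?exprn_ge0//.
  by have := psn_pencil_ge l (- t ^+ (2 ^ k)) k; rewrite scaleNr opprK.
apply: le_trans (psn_B _ _) _.
by rewrite psn_sqn// psn_Z// psn_sqn// pb expr1n mulr1 cnX.
Qed.

Lemma expr1D_le n : exists2 X : R, 0 < X &
  forall d : R, 0 <= d -> d <= 1 -> (1 + d) ^+ n <= 1 + X * d.
Proof.
elim: n => [|n [X X0 ih]].
  by exists 1 => // d d0 _; rewrite expr0 mul1r lerDl.
exists (2 * X + 1) => [|d d0 d1]; first lra.
rewrite exprSr; apply: le_trans (ler_wpM2r _ (ih d d0 d1)) _; first lra.
have h : 0 <= X * (d * (1 - d)) by rewrite !mulr_ge0 ?subr_ge0// ltW.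
by move: h; nra.
Qed.

Lemma half_expr_small (e : R) : 0 < e -> exists n, 2^-1 ^+ (2 ^ n) <= e.
Proof.
move=> e0; pose n := Num.bound e^-1; exists n.
rewrite exprVn invf_ple ?posrE ?exprn_gt0//.
have : e^-1 < n%:R by apply: archi_boundP; rewrite invr_ge0 ltW.
move=> /ltW/le_trans; apply; rewrite -natrX ler_nat.
by apply: leq_trans (ltnW (ltn_expl n (ltnSn 1))) (ltnW (ltn_expl _ (ltnSn 1))).
Qed.

Hypothesis mup : 0 < mu.

(** Divided by mu^N with N = 2^k, [psn_pencil_le] bounds g (l + t) / mu by (1 + d)^N + 2^-N. The
    exponent is chosen first, to make the last term at most e / 2; only then d, to make (1 + d)^N at
    most 1 + e / 2. *)
Lemma pencil_step (e : R) : 0 < e -> exists2 d : R, 0 < d & forall l t,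
  cn t <= mu / 2 -> g l <= mu * (1 + d) -> g (l + t) <= mu * (1 + e).
Proof.
move=> e0; have e2 : 0 < e / 2 by rewrite divr_gt0.
have [k hk] := half_expr_small e2; set N := (2 ^ k)%N in hk *.
have [X h3 hX] := expr1D_le N.
pose d := Num.min 1 (e / 2 / X).
have d0 : 0 < d by rewrite lt_min ltr01 divr_gt0.
exists d => // l t tmu gl.
have N0' : (0 < N)%N by rewrite expn_gt0.
have h1 : (1 + d) ^+ N <= 1 + e / 2.
  apply: le_trans (hX _ (ltW d0) _) _; first by rewrite ge_min lexx.
  by rewrite lerD2l -ler_pdivlMl// mulrC ge_min lexx orbT.
rewrite -(ler_pM2r (exprn_gt0 N.-1 mup)); apply: le_trans (psn_pencil_le l t k) _.
rewrite -/N -mulrA (mulrC (1 + e)) mulrA -exprS prednK//.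
apply: (@le_trans _ _ ((mu * (1 + d)) ^+ N + (mu * 2^-1) ^+ N)).
  have d0' := ltW d0.
  by rewrite lerD// ler_pXn2r// nnegrE ?mulr_ge0 ?addr_ge0 ?invr_ge0.
rewrite !exprMn -mulrDr ler_wpM2l ?exprn_ge0//.
by apply: le_trans (lerD h1 hk) _; lra.
Qed.

Lemma pencil_steps k (e : R) : 0 < e -> exists2 d : R, 0 < d & forall l,
  g l <= mu * (1 + d) -> g (l + (mu / 2 *+ k)%:C) <= mu * (1 + e).
Proof.
move=> e0; elim: k => [|k [d d0 hd]].
  by exists e => // l; rewrite mulr0n addr0.
have [d' d'0 hd'] := pencil_step d0; exists d' => // l gl.
rewrite mulrS real_complexD addrA; apply: hd; apply: hd' => //.
by rewrite cn_real ger0_norm ?divr_ge0.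
Qed.

Lemma pencil_inf_eq0 : False.
Proof.
(* Ten steps of length mu / 2 move l by 5 mu, but two points where g is at most 2 mu are at distance
   at most 4 mu, as p b = 1. *)
have [d d0 hd] := pencil_steps 10 ltr01.
have [_ [l _ <-] gl] : exists2 y, (g @` setT) y & y < mu + mu * Num.min d 1.
  apply: inf_adherent; first by rewrite mulr_gt0// lt_min d0 ltr01.
  by split; [exists (g 0), 0 | exists 0 => _ [l _ <-]].
have gl1 : g l <= 2 * mu.
  apply: le_trans (ltW gl) _.
  by rewrite mulr_natl mulr2n lerD2l ler_piMr// ge_min lexx orbT.
have /hd h : g l <= mu * (1 + d).
  apply: le_trans (ltW gl) _; rewrite mulrDr mulr1 lerD2l ler_pM2l//.
  by rewrite ge_min lexx.
have e : (mu / 2 *+ 10)%:C *: b = (x - l *: b) - (x - (l + (mu / 2 *+ 10)%:C) *: b).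
  by rewrite opprB addrC addrA subrK scalerDl addrAC subrr add0r.
have : p ((mu / 2 *+ 10)%:C *: b) <= g l + g (l + (mu / 2 *+ 10)%:C).
  by rewrite e; exact: psn_B.
move: h; set G := g (l + _) => h.
rewrite psn_Z// pb mulr1 cn_real ger0_norm ?mulrn_wge0 ?divr_ge0//.
have -> : mu / 2 *+ 10 = 5 * mu by rewrite -mulr_natr; field.
apply/negP; rewrite -ltNge; apply: le_lt_trans (lerD gl1 h) _.
by rewrite -subr_gt0 (_ : _ - _ = mu)//; ring.
Qed.

End GelfandMazur.

(** The infimum of g is 0 by [pencil_inf_eq0]. It is attained because |l - m| = p ((l - m) b) <= g l
    + g m, so that near-minimizers converge among the scalars; no completeness of A is involved. *)
Lemma psn_eigenvalue p b x : power_seminorm p -> p b = 1 ->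
  (forall x y, p (mul x y) = p x * p y) -> exists l, p (x - l *: b) = 0.
Proof.
move=> ps pb pM; pose g l := p (x - l *: b).
have g0 l : 0 <= g l by exact: psn_ge0.
have N0 : [set: R[i]] !=set0 by exists 0.
have e0 : infv setT g = 0.
  apply/eqP; rewrite eq_le infv_ge0// andbT leNgt; apply/negP.
  exact: pencil_inf_eq0.
have pD l m : (l - m) *: b = (x - m *: b) - (x - l *: b).
  by rewrite opprB [RHS]addrC addrA subrK scalerBl.
have [l hl] : exists l, forall z, cn (l - z) <= 2 * g z.
  apply: (complex_limit (z := id) 0) => z w /=.
  by rewrite -[cn _]mulr1 -pb -psn_Z// pD [leRHS]addrC; exact: (psn_B ps).
exists l; apply/le_anti; rewrite psn_ge0// andbT.
rewrite -(mulr0 3) -e0; apply: le_mulr_infv => // z _.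
have -> : x - l *: b = (x - z *: b) - (l - z) *: b.
  by rewrite scalerBl opprB addrA subrK.
apply: le_trans (psn_B ps _ _) _; rewrite psn_Z// pb mulr1.
by have := hl z; rewrite /g /=; lra.
Qed.

Definition is_character (chi : A -> R[i]) : Prop :=
  [/\ scalar chi, forall x y, chi (mul x y) = chi x * chi y &
      forall x, cn (chi x) <= rnorm x].

(** Modulo the kernel of p the algebra is spanned by b, with coordinate [eig]. As b need not be
    idempotent there, [eig] is multiplicative only up to the unimodular constant [eig (mul b b)],
    and multiplying by this constant gives a character. *)
Lemma exists_character_norm1 b : rnorm b = 1 ->
  exists2 chi, is_character chi & cn (chi b) = 1.
Proof.
move=> /exists_multiplicative_seminorm[p [ps pb pM]].
have /choice[eig heig] : forall x, exists l, p (x - l *: b) = 0.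
  by move=> x; exact: psn_eigenvalue.
have eig_uniq x l : p (x - l *: b) = 0 -> l = eig x.
  move=> e; apply/eqP; rewrite -subr_eq0 -cn_eq0 -[cn _]mulr1 -pb -psn_Z//.
  have -> : (l - eig x) *: b = (x - eig x *: b) - (x - l *: b).
    by rewrite opprB [RHS]addrC addrA subrK scalerBl.
  by rewrite eq_le psn_ge0// andbT (le_trans (psn_B ps _ _))// heig e addr0.
have eig_lin : scalar eig.
  move=> k x y; apply/esym/eig_uniq/le_anti; rewrite psn_ge0// andbT.
  have -> : k *: x + y - (k * eig x + eig y) *: b =
            k *: (x - eig x *: b) + (y - eig y *: b).
    by rewrite scalerDl opprD addrACA scalerBr scalerA.
  by apply: le_trans (psn_D ps _ _) _; rewrite psn_Z// !heig mulr0 addr0.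
have eigM x y : eig (mul x y) = eig (mul b b) * (eig x * eig y).
  apply/esym/eig_uniq/le_anti; rewrite psn_ge0// andbT.
  have -> : mul x y - (eig (mul b b) * (eig x * eig y)) *: b =
      mul (x - eig x *: b) y + eig x *: mul b (y - eig y *: b) +
      (eig x * eig y) *: (mul b b - eig (mul b b) *: b).
    have E (u v w t : A) : u - t = (u - v) + (v - w) + (w - t).
      by rewrite !addrA !subrK.
    rewrite (E _ (eig x *: mul b y) ((eig x * eig y) *: mul b b)).
    congr (_ + _ + _).
    - by rewrite mulDl -!scaleNr mulZl.
    - by rewrite mulDr -!scaleNr mulZr scalerDr scalerA mulrN scaleNr.
    - by rewrite scalerBr scalerA (mulrC (eig (mul b b))).
  apply: le_trans (psn_D ps _ _) _; rewrite psn_Z// heig mulr0 addr0.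
  apply: le_trans (psn_D ps _ _) _; rewrite psn_Z// !pM !heig.
  by rewrite mul0r !mulr0 addr0.
have cn_eig x : p x = cn (eig x) by exact: psn_eigen (heig x).
have bb : cn (eig (mul b b)) = 1 by rewrite -cn_eig psn_sq// pb expr1n.
exists (fun x => eig (mul b b) * eig x); last by rewrite cnM bb -cn_eig pb mulr1.
split=> [k x y|x y|x].
- by rewrite eig_lin mulrDr mulrCA.
- by rewrite (eigM x y); ring.
- by rewrite cnM bb mul1r -cn_eig; exact: psn_le.
Qed.

Lemma exists_norming_character b :
  exists2 chi, is_character chi & cn (chi b) = rnorm b.
Proof.
have [->|b0] := eqVneq b 0.
  exists (fun=> 0); last by rewrite rnorm0 cn0.
  by split=> [k x y|x y|x]; rewrite ?mulr0 ?addr0// cn0.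
have bn : rnorm b != 0 by rewrite rnorm_eq0.
have n1 : rnorm ((rnorm b)^-1%:C *: b) = 1.
  by rewrite rnormZ cn_real ger0_norm ?invr_ge0// mulVf.
have [chi [lin chiM le_chi] e] := exists_character_norm1 n1.
exists chi => //; have := lin (rnorm b)^-1%:C b 0.
have -> : chi 0 = 0.
  have := lin 1 0 0; rewrite scale1r mul1r addr0.
  by move=> /(congr1 (+%R^~ (- chi 0))); rewrite addrK subrr.
rewrite !addr0 => h; move: e; rewrite h cnM cn_real ger0_norm ?invr_ge0//.
by move=> /(congr1 ( *%R (rnorm b))); rewrite mulVKf// mulr1.
Qed.

End Characters.

(** * Operator spaces given by families of matrix-valued maps, and the algebra [min A] *)

Section ScalarMaps.
Variables (R : realType) (V : lmodType R[i]) (f : V -> R[i]).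
Hypothesis lf : scalar f.

Lemma scalar0 : f 0 = 0.
Proof.
have := lf 1 0 0; rewrite scale1r mul1r addr0.
by move=> /(congr1 (+%R^~ (- f 0))); rewrite addrK subrr.
Qed.

Lemma scalarD x y : f (x + y) = f x + f y.
Proof. by have := lf 1 x y; rewrite scale1r mul1r. Qed.

Lemma scalarZ c x : f (c *: x) = c * f x.
Proof. by have := lf c x 0; rewrite scalar0 !addr0. Qed.

Lemma scalarN x : f (- x) = - f x.
Proof. by rewrite -scaleN1r scalarZ mulN1r. Qed.

Lemma scalarB x y : f (x - y) = f x - f y.
Proof. by rewrite scalarD scalarN. Qed.

Lemma scalar_sum (I : Type) (r : seq I) (P : pred I) (F : I -> V) :
  f (\sum_(i <- r | P i) F i) = \sum_(i <- r | P i) f (F i).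
Proof. exact: (big_morph f scalarD scalar0). Qed.

End ScalarMaps.

Section BilinearForms.
Variable R : realType.
Implicit Types I J K L : finType.

Lemma opbD I J (X Y : I -> J -> R[i]) C C' : opb X C -> opb Y C' ->
  opb (fun i j => X i j + Y i j) (C + C').
Proof.
move=> hX hY v u; rewrite (_ : bil _ v u = bil X v u + bil Y v u).
  by apply: le_trans (cnD _ _) _; rewrite !mulrDl lerD.
rewrite /bil -big_split; apply: eq_bigr => i _; rewrite -big_split.
by apply: eq_bigr => j _; rewrite mulrDr mulrDl.
Qed.

Lemma opbZ I J (X : I -> J -> R[i]) c C : opb X C ->
  opb (fun i j => c * X i j) (cn c * C).
Proof.
move=> hX v u; rewrite (_ : bil _ v u = c * bil X v u).
  by rewrite cnM -!mulrA ler_wpM2l// mulrA.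
rewrite /bil mulr_sumr; apply: eq_bigr => i _; rewrite mulr_sumr.
by apply: eq_bigr => j _; rewrite mulrCA !mulrA.
Qed.

Lemma eq_opb I J (X Y : I -> J -> R[i]) C : (forall i j, X i j = Y i j) ->
  opb X C -> opb Y C.
Proof.
move=> e hX v u; rewrite (_ : bil Y v u = bil X v u)//.
by apply: eq_bigr => i _; apply: eq_bigr => j _; rewrite e.
Qed.

Lemma bil_delta I J (X : I -> J -> R[i]) i j :
  bil X (fun i' => (i' == i)%:R) (fun j' => (j' == j)%:R) = X i j.
Proof.
rewrite /bil (bigD1 i)//= (bigD1 j)//= !eqxx mul1r mulr1 !big1 ?addr0//.
  by move=> k /negPf ki; apply: big1 => l _; rewrite ki !mul0r.
by move=> l /negPf lj; rewrite lj mulr0.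
Qed.

Lemma opb_entry I J (X : I -> J -> R[i]) C i j : opb X C -> cn (X i j) <= C.
Proof.
by move=> /(_ (fun i' => (i' == i)%:R) (fun j' => (j' == j)%:R)); rewrite bil_delta !l2_delta !mulr1.
Qed.

Lemma l2_pairE I K (u : I * K -> R[i]) : l2 u ^+ 2 = \sum_k l2 (fun i => u (i, k)) ^+ 2.
Proof.
rewrite l2_sqr; under [RHS]eq_bigr do rewrite l2_sqr.
by rewrite exchange_big pair_big /=; apply: eq_bigr => -[].
Qed.

Lemma l2_le I J (u : I -> R[i]) (v : J -> R[i]) C : 0 <= C ->
  l2 u ^+ 2 <= C ^+ 2 * l2 v ^+ 2 -> l2 u <= C * l2 v.
Proof. by move=> C0; rewrite -exprMn ler_pXn2r ?nnegrE ?mulr_ge0. Qed.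

Lemma opb_vec_pair I J K (X : I -> J -> R[i]) C (u : J * K -> R[i]) : 0 <= C ->
  opb X C -> l2 (fun p : I * K => \sum_j X p.1 j * u (j, p.2)) <= C * l2 u.
Proof.
move=> C0 hX; apply: l2_le => //; rewrite !l2_pairE mulr_sumr.
apply: ler_sum => k _; rewrite -exprMn ler_pXn2r ?nnegrE ?mulr_ge0//=.
exact: opb_vec.
Qed.

Lemma opb_vecl_pair I J K (X : I -> J -> R[i]) C (v : I * K -> R[i]) : 0 <= C ->
  opb X C -> l2 (fun p : J * K => \sum_i v (i, p.2) * X i p.1) <= C * l2 v.
Proof.
move=> C0 hX; apply: l2_le => //; rewrite !l2_pairE mulr_sumr.
apply: ler_sum => k _; rewrite -exprMn ler_pXn2r ?nnegrE ?mulr_ge0//=.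
exact: opb_vecl.
Qed.

Lemma big_pair (V : nmodType) I K (f : I * K -> V) :
  \sum_p f p = \sum_i \sum_k f (i, k).
Proof. by rewrite pair_bigA; apply: eq_bigr => -[]. Qed.

Lemma big_split_ord_pair (V : nmodType) m n K (f : 'I_(m + n) * K -> V) :
  \sum_p f p = \sum_(p : 'I_m * K) f (lshift n p.1, p.2) +
               \sum_(p : 'I_n * K) f (rshift m p.1, p.2).
Proof. by rewrite !big_pair big_split_ord. Qed.

Lemma bil_mull I J K L (X : I -> L -> R[i]) (N : L * K -> J -> R[i]) v u :
  bil (fun (p : I * K) q => \sum_a X p.1 a * N (a, p.2) q) v u =
  bil N (fun a => \sum_i v (i, a.2) * X i a.1) u.
Proof.
pose h p := \sum_q N p q * u q.
transitivity (\sum_r \sum_a \sum_i v (i, r) * X i a * h (a, r)); last first.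
  rewrite exchange_big bilE big_pair; apply: eq_bigr => a _; apply: eq_bigr => r _.
  by rewrite -/(h _) mulr_suml.
rewrite bilE big_pair exchange_big; apply: eq_bigr => r _; rewrite exchange_big /=.
apply: eq_bigr => i _; rewrite /h mulr_sumr.
transitivity (\sum_j \sum_a v (i, r) * X i a * (N (a, r) j * u j)).
  apply: eq_bigr => j _; rewrite mulr_suml mulr_sumr; apply: eq_bigr => a _.
  by rewrite !mulrA.
by rewrite exchange_big; apply: eq_bigr => a _; rewrite mulr_sumr.
Qed.

End BilinearForms.

Lemma le_add_mul_sqrt (R : realType) (a b c d x y : R) :
  0 <= a -> 0 <= b -> 0 <= c -> 0 <= d -> 0 <= x -> 0 <= y ->
  x ^+ 2 = a ^+ 2 + b ^+ 2 -> y ^+ 2 = c ^+ 2 + d ^+ 2 -> a * c + b * d <= x * y.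
Proof.
move=> a0 b0 c0 d0 x0 y0 ex ey.
rewrite -(ler_pXn2r (ltn0Sn 1)) ?nnegrE ?addr_ge0 ?mulr_ge0// exprMn ex ey.
have := sqr_ge0 (a * d - b * c); nra.
Qed.

Section ConcreteOperatorSpace.
Variables (R : realType) (E : completeNormedModType R[i]).
Variables (nu : matrix_norms R E) (J : Type) (D : set J) (m : J -> nat).
Variable t : forall j : J, E -> 'I_(m j) -> 'I_(m j) -> R[i].

Arguments nu : clear implicits.
Arguments t : clear implicits.

Definition amplify (j : J) (I : finType) (x : I -> I -> E) (p q : I * 'I_(m j)) :=
  t j (x p.1 q.1) p.2 q.2.

Hypothesis t_lin : forall j k l, D j -> scalar (fun x => t j x k l).
Hypothesis nu_ge0 : forall n x, 0 <= nu n x.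
Hypothesis nuP : forall n (x : 'M[E]_n) C, 0 <= C ->
  nu n x <= C <-> forall j, D j -> opb (amplify (j := j) x) C.
Hypothesis nu_norm1 : forall x : E, nu 1 (const_mx x) = rnorm x.

Lemma nu_opb n (x : 'M[E]_n) j : D j -> opb (amplify (j := j) x) (nu n x).
Proof. by move=> Dj; have [h _] := nuP x (nu_ge0 x); apply: h. Qed.

Lemma bil_amplify_block j p q (x : 'M[E]_p) (y : 'M[E]_q) v u : D j ->
  bil (amplify (j := j) (block_mx x 0 0 y)) v u =
  bil (amplify (j := j) x) (fun a => v (lshift q a.1, a.2)) (fun a => u (lshift q a.1, a.2)) +
  bil (amplify (j := j) y) (fun a => v (rshift p a.1, a.2)) (fun a => u (rshift p a.1, a.2)).
Proof.
move=> Dj; rewrite {1}/bil big_split_ord_pair; congr (_ + _); apply: eq_bigr => a _.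
  rewrite big_split_ord_pair [X in _ + X]big1 ?addr0 => [|b _].
    by apply: eq_bigr => b _; rewrite /amplify /= block_mxEul.
  by rewrite /amplify /= block_mxEur mxE (scalar0 (t_lin _ _ Dj)) mulr0 mul0r.
rewrite big_split_ord_pair [X in X + _]big1 ?add0r => [|b _].
  by apply: eq_bigr => b _; rewrite /amplify /= block_mxEdr.
by rewrite /amplify /= block_mxEdl mxE (scalar0 (t_lin _ _ Dj)) mulr0 mul0r.
Qed.

Lemma l2_block_pair p q (K : finType) (v : 'I_(p + q) * K -> R[i]) :
  l2 v ^+ 2 = l2 (fun a : 'I_p * K => v (lshift q a.1, a.2)) ^+ 2 +
              l2 (fun a : 'I_q * K => v (rshift p a.1, a.2)) ^+ 2.
Proof. by rewrite !l2_sqr big_split_ord_pair. Qed.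

Lemma bil_amplify_bimul j p q (X : 'M[R[i]]_(p, q)) (x : 'M[E]_q) (Y : 'M[R[i]]_(q, p)) v u :
  D j -> bil (amplify (j := j) (mx_bimul X x Y)) v u =
  bil (amplify (j := j) x)
    (fun a => \sum_i v (i, a.2) * X i a.1) (fun a => \sum_i Y a.1 i * u (i, a.2)).
Proof.
move=> Dj; pose N a q := \sum_b Y b q.1 * amplify (j := j) x a (b, q.2).
transitivity (bil (fun (p0 : 'I_p * 'I_(m j)) (q0 : 'I_p * 'I_(m j)) =>
    \sum_a X p0.1 a * N (a, p0.2) q0) v u).
  apply: eq_bigr => -[i r] _; apply: eq_bigr => -[k s] _; congr (_ * _ * _).
  rewrite /amplify /= mxE (scalar_sum (t_lin _ _ Dj)); apply: eq_bigr => a _.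
  rewrite (scalar_sum (t_lin _ _ Dj)) /N mulr_sumr; apply: eq_bigr => b _.
  by rewrite (scalarZ (t_lin _ _ Dj)) /= -mulrA.
rewrite bil_mull bil_tr (bil_mull (fun i b => Y b i) (fun b a => amplify (j := j) x a b)).
rewrite bil_tr /bil; apply: eq_bigr => a _; apply: eq_bigr => b _; congr (_ * _).
by apply: eq_bigr => i _; rewrite mulrC.
Qed.

(** The amplifications of the maps [t j] are scalar matrices, where Ruan's axioms are properties of
    the operator norm. It serves twice: for [min_norms], with functionals as [t j], and for the
    norms on the dual of a space of forms. *)
Lemma concrete_operator_space : is_operator_space nu.
Proof.
have nuZ n c (x : 'M[E]_n) : nu n (map_mx ( *:%R c) x) <= cn c * nu n x.
  apply/nuP => [|j Dj]; first by rewrite mulr_ge0.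
  apply: eq_opb (opbZ c (nu_opb x Dj)) => p q.
  by rewrite /amplify mxE (scalarZ (t_lin _ _ Dj)).
split=> //.
- move=> n x y; apply/nuP => [|j Dj]; first by rewrite addr_ge0.
  apply: eq_opb (opbD (nu_opb x Dj) (nu_opb y Dj)) => p q.
  by rewrite /amplify mxE (scalarD (t_lin _ _ Dj)).
- move=> n c x; apply/le_anti; rewrite -/(cn c) [X in X && _]nuZ /=.
  have [->|c0] := eqVneq c 0; first by rewrite cn0 mul0r.
  have cp : 0 < cn c by rewrite lt_def cn_eq0 c0 cn_ge0.
  rewrite -ler_pdivlMl// -cnV; apply: le_trans (nuZ _ _ _).
  rewrite (_ : map_mx _ _ = x)//.
  by apply/matrixP => i k; rewrite !mxE scalerA mulVf// scale1r.
- move=> n x x0; apply/matrixP => i k; rewrite mxE; apply: rnorm0_eq0.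
  apply/le_anti; rewrite rnorm_ge0 andbT -nu_norm1; apply/nuP => // j Dj v u.
  have z r s : t j (x i k) r s = 0.
    apply: cn0_eq0; apply/le_anti; rewrite cn_ge0 andbT -x0.
    exact: (opb_entry (i, r) (k, s) (nu_opb x Dj)).
  rewrite /bil big1 ?cn0 ?mul0r// => p _; rewrite big1// => q _.
  by rewrite /amplify mxE z mulr0 mul0r.
- move=> p q x y; apply/le_anti/andP; split.
    apply/nuP => [|j Dj v u]; first by rewrite le_max nu_ge0.
    rewrite bil_amplify_block//; apply: le_trans (cnD _ _) _.
    apply: le_trans (lerD (nu_opb x Dj _ _) (nu_opb y Dj _ _)) _.
    set a := l2 _; set b := l2 _; set c := l2 _; set d := l2 _.
    have [a0 b0 c0 d0] : [/\ 0 <= a, 0 <= b, 0 <= c & 0 <= d] by split; exact: l2_ge0.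
    (* Both blocks are bounded by the maximum; the remaining sum a b + c d falls to Cauchy-Schwarz
       in two dimensions, because the vectors split orthogonally. *)
    apply: (@le_trans _ _ (Num.max (nu p x) (nu q y) * (a * b + c * d))).
      rewrite mulrDr -!mulrA; apply: lerD; rewrite ler_wpM2r ?mulr_ge0//.
        by rewrite le_max lexx.
      by rewrite le_max lexx orbT.
    rewrite -mulrA ler_wpM2l ?le_max ?nu_ge0//.
    by apply: le_add_mul_sqrt => //; exact: l2_block_pair.
  (* Extension of vectors by zero exhibits each block as a compression of the block matrix. *)
  pose ext (r s : nat) (K : finType) (f : 'I_r + 'I_s -> K -> R[i]) (a : 'I_(r + s) * K) :=
    f (fintype.split a.1) a.2.
  have splitl r s (i : 'I_r) : fintype.split (lshift s i) = inl i.
    exact: (unsplitK (inl i : 'I_r + 'I_s)).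
  have splitr r s (i : 'I_s) : fintype.split (rshift r i) = inr i.
    exact: (unsplitK (inr i : 'I_r + 'I_s)).
  rewrite ge_max; apply/andP; split; apply/nuP => // j Dj v u.
    pose w (v : 'I_p * 'I_(m j) -> R[i]) :=
      @ext p q _ (fun i k => if i is inl i then v (i, k) else 0).
    have wl v1 a : w v1 (lshift q a.1, a.2) = v1 a by rewrite /w /ext /= splitl; case: a.
    have wr v1 a : w v1 (rshift p a.1, a.2) = 0 by rewrite /w /ext /= splitr.
    have wn v1 : l2 (w v1) = l2 v1.
      apply/eqP; rewrite -(eqrXn2 (ltn0Sn 1))//; apply/eqP.
      rewrite l2_block_pair (eq_l2 (wl v1)) (eq_l2 (wr v1)) [X in _ + X]l2_sqr.
      by rewrite big1 ?addr0// => i _; rewrite cn0 expr0n.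
    have := nu_opb (block_mx x 0 0 y) Dj (w v) (w u).
    rewrite !wn bil_amplify_block// [X in cn (_ + X)]big1 ?addr0.
      congr (cn _ <= _); apply: eq_bigr => a _; apply: eq_bigr => b _.
      by rewrite !wl.
    by move=> a _; apply: big1 => b _; rewrite wr !mul0r.
  pose w (v : 'I_q * 'I_(m j) -> R[i]) :=
    @ext p q _ (fun i k => if i is inr i then v (i, k) else 0).
  have wl v1 a : w v1 (lshift q a.1, a.2) = 0 by rewrite /w /ext /= splitl.
  have wr v1 a : w v1 (rshift p a.1, a.2) = v1 a by rewrite /w /ext /= splitr; case: a.
  have wn v1 : l2 (w v1) = l2 v1.
    apply/eqP; rewrite -(eqrXn2 (ltn0Sn 1))//; apply/eqP.
    rewrite l2_block_pair (eq_l2 (wl v1)) (eq_l2 (wr v1)) [X in X + _]l2_sqr.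
    by rewrite big1 ?add0r// => i _; rewrite cn0 expr0n.
  have := nu_opb (block_mx x 0 0 y) Dj (w v) (w u).
  rewrite !wn bil_amplify_block// [X in cn (X + _)]big1 ?add0r.
    congr (cn _ <= _); apply: eq_bigr => a _; apply: eq_bigr => b _.
    by rewrite !wr.
  by move=> a _; apply: big1 => b _; rewrite wl !mul0r.
- move=> p q X x Y; apply/nuP => [|j Dj v u]; first by rewrite !mulr_ge0.
  rewrite bil_amplify_bimul//; apply: le_trans (nu_opb x Dj _ _) _.
  apply: (@le_trans _ _ (nu q x * (mx_opnorm X * l2 v) * (mx_opnorm Y * l2 u))).
    apply: ler_pM; rewrite ?mulr_ge0 ?l2_ge0//.
      by rewrite ler_wpM2l//; exact: (opb_vecl_pair _ _ (mx_opnormP X)).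
    exact: (opb_vec_pair _ _ (mx_opnormP Y)).
  by apply: le_of_eq; ring.
Qed.

End ConcreteOperatorSpace.

Section DualNorm.
Variables (R : realType) (E : normedModType R[i]).
Implicit Types (phi : E -> R[i]) (x : E) (C : R).

Lemma le_norm_bound phi x C :
  (`|phi x| <= C%:C * `|x|) = (cn (phi x) <= C * rnorm x).
Proof. by rewrite cnE rnormE -real_complexM lecR. Qed.

Lemma dual_bounded phi : dual phi -> exists2 C, 0 <= C & forall x, cn (phi x) <= C * rnorm x.
Proof.
move=> [_ [M hM]]; exists (Num.max M 0) => [|x]; first by rewrite le_max lexx orbT.
have := hM x; rewrite le_norm_bound => /le_trans; apply.
by rewrite ler_wpM2r// le_max lexx.
Qed.

Lemma dual_intro phi C : scalar phi -> (forall x, cn (phi x) <= C * rnorm x) -> dual phi.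
Proof. by move=> l h; split=> //; exists C => x; rewrite le_norm_bound. Qed.

Lemma dual_norm_le phi C : 0 <= C -> (forall x, cn (phi x) <= C * rnorm x) ->
  dual_norm phi <= C.
Proof.
move=> C0 h; apply: ge_sup; first by exists (cn (phi 0)), 0; rewrite ?rnorm0.
by move=> _ [x x1 ->]; apply: le_trans (h x) _; rewrite -[leRHS]mulr1 ler_wpM2l.
Qed.

Lemma le_dual_norm phi x : dual phi -> cn (phi x) <= dual_norm phi * rnorm x.
Proof.
move=> dphi; have [C C0 hC] := dual_bounded dphi.
have ub y : rnorm y <= 1 -> cn (phi y) <= dual_norm phi.
  move=> y1; apply: ub_le_sup; last by exists y.
  by exists C => _ [z z1 ->]; apply: le_trans (hC z) _; rewrite -[leRHS]mulr1 ler_wpM2l.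
have [->|x0] := eqVneq x 0.
  by rewrite (scalar0 dphi.1) cn0 rnorm0 mulr0.
have xp : 0 < rnorm x by rewrite lt_def rnorm_eq0 x0 rnorm_ge0.
have := ub ((rnorm x)^-1%:C *: x).
rewrite rnormZ cn_real ger0_norm ?invr_ge0// mulVf ?gt_eqF// => /(_ (lexx _)).
rewrite (scalarZ dphi.1) cnM cn_real ger0_norm ?invr_ge0//.
by rewrite ler_pdivrMl// mulrC.
Qed.

Lemma dual_ball phi x : dual phi -> dual_norm phi <= 1 -> cn (phi x) <= rnorm x.
Proof.
move=> dphi h; apply: le_trans (le_dual_norm _ dphi) _.
by rewrite -[leRHS]mul1r ler_wpM2r.
Qed.

End DualNorm.

Section MinNorms.
Variables (R : realType) (E : completeNormedModType R[i]).

(** A crude bound, but uniform in phi: it shows that the supremum defining [min_norms] is finite. *)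
Lemma opb_functional n (x : 'M[E]_n) (phi : E -> R[i]) :
  scalar phi -> (forall y, cn (phi y) <= rnorm y) ->
  opb (fun i j => phi (x i j)) (\sum_i \sum_j rnorm (x i j)).
Proof.
move=> lphi h v u; apply: le_trans (cn_sum _ _ _) _.
rewrite -mulrA mulr_suml; apply: ler_sum => i _.
apply: le_trans (cn_sum _ _ _) _; rewrite mulr_suml; apply: ler_sum => j _.
rewrite !cnM mulrAC mulrC ler_pM ?mulr_ge0//.
have le_l2 (I : finType) (w : I -> R[i]) k : cn (w k) <= l2 w.
  rewrite -(ler_pXn2r (ltn0Sn 1)) ?nnegrE// l2_sqr (bigD1 k)//= lerDl.
  by apply: sumr_ge0 => i' _; rewrite sqr_ge0.
by rewrite ler_pM.
Qed.

Lemma min_normsP n (x : 'M[E]_n) C : 0 <= C -> min_norms x <= C <->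
  forall phi, dual phi -> dual_norm phi <= 1 -> opb (fun i j => phi (x i j)) C.
Proof.
move=> C0; split=> [h phi dphi phi1|h].
  apply: (@eq_opb _ _ _ (fun i j => map_mx phi x i j)) => [i j|]; first by rewrite mxE.
  apply/opb_le_opnorm => //; apply: le_trans h; apply: ub_le_sup; last by exists phi.
  exists (\sum_i \sum_j rnorm (x i j)) => _ [psi [dpsi psi1 ->]].
  apply: mx_opnorm_le; first by do 2! (apply: sumr_ge0 => ? _).
  apply: (eq_opb (X := fun i j => psi (x i j))) => [i j|]; first by rewrite mxE.
  by apply: opb_functional => [|y]; [exact: dpsi.1|exact: dual_ball].
apply: ge_sup => [|_ [phi [dphi phi1 ->]]].
  have z0 : forall y : E, cn ((fun=> 0 : R[i]) y) <= 0 * rnorm y by move=> y; rewrite cn0 mul0r.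
  exists (mx_opnorm (map_mx (fun=> 0) x)), (fun=> 0); split=> //.
    by apply: (dual_intro _ z0) => c a b; rewrite mulr0 addr0.
  by apply: le_trans (dual_norm_le _ z0) _.
apply: mx_opnorm_le => //.
by apply: eq_opb (h phi dphi phi1) => i j; rewrite mxE.
Qed.

Lemma min_norms_ge0 n (x : 'M[E]_n) : 0 <= min_norms x.
Proof.
have z0 : forall y : E, cn ((fun=> 0 : R[i]) y) <= 0 * rnorm y by move=> y; rewrite cn0 mul0r.
apply: le_trans (mx_opnorm_ge0 (map_mx (fun=> 0) x)) _; apply: ub_le_sup.
  exists (\sum_i \sum_j rnorm (x i j)) => _ [psi [dpsi psi1 ->]].
  apply: mx_opnorm_le; first by do 2! (apply: sumr_ge0 => ? _).
  apply: (eq_opb (X := fun i j => psi (x i j))) => [i j|]; first by rewrite mxE.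
  by apply: opb_functional => [|y]; [exact: dpsi.1|exact: dual_ball].
exists (fun=> 0); split=> //.
  by apply: (dual_intro _ z0) => c a b; rewrite mulr0 addr0.
by apply: le_trans (dual_norm_le _ z0) _.
Qed.

Lemma min_norms_opb n (x : 'M[E]_n) phi : scalar phi ->
  (forall y, cn (phi y) <= rnorm y) -> opb (fun i j => phi (x i j)) (min_norms x).
Proof.
move=> lphi h; have [h1 _] := min_normsP x (min_norms_ge0 x); apply: h1 => //.
  by apply: (dual_intro lphi (C := 1)) => y; rewrite mul1r.
by apply: dual_norm_le => // y; rewrite mul1r.
Qed.

Hypothesis norming : forall x : E,
  exists2 phi : E -> R[i], dual phi /\ dual_norm phi <= 1 & cn (phi x) = rnorm x.

(** Functionals are 1 x 1 matrix-valued maps. The hypothesis [norming] recovers the given norm on 1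
    x 1 matrices; characters will supply it. *)
Lemma min_norms_operator_space : is_operator_space (@min_norms R E).
Proof.
pose D := [set phi : E -> R[i] | dual phi /\ dual_norm phi <= 1].
have bij n : bijective (fun i : 'I_n => (i, ord0 : 'I_1)).
  by exists fst => // -[i k]; rewrite (ord1 k).
apply: (@concrete_operator_space _ _ _ _ D (fun=> 1%N) (fun phi x _ _ => phi x)).
- by move=> phi _ _ [[]].
- by move=> n x; exact: min_norms_ge0.
- move=> n x C C0; rewrite min_normsP//; split=> [h phi [dphi phi1]|h phi dphi phi1].
    exact: (opb_reindex (bij n) (bij n) (h phi dphi phi1)).
  have bpr : bijective (@fst 'I_n 'I_1).
    by exists (fun i : 'I_n => (i, ord0 : 'I_1)) => // -[i k]; rewrite (ord1 k).
  exact: (opb_reindex bpr bpr (h phi (conj dphi phi1))).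
move=> x; apply/le_anti/andP; split.
  apply/min_normsP => // phi dphi phi1 v u.
  rewrite /bil !big_ord1 mxE !cnM /l2 !big_ord1 !sqrtr_sqr !ger0_norm// mulrAC.
  by rewrite mulrC -mulrA ler_wpM2r ?mulr_ge0//; exact: dual_ball.
have [phi [dphi phi1] <-] := norming x.
pose X := const_mx x : 'M[E]_1.
have h := (min_normsP X (min_norms_ge0 X)).1 (lexx _) phi dphi phi1.
by have := opb_entry ord0 ord0 h; rewrite mxE.
Qed.

End MinNorms.

Section UniformAlgebra.
Variables (R : realType) (A : completeNormedModType R[i]) (mul : A -> A -> A).
Hypothesis hA : uniform_algebra mul.

Lemma uniform_algebra_banach : is_banach_algebra mul.
Proof.
case: hA => B [mulB [j [[[[lr ll] assB subB] comB _] isoj jM]]].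
have ji : injective j.
  move=> a b e; apply/eqP; rewrite -subr_eq0 -normr_eq0 -isoj linearB /= e subrr.
  by rewrite normr0.
split.
- by split=> a c x y; apply: ji; rewrite linearP !jM linearP ?lr ?ll.
- by move=> a b c; apply: ji; rewrite !jM assB.
- by move=> a b; rewrite -!isoj jM.
Qed.

Lemma uniform_algebra_comm : commutative mul.
Proof.
case: hA => B [mulB [j [[[[lr ll] assB subB] comB _] isoj jM]]] a b.
apply/eqP; rewrite -subr_eq0 -normr_eq0 -isoj linearB /= !jM comB subrr.
by rewrite normr0.
Qed.

(** The C*-identity applied to b^2 and to the self-adjoint b^* b evaluates the norm of (b^* b)^2 in
    two ways, whence |b^2|^2 = |b|^4. *)
Lemma cstar_norm_sq (B : completeNormedModType R[i]) (mulB : B -> B -> B) :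
  commutative_cstar_algebra mulB -> forall b, rnorm (mulB b b) = rnorm b ^+ 2.
Proof.
move=> [[_ assB _] comB [star [_ starK starM starN]]] b.
have sN a : rnorm (mulB (star a) a) = rnorm a ^+ 2.
  by apply: complexI; rewrite -rnormE starN rnormE [RHS]real_complexM.
apply/eqP; rewrite -(eqrXn2 (ltn0Sn 1)) ?sqr_ge0//; apply/eqP.
rewrite -(sN (mulB b b)) starM.
have -> : mulB (mulB (star b) (star b)) (mulB b b) =
          mulB (mulB (star b) b) (mulB (star b) b).
  by rewrite -!assB; congr (mulB _ _); rewrite !assB (comB b).
have sh : star (mulB (star b) b) = mulB (star b) b by rewrite starM starK comB.
by rewrite -{1}sh sN sN.
Qed.

Lemma uniform_algebra_norm_sq a : rnorm (mul a a) = rnorm a ^+ 2.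
Proof.
case: hA => B [mulB [j [cB isoj jM]]].
have e b : rnorm b = rnorm (j b) by rewrite /rnorm isoj.
by rewrite !e jM (cstar_norm_sq cB).
Qed.

Lemma submult_rnorm : is_banach_algebra mul ->
  forall a b, rnorm (mul a b) <= rnorm a * rnorm b.
Proof. by move=> [_ _ h] a b; rewrite -lecR real_complexM -!rnormE. Qed.

Lemma uniform_algebra_character a :
  exists2 chi, is_character mul chi & cn (chi a) = rnorm a.
Proof.
have [bl ass sub] := uniform_algebra_banach.
apply: exists_norming_character => //.
- exact: uniform_algebra_comm.
- exact: submult_rnorm uniform_algebra_banach.
- exact: uniform_algebra_norm_sq.
Qed.

Lemma character_dual chi : is_character mul chi -> dual chi /\ dual_norm chi <= 1.
Proof.
move=> [lin _ le1]; split.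
  by apply: (dual_intro lin (C := 1)) => y; rewrite mul1r.
by apply: dual_norm_le => // y; rewrite mul1r.
Qed.

(** Pairing the matrix with vectors gives the value of phi at the single element with coefficients v
    i * u j, and some character attains the norm of that element. *)
Lemma min_norms_le_character n (x : 'M[A]_n) C : 0 <= C ->
  (forall chi, is_character mul chi -> opb (fun i j => chi (x i j)) C) ->
  min_norms x <= C.
Proof.
move=> C0 h; apply/min_normsP => // phi dphi phi1 v u.
have e psi : scalar psi ->
    bil (fun i j => psi (x i j)) v u = psi (\sum_i \sum_j (v i * u j) *: x i j).
  move=> lpsi; rewrite (scalar_sum lpsi); apply: eq_bigr => i _.
  rewrite (scalar_sum lpsi); apply: eq_bigr => j _; rewrite (scalarZ lpsi); ring.
rewrite e; last exact: dphi.1.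
apply: le_trans (dual_ball _ dphi phi1) _.
have [chi hchi <-] := uniform_algebra_character (\sum_i \sum_j (v i * u j) *: x i j).
by rewrite -e; [exact: h | case: hchi].
Qed.

(** Contract v with X in the first index; what is left is Y on each slice j, and Cauchy-Schwarz sums
    the slices. *)
Lemma opb_tens (I J K L : finType) (X : I -> J -> R[i]) (Y : K -> L -> R[i]) a b :
  0 <= a -> 0 <= b -> opb X a -> opb Y b ->
  opb (fun (p : I * K) (q : J * L) => X p.1 q.1 * Y p.2 q.2) (a * b).
Proof.
move=> a0 b0 hX hY v u.
pose w (p : J * K) := \sum_i v (i, p.2) * X i p.1.
have -> : bil (fun (p : I * K) (q : J * L) => X p.1 q.1 * Y p.2 q.2) v u =
    \sum_j bil Y (fun k => w (j, k)) (fun l => u (j, l)).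
  rewrite (_ : bil _ v u = bil (fun (p : I * K) q =>
    \sum_j X p.1 j * ((j == q.1)%:R * Y p.2 q.2)) v u).
    rewrite (bil_mull X (fun (r : J * K) (q : J * L) => (r.1 == q.1)%:R * Y r.2 q.2)).
    rewrite {1}/bil big_pair; apply: eq_bigr => j _; apply: eq_bigr => k _.
    rewrite big_pair (bigD1 j)//= [X in _ + X]big1 ?addr0 => [|j' /negPf j'j].
      by apply: eq_bigr => l _; rewrite eqxx mul1r.
    by apply: big1 => l _; rewrite eq_sym j'j mul0r mulr0 mul0r.
  apply: eq_bigr => p _; apply: eq_bigr => q _; congr (_ * _ * _).
  rewrite (bigD1 q.1)//= eqxx mul1r big1 ?addr0// => j /negPf jq.
  by rewrite jq mul0r mulr0.
apply: le_trans (cn_sum _ _ _) _.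
apply: (@le_trans _ _ (\sum_j b * (l2 (fun k => w (j, k)) * l2 (fun l => u (j, l))))).
  by apply: ler_sum => j _; rewrite mulrA; exact: hY.
rewrite -mulr_sumr (mulrC a) -!mulrA ler_wpM2l//.
apply: le_trans (sum_l2_l2 (fun j k => w (j, k)) (fun j l => u (j, l))) _.
rewrite mulrA ler_pM//.
  rewrite (eq_l2 (v := w)); last by case.
  exact: (opb_vecl_pair v a0 hX).
by rewrite (eq_l2 (v := u)) //; case.
Qed.

(** A character turns the amplified product into a Kronecker product of scalar matrices, and
    [opb_tens] bounds it. This makes [min_norms] one of the structures quantified over in (ii). *)
Lemma min_norms_cc_banach_algebra : is_cc_banach_algebra mul (@min_norms R A).
Proof.
split.
- exact: uniform_algebra_banach.
- apply: min_norms_operator_space => x.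
  have [chi hchi e] := uniform_algebra_character x; exists chi => //.
  exact: character_dual hchi.
move=> p q x y; rewrite mul1r; apply: min_norms_le_character => [|chi hchi].
  by rewrite mulr_ge0 ?min_norms_ge0.
have [lin chiM le1] := hchi.
have bu : bijective (@mxtens_unindex p q).
  by exists (@mxtens_index p q); [exact: mxtens_unindexK | exact: mxtens_indexK].
have bi : bijective (@mxtens_index p q).
  by exists (@mxtens_unindex p q); [exact: mxtens_indexK | exact: mxtens_unindexK].
apply: (opb_reindex bi bi).
apply: eq_opb (opb_tens (min_norms_ge0 x) (min_norms_ge0 y)
  (min_norms_opb x lin le1) (min_norms_opb y lin le1)) => -[i k] [j l] /=.
by rewrite !mxE !mxtens_indexK /= -chiM.
Qed.

End UniformAlgebra.

(** * Invariant and separating means *)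

Section HahnBanach.
Variables (R : realType) (X : lmodType R) (S : set X) (q : X -> R).
Hypothesis S0 : S 0.
Hypothesis SD : forall x y, S x -> S y -> S (x + y).
Hypothesis SZ : forall c x, S x -> S (c *: x).

Record sublinear (p : X -> R) : Prop := {
  sublinD : forall x y, S x -> S y -> p (x + y) <= p x + p y;
  sublinZ : forall c x, 0 < c -> S x -> p (c *: x) <= c * p x;
  sublin0 : p 0 = 0 }.

Hypothesis sq : sublinear q.

Let SN x : S x -> S (- x).
Proof. by move=> Sx; rewrite -scaleN1r; exact: SZ. Qed.

Lemma sublin_opp p x : sublinear p -> S x -> - p (- x) <= p x.
Proof.
move=> sp Sx; have := sublinD sp Sx (SN Sx).
by rewrite subrr sublin0//; lra.
Qed.

Lemma sublinZE p c x : sublinear p -> 0 < c -> S x -> p (c *: x) = c * p x.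
Proof.
move=> sp c0 Sx; apply/le_anti; rewrite sublinZ//= -ler_pdivlMl//.
have := sublinZ sp (_ : 0 < c^-1) (SZ c Sx).
by rewrite scalerA mulVf ?gt_eqF// scale1r invr_gt0; exact.
Qed.

(** In Zorn's lemma the infimum over a chain is finite because every member is bounded below by - q
    (- x). *)
Lemma minimal_sublinear : exists2 p,
  sublinear p /\ (forall x, S x -> p x <= q x) &
  forall r, sublinear r -> (forall x, S x -> r x <= p x) ->
    forall x, S x -> p x <= r x.
Proof.
pose T := {p | sublinear p /\ forall x, S x -> p x <= q x}.
pose le_sn (p r : T) := `[< forall x, S x -> sval r x <= sval p x >].
pose t0 : T := exist _ q (conj sq (fun x _ => lexx (q x))).
have [| | |[p [sp pq]] pmax] := @ZL_preorder T t0 le_sn.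
- by move=> t; apply/asboolP.
- move=> r s t /asboolP rs /asboolP st; apply/asboolP => x Sx.
  exact: le_trans (st x Sx) (rs x Sx).
- move=> C Ctot; have [C0|C0] := pselect (C = set0).
    by exists t0 => s; rewrite C0 => -[].
  have {}C0 : C !=set0 by apply/set0P/eqP.
  pose g x := infv C (fun t : T => sval t x).
  have gle x (t : T) : S x -> C t -> g x <= sval t x.
    move=> Sx Ct; apply: ge_inf; last by exists t.
    exists (- q (- x)) => _ [s _ <-]; case: s => s [ss sq'] /=.
    by apply: le_trans (sublin_opp ss Sx); rewrite lerN2 sq'//; exact: SN.
  have two (s t : T) : C s -> C t -> exists2 r, C r &
      forall x, S x -> sval r x <= sval s x /\ sval r x <= sval t x.
    move=> Cs Ct; have [/asboolP h|/asboolP h] := Ctot _ _ Cs Ct.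
      by exists t => // x Sx; rewrite h// lexx.
    by exists s => // x Sx; rewrite h// lexx.
  have g0 : g 0 = 0.
    apply/le_anti/andP; split.
      case: C0 => t Ct; apply: le_trans (gle _ _ S0 Ct) _.
      by have [st _] := svalP t; rewrite sublin0.
    by apply: le_infv => // -[t [st _]] _ /=; rewrite sublin0.
  have sg : sublinear g.
    split=> //.
    - move=> x y Sx Sy; apply: le_add_infv => // s t Cs Ct.
      have [r Cr h] := two _ _ Cs Ct.
      apply: le_trans (gle _ _ (SD Sx Sy) Cr) _; case: (svalP r) => rs _.
      apply: le_trans (sublinD rs Sx Sy) _.
      by have [h1 _] := h x Sx; have [_ h2] := h y Sy; rewrite lerD.
    - move=> c x c0 Sx; rewrite -ler_pdivrMl//; apply: le_infv => // t Ct.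
      rewrite ler_pdivrMl//; apply: le_trans (gle _ _ (SZ c Sx) Ct) _.
      by case: (svalP t) => ts _; exact: sublinZ.
  have gq x : S x -> g x <= q x.
    move=> Sx; case: C0 => t Ct; apply: le_trans (gle _ _ Sx Ct) _.
    by have [_ h] := svalP t; exact: h.
  by exists (exist _ g (conj sg gq)) => s Cs; apply/asboolP => x Sx; exact: gle.
exists p => // r sr rp x Sx.
have rq y : S y -> r y <= q y by move=> Sy; apply: le_trans (rp y Sy) (pq y Sy).
by have /asboolP := pmax (exist _ r (conj sr rq)) (asboolT rp); exact.
Qed.

(** For a minimal p and fixed y, the infimum r z over t >= 0 of p (z + t y) - t p y is sublinear and
    below p, hence equals p on [S]; at t = 1 this gives p x + p y <= p (x + y). The domain is a
    subset [S] so that it can be the bounded functions among all functions. *)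
Lemma hahn_banach : exists f : X -> R,
  [/\ forall x y, S x -> S y -> f (x + y) = f x + f y,
      forall c x, S x -> f (c *: x) = c * f x &
      forall x, S x -> f x <= q x].
Proof.
have [p [sp pq] pmin] := minimal_sublinear; exists p.
have pD x y : S x -> S y -> p (x + y) = p x + p y.
  move=> Sx Sy; apply/le_anti; rewrite sublinD//=.
  pose I := [set t : R | 0 <= t].
  have I0 : I !=set0 by exists 0; rewrite /I /=.
  pose f z t := p (z + t *: y) - t * p y.
  pose r z := infv I (f z).
  have rle z t : S z -> I t -> r z <= f z t.
    move=> Sz It; apply: ge_inf; last by exists t.
    exists (- p (- z)) => _ [s Is <-]; rewrite /f lerBrDr addrC.
    have Ssy : S (s *: y) by exact: SZ.
    have -> : s * p y = p (s *: y).
      have := Is; rewrite /I /= le_eqVlt => /orP[/eqP <-|s0]; last by rewrite sublinZE.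
      by rewrite scale0r mul0r sublin0.
    have := sublinD sp (SD Sz Ssy) (SN Sz).
    by rewrite addrAC subrr add0r; lra.
  have rp z : S z -> r z <= p z.
    move=> Sz; apply: le_trans (rle z 0 Sz _) _; first by rewrite /I /=.
    by rewrite /f scale0r addr0 mul0r subr0.
  have sr : sublinear r.
    have rD u v : S u -> S v -> r (u + v) <= r u + r v.
      move=> Su Sv; apply: le_add_infv => // s t Is It.
      apply: le_trans (rle (u + v) (s + t) (SD Su Sv) _) _.
        by rewrite /I /= addr_ge0.
      rewrite /f scalerDl mulrDl opprD addrACA [leRHS]addrACA lerD2r.
      by apply: sublinD => //; apply: SD => //; exact: SZ.
    split=> //.
    - move=> c u c0 Su; rewrite -ler_pdivrMl//; apply: le_infv => // t It.
      rewrite ler_pdivrMl//; apply: le_trans (rle (c *: u) (c * t) (SZ c Su) _) _.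
        by rewrite /I /= mulr_ge0// ltW.
      rewrite /f -scalerA -scalerDr mulrBr mulrA lerD2r.
      by apply: sublinZ => //; apply: SD => //; exact: SZ.
    - apply/le_anti/andP; split; first by rewrite -[leRHS](sublin0 sp) rp.
      by have := rD 0 0 S0 S0; rewrite addr0 lerDl.
  have := le_trans (pmin r sr rp x Sx) (rle x 1 Sx ler01).
  by rewrite /f scale1r mul1r; lra.
have pN x : S x -> p (- x) = - p x.
  move=> Sx; apply/eqP; rewrite -addr_eq0 -pD ?addNr ?sublin0//; exact: SN.
split=> // c x Sx; have [c0|c0|->] := ltgtP c 0.
- by rewrite -[c]opprK scaleNr pN ?sublinZE ?oppr_gt0// ?mulNr//; exact: SZ.
- exact: sublinZE.
- by rewrite scale0r mul0r sublin0.
Qed.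

End HahnBanach.

Section Means.
Variables (R : realType) (T : Type).
Implicit Types (f g k : T -> R).

Definition bounded_fun f := exists M, forall t, `|f t| <= M.

Lemma bounded_funD f g : bounded_fun f -> bounded_fun g -> bounded_fun (f + g).
Proof.
move=> [M hM] [N hN]; exists (M + N) => t.
by apply: le_trans (ler_normD _ _) _; rewrite lerD.
Qed.

Lemma bounded_funZ c f : bounded_fun f -> bounded_fun (c *: f).
Proof.
by move=> [M hM]; exists (`|c| * M) => t; rewrite normrM ler_wpM2l.
Qed.

Lemma bounded_fun_cst c : bounded_fun (fun=> c).
Proof. by exists `|c|. Qed.

Lemma bounded_funN f : bounded_fun f -> bounded_fun (- f).
Proof. by move=> [M hM]; exists M => t; rewrite normrN. Qed.

Record is_mean (m : (T -> R) -> R) : Prop := {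
  meanD : forall f g, bounded_fun f -> bounded_fun g -> m (f + g) = m f + m g;
  meanZ : forall c f, bounded_fun f -> m (c *: f) = c * m f;
  mean_le : forall f e, bounded_fun f -> (forall t, f t <= e) -> m f <= e }.

(* A mean subject to the constraints [m k >= c] for [(k, c)] in a convex cone
   exists as soon as none of them is violated by the supremum. *)
Lemma exists_mean (K : (T -> R) -> R -> Prop) : T ->
  (forall k c, K k c -> bounded_fun k) -> K 0 0 ->
  (forall k c k' c', K k c -> K k' c' -> K (k + k') (c + c')) ->
  (forall a k c, 0 < a -> K k c -> K (a *: k) (a * c)) ->
  (forall k c e, K k c -> (forall t, k t <= e) -> c <= e) ->
  exists2 m, is_mean m & forall k c, K k c -> c <= m k.
Proof.
move=> t0 Kb K0 KD KZ Ksup.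
(* [P f] collects the upper bounds of f that some constraint certifies; its infimum q is sublinear
   and will dominate the mean. A constraint (k, c) certifies q (- k) <= - c. *)
pose P f := [set e | exists k c, K k c /\ forall t, f t + k t <= e + c].
pose q f := inf (P f).
have Plb f M e : (forall t, `|f t| <= M) -> P f e -> - M <= e.
  move=> hM [k [c [Kkc h]]]; have h1 : c <= e + c + M.
    apply: (Ksup _ _ _ Kkc) => t.
    by have := h t; have := hM t; rewrite ler_norml => /andP[h1 _] h2; lra.
  lra.
have Pne f : bounded_fun f -> P f !=set0.
  by move=> [M hM]; exists M, 0, 0; split=> // t; rewrite !addr0 (le_trans (ler_norm _)).
have qle f e : bounded_fun f -> P f e -> q f <= e.
  by move=> [M hM] Pe; apply: ge_inf => //; exists (- M) => ? /Plb; apply.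
have q_ge f e : bounded_fun f -> (forall e', P f e' -> e <= e') -> e <= q f.
  by move=> bf h; apply: lb_le_inf; [exact: Pne|exact: h].
have b0 : bounded_fun (0 : T -> R) by exists 0 => t; rewrite normr0.
have sq : sublinear bounded_fun q.
  have qD f g : bounded_fun f -> bounded_fun g -> q (f + g) <= q f + q g.
    move=> bf bg; rewrite -lerBlDr; apply: (q_ge) => // e [k [c [Kkc h]]].
    rewrite lerBlDr -lerBlDl; apply: (q_ge) => // e' [k' [c' [Kkc' h']]].
    rewrite lerBlDl; apply: (qle); first exact: bounded_funD.
    exists (k + k'), (c + c'); split; first exact: KD.
    by move=> t; rewrite addrACA [leRHS]addrACA lerD.
  split=> //.
    move=> a f a0 bf; rewrite -ler_pdivrMl//; apply: (q_ge) => // e [k [c [Kkc h]]].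
    rewrite ler_pdivrMl//; apply: (qle); first exact: bounded_funZ.
    exists (a *: k), (a * c); split; first exact: KZ.
    by move=> t; rewrite -[leRHS]mulrDr -[leLHS]mulrDr ler_pM2l.
  apply/le_anti/andP; split.
    by apply: (qle) => //; exists 0, 0; split=> // t; rewrite !addr0.
  by apply: (q_ge) => // e Pe; have := Plb 0 0 e _ Pe; rewrite oppr0; apply=> t; rewrite normr0.
have [m [mD mZ mq]] := hahn_banach b0 bounded_funD bounded_funZ sq.
exists m; first split=> //.
- move=> f e bf h; apply: le_trans (mq f bf) _; apply: (qle) => //.
  by exists 0, 0; split=> // t; rewrite !addr0.
move=> k c Kkc; have bk := Kb _ _ Kkc.
rewrite -lerN2 -mulN1r -mZ//; apply: le_trans (mq _ (bounded_funZ _ bk)) _.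
apply: (qle); first exact: bounded_funZ.
by exists k, c; split=> // t; rewrite scaleN1r addNr addNr.
Qed.

Section MeanTheory.
Variable m : (T -> R) -> R.
Hypothesis hm : is_mean m.

Lemma mean_cst c : m (fun=> c) = c.
Proof.
apply/le_anti/andP; split; first by apply: (mean_le hm) => //; exact: bounded_fun_cst.
rewrite -lerN2 -mulN1r -(meanZ hm); last exact: bounded_fun_cst.
apply: (mean_le hm); first by apply: bounded_funZ; exact: bounded_fun_cst.
by move=> t; rewrite -[leRHS]mulN1r.
Qed.

Lemma meanN f : bounded_fun f -> m (- f) = - m f.
Proof. by move=> bf; rewrite -scaleN1r (meanZ hm)// mulN1r. Qed.

Lemma meanB f g : bounded_fun f -> bounded_fun g -> m (f - g) = m f - m g.
Proof. by move=> bf bg; rewrite (meanD hm)// ?meanN//; exact: bounded_funN. Qed.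

Lemma mean_homo f g : bounded_fun f -> bounded_fun g -> (forall t, f t <= g t) ->
  m f <= m g.
Proof.
move=> bf bg h; rewrite -subr_le0 -meanB//; apply: (mean_le hm).
  by apply: bounded_funD => //; exact: bounded_funN.
by move=> t; rewrite subr_le0.
Qed.

Lemma mean_sum n (f : 'I_n -> T -> R) : (forall i, bounded_fun (f i)) ->
  m (\sum_i f i) = \sum_i m (f i).
Proof.
move=> bf; have m0 : m 0 = 0 by exact: (mean_cst 0).
have : bounded_fun (\sum_i f i) /\ m (\sum_i f i) = \sum_i m (f i); last by case.
elim/big_rec2: _ => [|i y x _ [bx <-]].
  by split=> //; exact: (bounded_fun_cst 0).
by split; [exact: bounded_funD | rewrite (meanD hm)].
Qed.

End MeanTheory.

Fixpoint differences (V : set (T -> T)) (s : seq ((T -> R) * (T -> T))) : Prop :=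
  if s is p :: s' then (bounded_fun p.1 /\ V p.2) /\ differences V s' else True.

Definition sum_differences (s : seq ((T -> R) * (T -> T))) : T -> R :=
  fun t => \sum_(p <- s) (p.1 t - p.1 (p.2 t)).

Lemma differences_cat V s s' : differences V s -> differences V s' ->
  differences V (s ++ s').
Proof. by elim: s => //= p s ih [hp hs] hs'; split=> //; exact: ih. Qed.

Lemma differences_map V F s : (forall f, bounded_fun f -> bounded_fun (F f)) ->
  differences V s -> differences V [seq (F p.1, p.2) | p <- s].
Proof.
move=> hF; elim: s => //= p s ih [[bp Vp] hs].
by split; [split=> //; exact: hF | exact: ih].
Qed.

(* Averaging over the powers of one map turns its difference into a telescoping
   sum, which is negligible, and preserves the shape of the other ones. *)
Lemma sum_differences_sup (V : set (T -> T)) s e : T ->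
  (forall u v, V u -> V v -> u \o v =1 v \o u) -> differences V s ->
  (forall t, sum_differences s t <= e) -> 0 <= e.
Proof.
move=> t0 Vcomm; elim: {s}(size s) {-2}s e (erefl (size s)) => [|n ihn] [|[f v] s] e //=.
  by move=> _ _ /(_ t0); rewrite /sum_differences big_nil.
move=> [sn] [[[M hM] Vv] hs] h.
have iterC u l t : V u -> iter l v (u t) = u (iter l v t).
  by move=> Vu; elim: l => //= l ->; exact: (Vcomm v u Vv Vu).
have tel l t : \sum_(j < l) (f (iter j v t) - f (iter j.+1 v t)) = f t - f (iter l v t).
  by elim: l => [|l ih]; rewrite ?big_ord0 ?subrr// big_ord_recr ih /= addrA subrK.
have avg l : 0 <= e *+ l + 2 * M.
  pose S g t := \sum_(j < l) g (iter j v t) : R.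
  apply: (ihn [seq (S p.1, p.2) | p <- s]); first by rewrite size_map.
    apply: differences_map hs => g [N hN]; exists (\sum_(j < l) N) => t.
    by apply: le_trans (ler_norm_sum _ _ _) _; apply: ler_sum => j _.
  move=> t; have -> : sum_differences [seq (S p.1, p.2) | p <- s] t =
      \sum_(j < l) sum_differences s (iter j v t).
    rewrite /sum_differences big_map exchange_big /=.
    elim: s {ihn sn h} hs => [|p s ih] hs; first by rewrite !big_nil.
    case: hs => [[_ Vp] hs]; rewrite !big_cons ih//; congr (_ + _).
    by rewrite /S -sumrB; apply: eq_bigr => j _; rewrite iterC.
  apply: (@le_trans _ _ (\sum_(j < l) (e - (f (iter j v t) - f (iter j.+1 v t))))).
    apply: ler_sum => j _; rewrite lerBrDl.
    by have := h (iter j v t); rewrite /sum_differences big_cons.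
  rewrite big_split /= sumr_const card_ord lerD2l sumrN.
  rewrite tel.
  have := hM t; have := hM (iter l v t); rewrite !ler_norml => /andP[_ h1] /andP[h2 _].
  lra.
rewrite leNgt; apply/negP => e0.
have M0 : 0 <= M by exact: le_trans (hM t0).
have := avg (Num.bound ((2 * M) / - e)).
have : (2 * M) / - e < (Num.bound ((2 * M) / - e))%:R.
  by apply: archi_boundP; rewrite divr_ge0 ?mulr_ge0// oppr_ge0 ltW.
rewrite ltr_pdivrMr ?oppr_gt0// -mulr_natr; nra.
Qed.

(** The constraints m (f - f o v) >= 0, applied to f and to - f, force equality;
    [sum_differences_sup] is their consistency. This is the amenability of commuting families of
    maps. *)
Lemma exists_invariant_mean (V : set (T -> T)) : T ->
  (forall u v, V u -> V v -> u \o v =1 v \o u) ->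
  exists2 m, is_mean m & forall f v, V v -> bounded_fun f -> m (f \o v) = m f.
Proof.
move=> t0 Vcomm.
pose K k (c : R) := c = 0 /\ exists2 s, differences V s & k = sum_differences s.
have dcat s s' : sum_differences (s ++ s') = sum_differences s + sum_differences s'.
  by apply/funext => t; rewrite /sum_differences big_cat.
have bdiff s : differences V s -> bounded_fun (sum_differences s).
  elim: s => [_|p s ih [[[M hM] _] /ih [N hN]]].
    by exists 0 => t; rewrite /sum_differences big_nil normr0.
  exists (M + M + N) => t; rewrite /sum_differences big_cons.
  apply: le_trans (ler_normD _ _) _; apply: lerD; last exact: hN.
  by apply: le_trans (ler_normB _ _) _; rewrite lerD.
have [| | | | |m hm mK] := @exists_mean K t0.
- by move=> k c [_ [s ds ->]]; exact: bdiff.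
- split=> //; exists [::] => //; apply/funext => t.
  by rewrite /sum_differences big_nil.
- move=> k c k' c' [-> [s ds ->]] [-> [s' ds' ->]]; split; first by rewrite addr0.
  by exists (s ++ s'); rewrite ?dcat//; exact: differences_cat.
- move=> a k c _ [-> [s ds ->]]; split; first by rewrite mulr0.
  exists [seq (a *: p.1, p.2) | p <- s].
    by apply: (differences_map _ ds) => f; exact: bounded_funZ.
  apply/funext => t; rewrite /sum_differences big_map [LHS]mulr_sumr.
  by apply: eq_bigr => p _; rewrite mulrBr.
- by move=> k c e [-> [s ds ->]]; exact: (sum_differences_sup t0 Vcomm ds).
exists m => // f v Vv bf.
have bfv : bounded_fun (f \o v) by case: bf => M hM; exists M => t; exact: hM.
have h g : bounded_fun g -> bounded_fun (g \o v) -> 0 <= m g - m (g \o v).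
  move=> bg bgv; rewrite -(meanB hm)//; apply: mK; split=> //.
  exists [:: (g, v)] => //; apply/funext => t.
  by rewrite /sum_differences big_seq1.
apply/le_anti; rewrite -subr_ge0 h//=.
have := h (- f) (bounded_funN bf) (bounded_funN bfv).
by rewrite (meanN hm)// (meanN hm)//; lra.
Qed.

End Means.

Section ComplexMeans.
Variables (R : realType) (T : Type) (m : (T -> R) -> R).
Hypothesis hm : is_mean m.
Implicit Types f g : T -> R[i].

Definition cbounded f := exists M, forall t, cn (f t) <= M.

Definition cmean f : R[i] :=
  Complex (m (fun t => complex.Re (f t))) (m (fun t => complex.Im (f t))).

Lemma norm_Re_le_cn (z : R[i]) : `|complex.Re z| <= cn z.
Proof.
by rewrite ler_norml Re_le_cn andbT lerNl -(cnN z) -raddfN Re_le_cn.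
Qed.

Lemma norm_Im_le_cn (z : R[i]) : `|complex.Im z| <= cn z.
Proof.
by rewrite ler_norml Im_le_cn andbT lerNl -(cnN z) -raddfN Im_le_cn.
Qed.

Lemma complex_ReM (z w : R[i]) : complex.Re (z * w) =
  complex.Re z * complex.Re w - complex.Im z * complex.Im w.
Proof. by case: z w => a b [c d]. Qed.

Lemma complex_ImM (z w : R[i]) : complex.Im (z * w) =
  complex.Re z * complex.Im w + complex.Im z * complex.Re w.
Proof. by case: z w => a b [c d]. Qed.

Lemma cbounded_Re f : cbounded f -> bounded_fun (fun t => complex.Re (f t)).
Proof. by move=> [M hM]; exists M => t; exact: le_trans (norm_Re_le_cn _) (hM t). Qed.

Lemma cbounded_Im f : cbounded f -> bounded_fun (fun t => complex.Im (f t)).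
Proof. by move=> [M hM]; exists M => t; exact: le_trans (norm_Im_le_cn _) (hM t). Qed.

Lemma cbounded_cn f : cbounded f -> bounded_fun (fun t => cn (f t)).
Proof. by move=> [M hM]; exists M => t; rewrite ger0_norm. Qed.

Lemma cboundedM f g : cbounded f -> cbounded g -> cbounded (fun t => f t * g t).
Proof.
by move=> [M hM] [N hN]; exists (M * N) => t; rewrite cnM ler_pM.
Qed.

Lemma cboundedD f g : cbounded f -> cbounded g -> cbounded (fun t => f t + g t).
Proof.
move=> [M hM] [N hN]; exists (M + N) => t.
by apply: le_trans (cnD _ _) _; rewrite lerD.
Qed.

Lemma cbounded_cst c : cbounded (fun=> c).
Proof. by exists (cn c). Qed.

Lemma cmeanD f g : cbounded f -> cbounded g ->
  cmean (fun t => f t + g t) = cmean f + cmean g.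
Proof.
move=> bf bg; rewrite /cmean; apply/eqP; rewrite eq_complex /=; apply/andP.
split; rewrite -(meanD hm); do ?[exact: cbounded_Re|exact: cbounded_Im].
  by apply/eqP; congr m; apply/funext => t; rewrite raddfD.
by apply/eqP; congr m; apply/funext => t; rewrite raddfD.
Qed.

Lemma cmeanZ c f : cbounded f -> cmean (fun t => c * f t) = c * cmean f.
Proof.
move=> bf; have bR := cbounded_Re bf; have bI := cbounded_Im bf.
rewrite /cmean; case: c => a b; apply/eqP; rewrite eq_complex /=; apply/andP; split.
  rewrite -(meanZ hm a bR) -(meanZ hm b bI) -(meanB hm); do ?exact: bounded_funZ.
  by apply/eqP; congr m; apply/funext => t; rewrite complex_ReM.
rewrite -(meanZ hm a bI) -(meanZ hm b bR) -(meanD hm); do ?exact: bounded_funZ.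
by apply/eqP; congr m; apply/funext => t; rewrite complex_ImM.
Qed.

Lemma cmean_cst c : cmean (fun=> c) = c.
Proof. by rewrite /cmean !(mean_cst hm); case: c. Qed.

(** Rotating f by the constant phase that makes its mean real and nonnegative reduces the estimate
    to real parts. *)
Lemma cn_cmean_le f : cbounded f -> cn (cmean f) <= m (fun t => cn (f t)).
Proof.
move=> bf; have := csgnM (cmean f); rewrite -cmeanZ// => /(congr1 (@complex.Re R)) /= <-.
have bc : cbounded (fun t => csgn (cmean f) * f t).
  by apply: cboundedM => //; exact: cbounded_cst.
apply: (mean_homo hm); [exact: cbounded_Re|exact: cbounded_cn|move=> t].
by apply: le_trans (Re_le_cn _) _; rewrite cnM cn_csgn mul1r.
Qed.

Lemma cn_cmean_ub f M : (forall t, cn (f t) <= M) -> cn (cmean f) <= M.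
Proof.
move=> h; have bf : cbounded f by exists M.
by apply: le_trans (cn_cmean_le bf) _; apply: (mean_le hm) => //; exact: cbounded_cn.
Qed.

End ComplexMeans.

Lemma linear_map0 (R : pzRingType) (V W : lmodType R) (f : V -> W) :
  linear f -> f 0 = 0.
Proof.
move=> lf; have := lf 1 0 0; rewrite !scale1r addr0.
by move=> /(congr1 (+%R^~ (- f 0))); rewrite addrK subrr.
Qed.

Lemma linear_mapD (R : pzRingType) (V W : lmodType R) (f : V -> W) :
  linear f -> {morph f : x y / x + y}.
Proof. by move=> lf x y; have := lf 1 x y; rewrite !scale1r. Qed.

Lemma cn_nat (R : realType) n : cn (n%:R : R[i]) = n%:R.
Proof. by rewrite -(rmorph_nat (real_complex R)) [LHS]cn_real ger0_norm. Qed.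

Lemma geometric_small (R : realType) (C e : R) : 0 < e -> exists n, C * 2^-1 ^+ n < e.
Proof.
move=> e0; pose N := Num.bound (`|C| / e); exists N.
have : `|C| / e < N%:R by apply: archi_boundP; rewrite divr_ge0// ltW.
rewrite ltr_pdivrMr// mulrC => hN.
rewrite exprVn ltr_pdivrMr ?exprn_gt0//; apply: le_lt_trans (ler_norm _) _.
apply: lt_le_trans hN _.
rewrite ler_pM2l// -natrX ler_nat; exact: ltnW (ltn_expl _ _).
Qed.

Lemma le_geometric (R : realType) (a b C : R) :
  (forall n, a <= b + C * 2^-1 ^+ n) -> a <= b.
Proof.
move=> h; apply/ler_addgt0Pr => e e0; have [n hn] := geometric_small C e0.
by apply: le_trans (h n) _; rewrite lerD2l ltW.
Qed.

Section Completeness.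
Variables (R : realType) (E : completeNormedModType R[i]).

Lemma complete_seq (u : nat -> E) (d : nat -> R) :
  (forall m n, (n <= m)%N -> rnorm (u m - u n) <= d n) ->
  (forall e, 0 < e -> exists n, d n < e) ->
  exists l, forall n, rnorm (l - u n) <= d n.
Proof.
move=> ud d0.
have posC (e : R[i]) : 0 < e -> exists2 r : R, 0 < r & e = r%:C.
  case: e => a b; rewrite ltcE /= => /andP[/eqP -> a0].
  by exists a.
have : cauchy (u @ \oo).
  apply/cauchyP => e /posC[r r0 ->]; have [n dn] := d0 r r0.
  exists (u n); exists n => // m /= nm.
  rewrite -ball_normE /= rnormE ltcR rnorm_distC.
  exact: le_lt_trans (ud m n nm) dn.
move=> /cauchy_cvg/cvg_ex[l ul]; exists l => n.
apply/ler_addgt0Pr => e e0; move/cvgrPdist_lt : ul.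
move=> /(_ e%:C); rewrite ltcR => /(_ e0) [N _ hN].
have /= := hN (maxn n N) (leq_maxr _ _); rewrite rnormE ltcR => h.
rewrite -[l](subrK (u (maxn n N))) -addrA addrC; apply: le_trans (rnormD _ _) _.
by rewrite lerD ?ud ?leq_maxl// ltW.
Qed.

Lemma complete_geometric (u : nat -> E) (C : R) :
  (forall n, rnorm (u n.+1 - u n) <= C * 2^-1 ^+ n) ->
  exists l, forall n, rnorm (l - u n) <= 2 * C * 2^-1 ^+ n.
Proof.
move=> h; have C0 : 0 <= C by have := h 0%N; rewrite expr0 mulr1; exact: le_trans.
have p0 n : 0 <= 2^-1 ^+ n :> R by rewrite exprn_ge0// invr_ge0.
have tail k n : rnorm (u (n + k)%N - u n) <= C * 2^-1 ^+ n * (2 - 2 * 2^-1 ^+ k).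
  elim: k => [|k ih]; first by rewrite addn0 subrr rnorm0 expr0 mulr1 subrr mulr0.
  have -> : u (n + k.+1)%N - u n = (u (n + k).+1 - u (n + k)%N) + (u (n + k)%N - u n).
    by rewrite addnS addrA subrK.
  apply: le_trans (rnormD _ _) _; apply: le_trans (lerD (h _) ih) _.
  by rewrite exprD exprS; apply: le_of_eq; field.
have [| |l hl] := @complete_seq u (fun n => 2 * C * 2^-1 ^+ n).
- move=> m n nm; rewrite -(subnKC nm); apply: le_trans (tail _ _) _.
  by rewrite [leLHS]mulrC -mulrA ler_wpM2r ?mulr_ge0// gerBl mulr_ge0.
- by move=> e; exact: geometric_small.
by exists l.
Qed.

End Completeness.

(** * Amenability of commutative C*-algebras *)

Section CstarAmenable.
Variables (R : realType) (A : completeNormedModType R[i]) (mul : A -> A -> A).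
Variable star : A -> A.
Hypothesis mulB : bilinear_map mul.
Hypothesis mulA : associative mul.
Hypothesis mulC : commutative mul.
Hypothesis mul_le : forall a b, rnorm (mul a b) <= rnorm a * rnorm b.
Hypothesis hstar : is_cstar_involution mul star.

Let mulDl x y z : mul (x + y) z = mul x z + mul y z.
Proof. by have := mulB.2 z 1 x y; rewrite !scale1r. Qed.
Let mulDr x y z : mul z (x + y) = mul z x + mul z y.
Proof. by rewrite mulC mulDl ![mul z _]mulC. Qed.
Let mul0l x : mul 0 x = 0.
Proof. by apply: (addrI (mul 0 x)); rewrite -mulDl !addr0. Qed.
Let mul0r' x : mul x 0 = 0. Proof. by rewrite mulC mul0l. Qed.
Let mulZl k x z : mul (k *: x) z = k *: mul x z.
Proof. by have := mulB.2 z k x 0; rewrite mul0l !addr0. Qed.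
Let mulZr k x z : mul z (k *: x) = k *: mul z x.
Proof. by rewrite mulC mulZl mulC. Qed.
Let mul_oppl x y : mul (- x) y = - mul x y.
Proof. by rewrite -scaleN1r mulZl scaleN1r. Qed.
Let mul_oppr x y : mul x (- y) = - mul x y.
Proof. by rewrite mulC mul_oppl mulC. Qed.
Let starD x y : star (x + y) = star x + star y.
Proof. by have := star_conjlinear hstar 1 x y; rewrite rmorph1 !scale1r. Qed.
Let star0 : star 0 = 0.
Proof. by apply: (addrI (star 0)); rewrite -starD !addr0. Qed.
Let starZ k x : star (k *: x) = k^* *: star x.
Proof. by have := star_conjlinear hstar k x 0; rewrite star0 !addr0. Qed.
Let starM x y : star (mul x y) = mul (star x) (star y).
Proof. by rewrite (star_antimult hstar) mulC. Qed.
Let starK := star_involutive hstar.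
Let starN x : star (- x) = - star x.
Proof. by rewrite -scaleN1r starZ rmorphN rmorph1 scaleN1r. Qed.

Lemma cstar_normE a : rnorm (mul (star a) a) = rnorm a ^+ 2.
Proof. by apply: complexI; rewrite -rnormE (star_cstar hstar) rnormE [RHS]real_complexM. Qed.

Lemma rnorm_star a : rnorm (star a) = rnorm a.
Proof.
have le b : rnorm b <= rnorm (star b).
  have [->|b0] := eqVneq b 0; first by rewrite rnorm0.
  have bp : 0 < rnorm b by rewrite lt_def rnorm_eq0 b0 rnorm_ge0.
  by rewrite -(ler_pM2r bp) -expr2 -cstar_normE.
by apply/le_anti; rewrite le andbT -{2}[a]starK le.
Qed.

(* The element [b] is quasi-unitary if [1 + b] is a unitary of the unitization;
   [circ] is the product of the unitization in these coordinates. *)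
Definition circ a b := a + b + mul a b.
Definition quasi_unitary b := circ b (star b) = 0.

Lemma circC : commutative circ.
Proof. by move=> a b; rewrite /circ (addrC a) mulC. Qed.

Lemma circA : associative circ.
Proof.
move=> a b c; rewrite /circ !mulDl !mulDr mulA !addrA.
by rewrite [LHS](ACl (1*2*5*3*6*4*7)).
Qed.

Lemma quasi_unitary_circ a b : quasi_unitary a -> quasi_unitary b ->
  quasi_unitary (circ a b).
Proof.
rewrite /quasi_unitary => ha hb.
have -> : star (circ a b) = circ (star a) (star b) by rewrite /circ !starD starM.
rewrite circA (circC a) -(circA b) ha (_ : circ b 0 = b)//.
by rewrite /circ addr0 mul0r' addr0.
Qed.

Lemma quasi_unitary_norm b : quasi_unitary b -> rnorm b <= 2.
Proof.
move=> hb; have [->|b0] := eqVneq b 0; first by rewrite rnorm0.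
have bp : 0 < rnorm b by rewrite lt_def rnorm_eq0 b0 rnorm_ge0.
rewrite -(ler_pM2r bp) -expr2 -cstar_normE mulC.
have -> : mul b (star b) = - (b + star b).
  by apply/eqP; rewrite -addr_eq0 addrC; apply/eqP.
by rewrite rnormN; apply: le_trans (rnormD _ _) _; rewrite rnorm_star mulr_natl mulr2n.
Qed.

(* [y = 1 - sqrt(1 - h^2)] is the fixed point of the contraction
   [y |-> (h^2 + y^2) / 2]; then [- i h - y] is quasi-unitary. *)
Lemma selfadjoint_quasi_unitary h : star h = h -> rnorm h <= 2^-1 ->
  exists2 b, quasi_unitary b & h = (2^-1 * 'i) *: (b - star b).
Proof.
move=> sh nh; pose T y : A := 2^-1 *: (mul h h + mul y y).
have n2 : cn (2^-1 : R[i]) = 2^-1 by rewrite cnV cn_nat.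
(* The bound 1 / 2 on h makes the ball of radius 1 / 2 stable under T, and on this ball |y + z| <= 1
   gives the contraction constant 1 / 2. *)
have nT y : rnorm y <= 2^-1 -> rnorm (T y) <= 2^-1.
  move=> ny; rewrite rnormZ n2 ler_piMr ?invr_ge0//.
  apply: le_trans (rnormD _ _) _.
  have q z : rnorm z <= 2^-1 -> rnorm (mul z z) <= 2^-1.
    move=> nz; apply: le_trans (mul_le _ _) _; have := rnorm_ge0 z; nra.
  have := q _ nh; have := q _ ny; lra.
have cT y z : rnorm y <= 2^-1 -> rnorm z <= 2^-1 ->
    rnorm (T y - T z) <= 2^-1 * rnorm (y - z).
  move=> ny nz; rewrite -scalerBr rnormZ n2 ler_wpM2l ?invr_ge0//.
  have -> : mul h h + mul y y - (mul h h + mul z z) = mul (y - z) (y + z).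
    rewrite opprD addrACA subrr add0r mulDl !mulDr -!(scaleN1r z) !mulZl (mulC z y).
    by rewrite !scaleN1r !addrA addrK.
  apply: le_trans (mul_le _ _) _; rewrite ler_piMr//.
  apply: le_trans (rnormD _ _) _; lra.
pose u n := iter n T 0.
have nu n : rnorm (u n) <= 2^-1.
  by elim: n => [|n ih]; [rewrite /u /= rnorm0 invr_ge0 | exact: nT].
have su n : star (u n) = u n.
  elim: n => [|n ih]; first exact: star0.
  rewrite /u iterS -/(u n) /T starZ starD !starM ih sh.
  by rewrite conj_Creal// rpredV realn.
have [y hy] : exists y, forall n, rnorm (y - u n) <= 2 * rnorm (u 1%N - u 0%N) * 2^-1 ^+ n.
  apply: complete_geometric; elim=> [|n ih]; first by rewrite expr0 mulr1.
  apply: le_trans (cT (u n.+1) (u n) (nu _) (nu _)) _.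
  by rewrite exprS mulrCA ler_wpM2l ?invr_ge0.
set C := 2 * _ in hy.
have small z : (exists D, forall n, rnorm z <= D * 2^-1 ^+ n) -> z = 0.
  move=> [D hD]; apply: rnorm0_eq0; apply/le_anti; rewrite rnorm_ge0 andbT.
  by apply: (le_geometric (C := D)) => n; rewrite add0r.
have ny : rnorm y <= 2^-1.
  apply: (le_geometric (C := C)) => n; rewrite -[y](subrK (u n)) addrC.
  by apply: le_trans (rnormD _ _) _; rewrite lerD.
have sy : star y = y.
  apply/eqP; rewrite -subr_eq0; apply/eqP/small; exists (C + C) => n.
  have -> : star y - y = star (y - u n) - (y - u n).
    by rewrite starD starN su opprB addrA subrK.
  by apply: le_trans (rnormB _ _) _; rewrite rnorm_star mulrDl lerD.
have Ty : T y = y.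
  apply/eqP; rewrite -subr_eq0; apply/eqP/small; exists (C + C) => n.
  have -> : T y - y = (T y - T (u n)) - (y - u n.+1) by rewrite opprB addrA subrK.
  apply: le_trans (rnormB _ _) _; rewrite mulrDl lerD//.
    apply: le_trans (cT _ _ ny (nu n)) _; apply: le_trans (hy n).
    by rewrite ler_piMl// invf_le1 ?ler1n.
  apply: le_trans (hy _) _; rewrite exprS mulrCA ler_piMl//; last by rewrite invf_le1 ?ler1n.
  exact: le_trans (hy n).
(* Here 1 + b = (1 - y) - i h, whose product with its adjoint is (1 - y)^2 + h^2; this is 1 exactly
   when 2 y = h^2 + y^2. *)
exists (- ('i *: h) - y).
  rewrite /quasi_unitary /circ starD !starN starZ sh sy conjCi scaleNr opprK.
  set a := 'i *: h; have -> : mul (- a - y) (a - y) = mul h h + mul y y.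
    rewrite !mulDl !mulDr !mul_oppl !mul_oppr !opprK (mulC y a) addrA addrK.
    by rewrite {1}/a /a mulZl mulZr scalerA -expr2 sqrCi scaleN1r opprK.
  have -> : mul h h + mul y y = 2 *: y.
    by rewrite -{3}Ty scalerA divff ?scale1r// pnatr_eq0.
  by rewrite addrACA addNr add0r scaler_nat mulr2n -opprD addNr.
rewrite starD !starN starZ sh sy conjCi scaleNr opprK.
have -> : - ('i *: h) - y - ('i *: h - y) = 2 *: (- ('i *: h)).
  by rewrite opprB addrA subrK scaler_nat mulr2n.
rewrite !scalerN !scalerA -scaleNr (_ : - _ = 1) ?scale1r//.
rewrite (_ : 2^-1 * 'i * 2 * 'i = (2^-1 * 2) * 'i ^+ 2); last by ring.
by rewrite mulVf ?pnatr_eq0// sqrCi mul1r opprK.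
Qed.

(** Real and imaginary parts reduce to a self-adjoint h. Scaled into the ball of radius 1 / 2, it is
    a multiple of b - b^* with b quasi-unitary, and b^* is quasi-unitary too. An induction principle
    replaces the notion of linear span. *)
Lemma quasi_unitary_span (P : A -> Prop) :
  (forall c x y, P x -> P y -> P (c *: x + y)) -> P 0 ->
  (forall b, quasi_unitary b -> P b) -> forall a, P a.
Proof.
move=> PD P0 Pq.
have PZ c x : P x -> P (c *: x) by move=> Px; rewrite -[_ *: _]addr0; exact: PD.
have Psa h : star h = h -> P h.
  move=> sh; pose r := (2 * (rnorm h + 1))^-1.
  have h1 : 0 < rnorm h + 1 by rewrite ltr_wpDl.
  have r0 : 0 < r by rewrite invr_gt0 mulr_gt0.
  have [|| b qb e] := @selfadjoint_quasi_unitary (r%:C *: h).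
  - by rewrite starZ sh; congr (_ *: _); rewrite conj_Creal// complex_real.
  - rewrite rnormZ cn_real gtr0_norm// /r invfM -mulrA ler_piMr ?invr_ge0//.
    by rewrite ler_pdivrMl// mulr1 lerDl.
  have -> : h = (r^-1)%:C *: (r%:C *: h).
    by rewrite scalerA -real_complexM mulVf ?gt_eqF// scale1r.
  rewrite e; apply/PZ/PZ; rewrite addrC -scaleN1r; apply: PD; apply: Pq => //.
  by rewrite /quasi_unitary starK circC.
move=> a; have -> : a = (2^-1 : R[i]) *: (a + star a) + (2^-1 * - 'i) *: ('i *: (a - star a)).
  rewrite scalerA -mulrA mulNr -expr2 sqrCi opprK mulr1 -scalerDr addrACA subrr addr0.
  by rewrite -mulr2n -[a *+ 2]scaler_nat scalerA mulVf ?scale1r// pnatr_eq0.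
apply: PD; first by apply: Psa; rewrite starD starK addrC.
by apply/PZ/Psa; rewrite starZ starD starN starK conjCi scaleNr -scalerN opprB.
Qed.

Lemma cstar_amenable : amenable mul.
Proof.
move=> E lact ract [[[lact_r lact_l] [ract_r ract_l] lM rM lr] [M hM] [N hN]] D
  [dD lD derD] [C hC].
pose T := {b : A | quasi_unitary b}.
have q0 : quasi_unitary 0 by rewrite /quasi_unitary /circ star0 mul0l !addr0.
pose op (v b : T) : T := exist _ _ (quasi_unitary_circ (svalP v) (svalP b)).
pose V := [set op v | v in setT].
have opC u v : V u -> V v -> u \o v =1 v \o u.
  move=> [a _ <-] [b _ <-] c; apply: eq_exist => /=.
  by rewrite circA (circC (sval a)) -circA.
have [m hm minv] := exists_invariant_mean R (exist _ 0 q0 : T) opC.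
(* With u = 1 + b and D extended to the unitization by D(1) = 0, this is the value at x of D(u)
   u^-1. *)
pose F x (b : T) : R[i] := D (sval b) (x + lact (star (sval b)) x).
have D_bd a x : cn (D a x) <= Num.max C 0 * rnorm a * rnorm x.
  apply: le_trans (le_dual_norm _ (dD a)) _; rewrite ler_wpM2r//.
  by apply: le_trans (hC a) _; rewrite ler_wpM2r// le_max lexx.
have lact_bd a x : rnorm (lact a x) <= Num.max M 0 * rnorm a * rnorm x.
  rewrite -lecR !real_complexM -!rnormE; apply: le_trans (hM a x) _.
  by rewrite !ler_wpM2r// lecR le_max lexx.
have F_bd x b : cn (F x b) <= Num.max C 0 * 2 * (rnorm x + Num.max M 0 * 2 * rnorm x).
  have C0 : 0 <= Num.max C 0 by rewrite le_max lexx orbT.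
  have M0 : 0 <= Num.max M 0 by rewrite le_max lexx orbT.
  have b2 := quasi_unitary_norm (svalP b).
  apply: le_trans (D_bd _ _) _; rewrite ler_pM ?mulr_ge0//; first by rewrite ler_wpM2l.
  apply: le_trans (rnormD _ _) _; rewrite lerD2l; apply: le_trans (lact_bd _ _) _.
  by rewrite ler_wpM2r// ler_wpM2l// rnorm_star.
have cF x : cbounded (F x) by eexists; exact: F_bd.
pose phi x := cmean m (F x).
have phi_lin : scalar phi.
  move=> c x y; rewrite /phi -(cmeanZ hm)// -(cmeanD hm)//; last first.
    by apply: cboundedM => //; exact: cbounded_cst.
  congr cmean; apply/funext => b; rewrite /F lact_r.
  by rewrite -(dD (sval b)).1 scalerDr addrACA.
pose B := Num.max C 0 * 2 * (1 + Num.max M 0 * 2).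
have phi_bd x : cn (phi x) <= B * rnorm x.
  apply: (cn_cmean_ub hm) => b.
  apply: le_trans (F_bd x b) _; apply: le_of_eq.
  by rewrite /B; ring.
have key a x : D a x = phi (lact a x) - phi (ract x a).
  apply: (quasi_unitary_span (P := fun a => forall x, D a x = phi (lact a x) - phi (ract x a))) => {a x} [c a b Pa Pb x|x|a qa x].
  - rewrite lD Pa Pb (lact_l x) (ract_r x) !phi_lin mulrBr.
    by rewrite opprD addrACA.
  - rewrite (scalar0 (lD x)) (linear_map0 (lact_l x)) (linear_map0 (ract_r x)).
    by rewrite subrr.
  pose L b y := y + lact b y.
  have Lcirc b c y : L (circ b c) y = L b (L c y).
    rewrite /L /circ (linear_mapD (lact_r b)) !(linear_mapD (lact_l y)) lM.
    by rewrite !addrA (addrAC y).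
  have L0 y : L 0 y = y by rewrite /L (linear_map0 (lact_l y)) addr0.
  pose v : T := exist _ a qa; pose y := L a x; pose w := x + ract x a.
  (* For the unitaries v = 1 + a and u = 1 + b, this is the derivation rule for v u multiplied by
     u^-1 on the right: D(v u) u^-1 = D(v) + v D(u) u^-1. Averaging over u turns it into phi v =
     D(v) + v phi. *)
  have Fy b : F y (op v b) = D a x + F w b.
    case: b => b qb; rewrite /F /= -/(L _ y).
    have -> : L (star (circ a b)) y = L (star b) x.
      have -> : star (circ a b) = circ (star b) (star a).
        by rewrite circC /circ !starD starM.
      by rewrite Lcirc /y -(Lcirc (star a)) (circC (star a)) qa L0.
    have e1 : L b (L (star b) x) = x by rewrite -Lcirc qb L0.
    have dz u := scalarD (dD u).1; have dl u := scalarD (lD u).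
    have e2 : D a x = D a (L (star b) x) + D a (lact b (L (star b) x)).
      by rewrite -dz -/(L b _) e1.
    rewrite /circ !dl derD /dual_lact /dual_ract e2.
    have -> : w + lact (star b) w = L (star b) x + ract (L (star b) x) a.
      rewrite /w /L (linear_mapD (lact_r _)) (linear_mapD (ract_l a)) lr.
      by rewrite addrACA.
    by rewrite (dz b (L (star b) x)); ring.
  have inv : cmean m (fun b => F y (op v b)) = phi y.
    have Vv : V (op v) by exists v.
    congr Complex.
      exact: (minv (fun b => complex.Re (F y b)) _ Vv (cbounded_Re (cF y))).
    exact: (minv (fun b => complex.Im (F y b)) _ Vv (cbounded_Im (cF y))).
  have : phi y = D a x + phi w.
    rewrite -inv -[X in X + _](cmean_cst hm) -(cmeanD hm)//; last exact: cbounded_cst.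
    by congr cmean; apply/funext => b.
  rewrite /y /L /w !(scalarD phi_lin) => e.
  have -> : D a x = (phi x + phi (lact a x)) - (phi x + phi (ract x a)) by rewrite e addrK.
  ring.
(* Averaging yields D(a) = phi a - a phi, opposite to the convention for inner derivations; hence
   the sign. *)
exists (fun x => - phi x).
  apply: (dual_intro (C := B)) => [c x y|x]; first by rewrite phi_lin mulrN opprD.
  by rewrite cnN; exact: phi_bd.
by move=> a x; rewrite key /dual_lact /dual_ract opprK addrC.
Qed.

End CstarAmenable.

(** * Complete boundedness of functionals, and the passage from amenability to operator
    amenability *)

Section CompletelyBounded.
Variable R : realType.

Lemma mx_opnorm_row n (v : 'I_n -> R[i]) : mx_opnorm (\row_j v j) <= l2 v.
Proof.
apply: mx_opnorm_le => // w u; rewrite /bil big_ord1.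
under eq_bigr do rewrite mxE -mulrA.
rewrite -mulr_sumr cnM mulrAC mulrC.
have -> : l2 w = cn (w ord0) by rewrite /l2 big_ord1 sqrtr_sqr ger0_norm.
by rewrite ler_wpM2r// cn_sum_l2.
Qed.

Lemma mx_opnorm_col n (u : 'I_n -> R[i]) : mx_opnorm (\col_j u j) <= l2 u.
Proof.
apply: mx_opnorm_le => // v w; rewrite /bil exchange_big big_ord1.
under eq_bigr do rewrite mxE.
rewrite -mulr_suml cnM.
have -> : l2 w = cn (w ord0) by rewrite /l2 big_ord1 sqrtr_sqr ger0_norm.
by rewrite ler_wpM2r// mulrC cn_sum_l2.
Qed.

Variables (E : completeNormedModType R[i]) (nu : matrix_norms R E).
Arguments nu : clear implicits.
Hypothesis os : is_operator_space nu.

Lemma operator_norm_ge0 n (x : 'M[E]_n) : 0 <= nu n x.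
Proof.
have hom := os_homog os; have tri := os_triangle os.
have n0 : nu n 0 = 0.
  have := hom n 0 0; rewrite -/(cn 0) cn0 mul0r; congr (nu n _ = _).
  by apply/matrixP => i j; rewrite !mxE scaler0.
have := tri n x (map_mx ( *:%R (-1)) x); rewrite hom -/(cn (-1)) cnN cn1 mul1r.
rewrite (_ : x + _ = 0) ?n0; last by apply/matrixP => i j; rewrite !mxE scaleN1r subrr.
lra.
Qed.

(** Ruan's axiom for a row v and a column u compresses x to the single element z, where the bound of
    phi on E applies. *)
Lemma functional_opb n (x : 'M[E]_n) (phi : E -> R[i]) C : scalar phi -> 0 <= C ->
  (forall y, cn (phi y) <= C * rnorm y) -> opb (fun i j => phi (x i j)) (C * nu n x).
Proof.
move=> lphi C0 h v u.
pose z := \sum_i \sum_j (v i * u j) *: x i j.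
have -> : bil (fun i j => phi (x i j)) v u = phi z.
  rewrite (scalar_sum lphi); apply: eq_bigr => i _.
  by rewrite (scalar_sum lphi); apply: eq_bigr => j _; rewrite (scalarZ lphi); ring.
apply: le_trans (h z) _; rewrite -!mulrA ler_wpM2l// -(os_norm1 os).
have -> : const_mx z = mx_bimul (\row_j v j) x (\col_j u j) :> 'M[E]_1.
  apply/matrixP => i j; rewrite !mxE; apply: eq_bigr => k _; apply: eq_bigr => l _.
  by rewrite !mxE.
apply: le_trans (os_ruan_mul os _ _ _) _; rewrite mulrCA mulrA.
apply: ler_pM; rewrite ?mulr_ge0 ?operator_norm_ge0 ?mx_opnorm_col//.
by rewrite ler_wpM2r ?operator_norm_ge0 ?mx_opnorm_row.
Qed.

(** The set under the supremum in [cb_norm] is bounded by [functional_opb], and its matrices of size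
    1 include the value at x. *)
Lemma cn_le_dual_norms (phi : E -> R[i]) x : dual phi -> rnorm x <= 1 ->
  cn (phi x) <= dual_norms nu (const_mx phi : 'M_1).
Proof.
move=> dphi x1; have [C C0 hC] := dual_bounded dphi.
pose T (y : E) : 'M[R[i]]_1 := map_mx (fun f : E -> R[i] => f y) (const_mx phi).
have ub n (y : 'M[E]_n) : nu n y <= 1 -> Mn_norms (map_mx T y) <= C.
  move=> y1; apply: mx_opnorm_le => //.
  have bi : bijective (@mxtens_index n 1).
    by exists (@mxtens_unindex n 1); [exact: mxtens_indexK | exact: mxtens_unindexK].
  have bi0 : bijective (fun i : 'I_n => (i, ord0 : 'I_1)).
    by exists fst => // -[i k]; rewrite (ord1 k).
  apply: (opb_reindex bi bi); apply: (opb_reindex bi0 bi0).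
  apply: opb_le (_ : C * nu n y <= C) _; first by rewrite ler_piMr.
  apply: eq_opb (functional_opb y dphi.1 C0 hC) => i j.
  by rewrite !mxE !mxtens_indexK.
apply: (@le_trans _ _ (Mn_norms (map_mx T (const_mx x : 'M_1)))); last first.
  apply: ub_le_sup; first by exists C => _ [n [y [y1 ->]]]; exact: ub.
  by exists 1%N, (const_mx x); rewrite (os_norm1 os).
have := opb_entry ord0 ord0 (mx_opnormP (mx_flatten (map_mx T (const_mx x : 'M_1)))).
by rewrite !mxE.
Qed.

End CompletelyBounded.

Section AmenableOperatorAmenable.
Variables (R : realType) (A : completeNormedModType R[i]) (mul : A -> A -> A).

Lemma cb_bilinear_bounded (E F G : completeNormedModType R[i])
    (nuE : matrix_norms R E) (nuF : matrix_norms R F) (nuG : matrix_norms R G)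
    (f : E -> F -> G) :
  is_operator_space nuE -> is_operator_space nuF -> is_operator_space nuG ->
  completely_bounded_bilinear nuE nuF nuG f -> bounded_bilinear f.
Proof.
move=> osE osF osG [M hM]; exists M => x y.
rewrite !rnormE -!real_complexM lecR -(os_norm1 osG) -(os_norm1 osE) -(os_norm1 osF).
have := hM 1%N 1%N (const_mx x) (const_mx y); congr (nuG _ _ <= _).
by apply/matrixP => i j; rewrite !mxE.
Qed.

Lemma amenable_operator_amenable (nu : matrix_norms R A) :
  amenable mul -> is_operator_space nu -> operator_amenable mul nu.
Proof.
move=> am osA E nuE lact ract [osE bim cbl cbr] D derD [M hM].
apply: (am E lact ract _ D derD).
  split=> //; first exact: (cb_bilinear_bounded osA osE osE cbl).
  exact: (cb_bilinear_bounded osE osA osE cbr).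
exists M => a; apply: ge_sup; first by exists (cn (D a 0)), 0; rewrite ?rnorm0.
move=> _ [x x1 ->]; rewrite -(os_norm1 osA).
apply: le_trans (hM 1%N (const_mx a)); rewrite map_const_mx.
exact: (cn_le_dual_norms osE (deriv_dual derD a) x1).
Qed.

End AmenableOperatorAmenable.

(** * Duals of spaces given by a unit ball, and the dual of a space of bounded forms as an operator
    space *)

Lemma sequentially_complete (R : realType) (V : normedModType R[i]) :
  (forall u : nat -> V,
    (forall m n, rnorm (u m - u n) <= 2^-1 ^+ m + 2^-1 ^+ n) ->
    exists l, exists C, forall n, rnorm (l - u n) <= C * 2^-1 ^+ n) ->
  forall F : set_system V, ProperFilter F -> cauchy F -> cvg F.
Proof.
move=> hV F FF /cauchyP Fc.
have posC (e : R[i]) : 0 < e -> exists2 r : R, 0 < r & e = r%:C.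
  by case: e => a b; rewrite ltcE /= => /andP[/eqP -> a0]; exists a.
have p0 n : 0 < (2^-1 ^+ n)%:C :> R[i] by rewrite ltcR exprn_gt0// invr_gt0.
have /choice[u hu] : forall n, exists c : V, F (ball c (2^-1 ^+ n)%:C).
  by move=> n; exact: Fc (p0 n).
have [m n|l [C hl]] := hV u.
  have [v [/= hm hn]] := filter_ex (filterI (hu m) (hu n)).
  move: hm hn; rewrite -!ball_normE /= !rnormE !ltcR => hm hn.
  have -> : u m - u n = (u m - v) - (u n - v) by rewrite opprB addrA subrK.
  by apply: le_trans (rnormB _ _) _; rewrite lerD// ltW.
apply/cvg_ex; exists l; apply/cvgrPdist_lt => e /posC[r r0 ->].
have [n hn] := geometric_small (C + 1) r0.
apply: filterS (hu n) => v; rewrite -ball_normE /= !rnormE !ltcR => hv.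
have -> : l - v = (l - u n) + (u n - v) by rewrite addrA subrK.
apply: le_lt_trans (rnormD _ _) _; apply: le_lt_trans hn.
by rewrite mulrDl mul1r lerD// ltW.
Qed.

(* A subspace [S] of [L] with an absorbing subset [B] playing the role of the
   closed unit ball. *)
Record ball_space (R : realType) (L : lmodType R[i]) := BallSpace {
  bs_space : set L;
  bs_ball : set L;
  bs_space_lin : forall c x y, bs_space x -> bs_space y -> bs_space (c *: x + y);
  bs_sub : forall x, bs_ball x -> bs_space x;
  bs_ball0 : bs_ball 0;
  bs_absorbing : forall x, bs_space x -> exists2 c : R, 0 < c & bs_ball (c%:C *: x) }.

Section BallDual.
Variables (R : realType) (L : lmodType R[i]) (X : ball_space L).
Local Notation S := (bs_space X).
Local Notation B := (bs_ball X).

(* Functionals on [S] are made into total functions by the value 0 outside. *)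
Definition is_bdual (e : L -> R[i]) : Prop :=
  [/\ forall x, ~ S x -> e x = 0,
      forall c x y, S x -> S y -> e (c *: x + y) = c * e x + e y &
      exists M, forall x, B x -> cn (e x) <= M].

Definition bdual_pred : {pred L -> R[i]} := [pred e | `[< is_bdual e >]].

Lemma bdual_predE e : (e \in bdual_pred) = `[< is_bdual e >].
Proof. by []. Qed.

Lemma bdual_submod : submod_closed bdual_pred.
Proof.
split=> [|c e f].
  rewrite bdual_predE; apply/asboolP; split=> //.
    by move=> c x y _ _; rewrite mulr0 addr0.
  by exists 0 => x _; rewrite cn0.
rewrite !bdual_predE => /asboolP[e0 el [M hM]] /asboolP[f0 fl [N hN]]; apply/asboolP; split.
- by move=> x Sx; rewrite /= [LHS](_ : _ = c * e x + f x)// e0// f0// mulr0 addr0.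
- move=> k x y Sx Sy; rewrite [LHS](_ : _ = c * e (k *: x + y) + f (k *: x + y))//.
  rewrite el// fl// [(c *: e + f) x](_ : _ = c * e x + f x)//.
  by rewrite [(c *: e + f) y](_ : _ = c * e y + f y)//; ring.
exists (cn c * M + N) => x Bx; rewrite [X in cn X](_ : _ = c * e x + f x)//.
by apply: le_trans (cnD _ _) _; rewrite cnM lerD ?ler_wpM2l ?hM ?hN.
Qed.

HB.instance Definition _ := GRing.isSubmodClosed.Build _ _ bdual_pred bdual_submod.

Definition bdual := {e | e \in bdual_pred}.

HB.instance Definition _ := Choice.on bdual.
HB.instance Definition _ := [isSub of bdual for @sval _ _].
HB.instance Definition _ := [SubChoice_isSubLmodule of bdual by <:].

Definition bdual_fun (e : bdual) : L -> R[i] := val e.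
Coercion bdual_fun : bdual >-> Funclass.

Lemma bdualP (e : bdual) : is_bdual e.
Proof. by have := valP e; rewrite bdual_predE => /asboolP. Qed.

Definition bdual_mk e (he : is_bdual e) : bdual := exist _ e (asboolT he).

Lemma bdualDE (e f : bdual) x : (e + f : bdual) x = e x + f x. Proof. by []. Qed.
Lemma bdualZE c (e : bdual) x : (c *: e : bdual) x = c * e x. Proof. by []. Qed.
Lemma bdual_ext (e f : bdual) : (forall x, S x -> e x = f x) -> e = f.
Proof.
move=> ef; apply/val_inj/funext => x.
have [Sx|Sx] := pselect (S x); first exact: ef.
by rewrite -/(bdual_fun e) -/(bdual_fun f); case: (bdualP e) (bdualP f) => e0 _ _ [f0 _ _]; rewrite e0// f0.
Qed.

Definition bnorm (e : bdual) : R := sup [set r | exists2 x, B x & r = cn (e x)].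

Lemma le_bnorm (e : bdual) x : B x -> cn (e x) <= bnorm e.
Proof.
move=> Bx; have [_ _ [M hM]] := bdualP e.
by apply: ub_le_sup; [exists M => _ [y By ->]; exact: hM | exists x].
Qed.

Lemma bnorm_ge0 (e : bdual) : 0 <= bnorm e.
Proof. exact: le_trans (cn_ge0 _) (le_bnorm _ (bs_ball0 X)). Qed.

Lemma bnorm_le (e : bdual) C : (forall x, B x -> cn (e x) <= C) -> bnorm e <= C.
Proof.
move=> h; apply: ge_sup => [|_ [x Bx ->]]; last exact: h.
by exists (cn (e 0)), 0 => //; exact: bs_ball0.
Qed.

Lemma bnormD (e f : bdual) : bnorm (e + f) <= bnorm e + bnorm f.
Proof.
apply: bnorm_le => x Bx; rewrite bdualDE; apply: le_trans (cnD _ _) _.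
by rewrite lerD// le_bnorm.
Qed.

Lemma bdualZ (e : bdual) c x : S x -> e (c *: x) = c * e x.
Proof.
case: (bdualP e) => _ el _ Sx.
have S0 : S 0 by apply: bs_sub; exact: bs_ball0.
have e0 : e 0 = 0.
  have := el 1 0 0 S0 S0; rewrite scale1r addr0 mul1r.
  by move=> /(congr1 (+%R^~ (- e 0))); rewrite addrK subrr.
by have := el c x 0 Sx S0; rewrite e0 !addr0.
Qed.

Lemma bnormZ c (e : bdual) : bnorm (c *: e) = cn c * bnorm e.
Proof.
have le k (f : bdual) : bnorm (k *: f) <= cn k * bnorm f.
  by apply: bnorm_le => x Bx; rewrite bdualZE cnM ler_wpM2l// le_bnorm.
apply/le_anti; rewrite le /=; have [->|c0] := eqVneq c 0.
  by rewrite cn0 mul0r bnorm_ge0.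
have cp : 0 < cn c by rewrite lt_def cn_eq0 c0 cn_ge0.
rewrite -ler_pdivlMl// -cnV; apply: le_trans (le _ _).
by rewrite scalerA mulVf// scale1r.
Qed.

Lemma bnorm_absorb (x : L) : exists2 C : R, 0 < C & forall e : bdual, cn (e x) <= C * bnorm e.
Proof.
have [Sx|Sx] := pselect (S x); last first.
  exists 1 => // e; case: (bdualP e) => e0 _ _; rewrite e0// cn0 mul1r.
  exact: bnorm_ge0.
have [c c0 Bc] := bs_absorbing Sx; exists c^-1 => [|e]; first by rewrite invr_gt0.
rewrite ler_pdivlMl//; apply: le_trans (le_bnorm _ Bc).
by rewrite bdualZ// cnM cn_real gtr0_norm.
Qed.

Lemma bnorm0_eq0 e : bnorm e = 0 -> e = 0.
Proof.
move=> e0; apply: bdual_ext => x _; apply: cn0_eq0; apply/le_anti.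
have [C _ h] := bnorm_absorb x; have := h e; rewrite e0 mulr0 => ->.
by rewrite cn_ge0.
Qed.

Let cnorm (e : bdual) : R[i] := (bnorm e)%:C.
Let cnormD e f : cnorm (e + f) <= cnorm e + cnorm f.
Proof. by rewrite /cnorm -real_complexD lecR bnormD. Qed.
Let cnormZ c e : cnorm (c *: e) = `|c| * cnorm e.
Proof. by rewrite /cnorm bnormZ cnE real_complexM. Qed.
Let cnorm0_eq0 e : cnorm e = 0 -> e = 0.
Proof. by move=> /complexI/bnorm0_eq0. Qed.

HB.instance Definition _ := Lmodule_isNormed.Build R[i] bdual cnormD cnormZ cnorm0_eq0.

Lemma rnorm_bdual (e : bdual) : rnorm e = bnorm e.
Proof. by []. Qed.

(** Pointwise limits exist at every x, with a rate depending on x, because the ball is absorbing. On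
    the ball the rate is uniform, and [l_unique] identifies the two limits. *)
Lemma bdual_complete (F : set_system bdual) : ProperFilter F -> cauchy F -> cvg F.
Proof.
suff h (u : nat -> bdual) :
    (forall m n, bnorm (u m - u n) <= 2^-1 ^+ m + 2^-1 ^+ n) ->
    exists l : bdual, exists C, forall n, bnorm (l - u n) <= C * 2^-1 ^+ n.
  exact: sequentially_complete.
move=> hu.
have p0 n : 0 <= 2^-1 ^+ n :> R by rewrite exprn_ge0// invr_ge0.
have /choice[l hl] : forall x, exists l, exists C, forall n, cn (l - u n x) <= C * 2^-1 ^+ n.
  move=> x; have [C C0 hC] := bnorm_absorb x.
  have [l hl] : exists l, forall n, cn (l - u n x) <= 2 * (C * 2^-1 ^+ n).
    apply: (complex_limit 0%N) => m n; rewrite -mulrDr; apply: le_trans (hC (u m - u n : bdual)) _.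
    by rewrite ler_wpM2l// ltW.
  by exists l, (2 * C) => n; rewrite -mulrA.
have l_unique x z C : (forall n, cn (z - u n x) <= C * 2^-1 ^+ n) -> z = l x.
  move=> hz; have [D hD] := hl x.
  apply/eqP; rewrite -subr_eq0; apply/eqP/cn0_eq0/le_anti; rewrite cn_ge0 andbT.
  apply: (le_geometric (C := C + D)) => n; rewrite add0r mulrDl.
  have -> : z - l x = (z - u n x) - (l x - u n x) by rewrite opprB addrA subrK.
  by apply: le_trans (cnB _ _) _; rewrite lerD.
have lB x n : B x -> cn (l x - u n x) <= 2 * 2^-1 ^+ n.
  move=> Bx; have [z hz] : exists z, forall n, cn (z - u n x) <= 2 * 2^-1 ^+ n.
    apply: (complex_limit 0%N) => i j; apply: le_trans (hu i j).
    exact: (le_bnorm (u i - u j : bdual) Bx).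
  by rewrite -(l_unique _ _ _ hz).
have l_dual : is_bdual l.
  split=> [x Sx|c x y Sx Sy|].
  - apply/esym/(l_unique _ _ 0) => n; case: (bdualP (u n)) => e0 _ _.
    by rewrite e0// subrr cn0 mul0r.
  - have [C hC] := hl x; have [D hD] := hl y.
    apply/esym/(l_unique _ _ (cn c * C + D)) => n; case: (bdualP (u n)) => _ el _.
    rewrite el// opprD addrACA -mulrBr; apply: le_trans (cnD _ _) _.
    by rewrite cnM mulrDl lerD// -mulrA ler_wpM2l.
  exists (2 + bnorm (u 0%N)) => x Bx; rewrite -[l x](subrK (u 0%N x)).
  apply: le_trans (cnD _ _) _; rewrite lerD ?le_bnorm//.
  by have := lB x 0%N Bx; rewrite expr0 mulr1.
exists (bdual_mk l_dual), 2 => n; apply: bnorm_le => x Bx; exact: lB.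
Qed.

HB.instance Definition _ := Uniform_isComplete.Build bdual bdual_complete.

End BallDual.

Section Pullback.
Variables (R : realType) (L : lmodType R[i]) (X : ball_space L) (theta : L -> L).
Hypothesis theta_lin : linear theta.
Hypothesis theta_space : forall F, bs_space X F -> bs_space X (theta F).
Hypothesis theta_ball : exists2 C : R, 0 < C &
  forall F, bs_ball X F -> bs_ball X (C^-1%:C *: theta F).

Lemma pullback_bdual (e : bdual X) :
  is_bdual X (fun F => if `[< bs_space X F >] then e (theta F) else 0).
Proof.
have [e0 el [M hM]] := bdualP e; split=> [F SF|c F G SF SG|].
- by case: asboolP.
- rewrite !asboolT//; last exact: bs_space_lin.
  by rewrite theta_lin el//; exact: theta_space.
have [C C0 hC] := theta_ball; exists (C * M) => F BF.
have SF := bs_sub BF; rewrite asboolT//.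
have := hM _ (hC F BF); rewrite bdualZ ?cnM ?cn_real; last exact: theta_space.
by rewrite gtr0_norm ?invr_gt0// ler_pdivrMl.
Qed.

Definition pullback (e : bdual X) : bdual X := bdual_mk (pullback_bdual e).

Lemma pullbackE e F : bs_space X F -> pullback e F = e (theta F).
Proof. by move=> SF; rewrite /pullback /bdual_fun /= asboolT. Qed.

End Pullback.

Section BoundedForms.
Variables (R : realType) (V : lmodType R[i]) (nr : V -> R) (W : set V).
Hypothesis nr_ge0 : forall x, 0 <= nr x.
Hypothesis nrZ : forall c x, nr (c *: x) = cn c * nr x.
Local Notation L := (V -> V -> R[i]).

Record is_bform (F : L) : Prop := {
  bform_linl : forall y, scalar (F^~ y);
  bform_linr : forall x, scalar (F x);
  bform_Wl : forall x y, W x -> F x y = 0;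
  bform_Wr : forall x y, W y -> F x y = 0;
  bform_bounded : exists M, forall x y, cn (F x y) <= M * nr x * nr y }.

Definition bform_ball (F : L) : Prop :=
  is_bform F /\ forall x y, cn (F x y) <= nr x * nr y.

Lemma bform_lin c F G : is_bform F -> is_bform G -> is_bform (c *: F + G).
Proof.
move=> [Fl Fr Fwl Fwr [M hM]] [Gl Gr Gwl Gwr [N hN]].
have E x y : (c *: F + G) x y = c * F x y + G x y by [].
split.
- by move=> y k u v; rewrite !E (Fl y) (Gl y); ring.
- by move=> x k u v; rewrite !E (Fr x) (Gr x); ring.
- by move=> x y Wx; rewrite E Fwl// Gwl// mulr0 addr0.
- by move=> x y Wy; rewrite E Fwr// Gwr// mulr0 addr0.
exists (cn c * M + N) => x y; rewrite E; apply: le_trans (cnD _ _) _.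
rewrite cnM -[leRHS]mulrA mulrDl -mulrA; apply: lerD; last by rewrite mulrA.
by rewrite ler_wpM2l// mulrA.
Qed.

Lemma bform0 : is_bform 0.
Proof.
split=> //; try by move=> y k u v; rewrite mulr0 addr0.
by exists 0 => x y; rewrite cn0 !mul0r.
Qed.

Lemma bform_absorbing F : is_bform F -> exists2 c : R, 0 < c & bform_ball (c%:C *: F).
Proof.
move=> hF; have [_ _ _ _ [M hM]] := hF; exists (`|M| + 1)^-1.
  by rewrite invr_gt0 ltr_wpDl.
split; first by rewrite -[_ *: F]addr0; apply: bform_lin => //; exact: bform0.
move=> x y; rewrite [X in cn X](_ : _ = (`|M| + 1)^-1%:C * F x y)// cnM cn_real.
rewrite ger0_norm ?invr_ge0 ?addr_ge0// ler_pdivrMl ?ltr_wpDl//.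
apply: le_trans (hM x y) _; rewrite -mulrA ler_wpM2r ?mulr_ge0//.
by apply: le_trans (ler_norm _) _; rewrite lerDl.
Qed.

Lemma bform_ball0 : bform_ball 0.
Proof. by split=> [|x y]; [exact: bform0 | rewrite cn0 mulr_ge0]. Qed.

Definition bform_space : ball_space L :=
  @BallSpace R L is_bform bform_ball bform_lin (fun F h => h.1) bform_ball0 bform_absorbing.

Definition n2 (K : finType) (x : K -> V) : R := l2 (fun k => (nr (x k))%:C).

Lemma n2_ge0 (K : finType) (x : K -> V) : 0 <= n2 x. Proof. exact: l2_ge0. Qed.

Lemma n2_sqr (K : finType) (x : K -> V) : n2 x ^+ 2 = \sum_k nr (x k) ^+ 2.
Proof. by rewrite l2_sqr; apply: eq_bigr => k _; rewrite cn_real ger0_norm. Qed.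

Lemma sum_nr_nr (K : finType) (x y : K -> V) : \sum_k nr (x k) * nr (y k) <= n2 x * n2 y.
Proof.
have -> : n2 x * n2 y = Num.sqrt (\sum_k nr (x k) ^+ 2) * Num.sqrt (\sum_k nr (y k) ^+ 2).
  by congr (Num.sqrt _ * Num.sqrt _); apply: eq_bigr => k _; rewrite cn_real ger0_norm.
exact: cauchy_schwarz_sum.
Qed.

(** Reads the matrix F as one bounded form on V^K x V^K: the column index goes with the first
    argument and the row index with the second, as in the product of a row y, a matrix and a column
    x. *)
Definition contr (K : finType) (F : K -> K -> L) (C : R) : Prop :=
  forall x y : K -> V, cn (\sum_k \sum_l F k l (x l) (y k)) <= C * n2 x * n2 y.

Definition contractive (K : finType) (F : K -> K -> L) : Prop :=
  (forall k l, is_bform (F k l)) /\ contr F 1.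

Lemma n2_scale (K : finType) (u : K -> R[i]) (z : V) :
  n2 (fun k => u k *: z) = l2 u * nr z.
Proof.
rewrite /n2 (eq_l2 (v := fun k => (nr z)%:C * (cn (u k))%:C)); last first.
  by move=> k; rewrite nrZ real_complexM mulrC.
rewrite l2Z cn_real ger0_norm// mulrC; congr (_ * _).
by congr Num.sqrt; apply: eq_bigr => k _; rewrite cn_real ger0_norm.
Qed.

(** The families u_l x and v_k y have norms l2 u * nr x and l2 v * nr y in V^K, so that
    contractivity of F bounds the compressed form by nr x * nr y. *)
Lemma contractive_ball (K : finType) (F : K -> K -> L) (v u : K -> R[i]) :
  contractive F -> l2 v <= 1 -> l2 u <= 1 ->
  bform_ball (\sum_k \sum_l (v k * u l) *: F k l).
Proof.
move=> [SF cF] v1 u1; have SZ c G : is_bform G -> is_bform (c *: G).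
  by move=> SG; rewrite -[_ *: G]addr0; apply: bform_lin => //; exact: bform0.
have SD G H : is_bform G -> is_bform H -> is_bform (G + H).
  by move=> SG SH; rewrite -[G]scale1r; exact: bform_lin.
split.
  elim/big_rec: _ => [|k G _ SG]; first exact: bform0.
  apply: (SD) => //; elim/big_rec: _ => [|l H _ SH]; first exact: bform0.
  by apply: (SD) => //; exact: SZ.
move=> x y.
have -> : (\sum_k \sum_l (v k * u l) *: F k l) x y =
    \sum_k \sum_l F k l (u l *: x) (v k *: y).
  rewrite !fct_sumE; apply: eq_bigr => k _; rewrite !fct_sumE; apply: eq_bigr => l _.
  rewrite (scalarZ (bform_linl (SF k l) _)) (scalarZ (bform_linr (SF k l) _)).
  by rewrite [LHS](_ : _ = v k * u l * F k l x y)//; ring.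
apply: le_trans (cF _ _) _; rewrite mul1r !n2_scale.
by rewrite ler_pM ?mulr_ge0// ler_piMl.
Qed.

Local Notation E := (bdual bform_space).

(* A matrix of functionals is normed by its pairings with the matrices of forms
   that are contractive on [V^m], a class that row and column contractive actions
   on [V] preserve. *)
Definition form_norms : matrix_norms R E := fun n e =>
  sup [set r | exists m (F : 'I_m -> 'I_m -> L), contractive F /\
    r = mx_opnorm (\matrix_(r < n * m, s < n * m)
      e (mxtens_unindex r).1 (mxtens_unindex s).1
        (F (mxtens_unindex r).2 (mxtens_unindex s).2))].

(** Compression of F by vectors of norm at most 1 lands in the unit ball of forms, where e is
    bounded by its norm; homogeneity then removes the normalization of v and u. *)
Lemma opb_bdual (K : finType) (F : K -> K -> L) (e : E) :
  contractive F -> opb (fun k l => e (F k l)) (bnorm e).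
Proof.
move=> cF; have h v u : l2 v <= 1 -> l2 u <= 1 -> cn (bil (fun k l => e (F k l)) v u) <= bnorm e.
  move=> v1 u1.
  have -> : bil (fun k l => e (F k l)) v u = e (\sum_k \sum_l (v k * u l) *: F k l).
    have [SF _] := cF; have [_ el _] := bdualP e.
    have e0 : e 0 = 0 by rewrite -(scale0r 0) bdualZ ?mul0r//; exact: bform0.
    have SZ c G : is_bform G -> is_bform (c *: G).
      by move=> SG; rewrite -[_ *: G]addr0; apply: bform_lin => //; exact: bform0.
    have esum (I : finType) (G : I -> L) : (forall i, is_bform (G i)) ->
        is_bform (\sum_i G i) /\ e (\sum_i G i) = \sum_i e (G i).
      move=> SG; elim/big_rec2: _ => [|i y z _ [Sz <-]].
        by split=> //; exact: bform0.
      rewrite -[G i]scale1r; split; first exact: bform_lin.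
      by rewrite el// scale1r mul1r.
    have S1 k : is_bform (\sum_l (v k * u l) *: F k l) by apply: (esum _ _ _).1 => l; exact: SZ.
    rewrite (esum _ _ S1).2; apply: eq_bigr => k _.
    rewrite (esum _ _ (fun l => SZ _ _ (SF k l))).2; apply: eq_bigr => l _.
    by rewrite bdualZ; [ring | exact: SF].
  exact/le_bnorm/contractive_ball.
move=> v u; have [v0|v0] := eqVneq (l2 v) 0.
  rewrite v0 mulr0 mul0r /bil big1 ?cn0// => k _; rewrite big1// => l _.
  by rewrite (l2_eq0 v0) !mul0r.
have [u0|u0] := eqVneq (l2 u) 0.
  rewrite u0 mulr0 /bil big1 ?cn0// => k _; rewrite big1// => l _.
  by rewrite (l2_eq0 u0) mulr0.
have vp : 0 < l2 v by rewrite lt_def v0 l2_ge0.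
have up : 0 < l2 u by rewrite lt_def u0 l2_ge0.
have := h (fun k => (l2 v)^-1%:C * v k) (fun l => (l2 u)^-1%:C * u l).
rewrite !l2Z !cn_real !ger0_norm ?invr_ge0// !mulVf// lexx => /(_ isT isT).
have -> : bil (fun k l => e (F k l)) (fun k => (l2 v)^-1%:C * v k) (fun l => (l2 u)^-1%:C * u l) =
    ((l2 v)^-1 * (l2 u)^-1)%:C * bil (fun k l => e (F k l)) v u.
  rewrite /bil mulr_sumr; apply: eq_bigr => k _; rewrite mulr_sumr; apply: eq_bigr => l _.
  by rewrite real_complexM; ring.
rewrite cnM cn_real ger0_norm ?mulr_ge0 ?invr_ge0// => h1.
by rewrite -mulrA mulrC -ler_pdivrMl ?mulr_gt0// invfM.
Qed.

Lemma opb_bdual_mx n (K : finType) (F : K -> K -> L) (e : 'M[E]_n) : contractive F ->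
  opb (fun p q : 'I_n * K => e p.1 q.1 (F p.2 q.2)) (\sum_i \sum_j bnorm (e i j)).
Proof.
move=> cF v u.
have -> : bil (fun p q : 'I_n * K => e p.1 q.1 (F p.2 q.2)) v u =
    \sum_i \sum_j bil (fun k l => e i j (F k l)) (fun k => v (i, k)) (fun l => u (j, l)).
  rewrite {1}/bil big_pair; apply: eq_bigr => i _; rewrite exchange_big /=.
  rewrite big_pair; apply: eq_bigr => j _.
  by rewrite exchange_big /=; apply: eq_bigr => k _.
have le_l2 (w : 'I_n * K -> R[i]) i : l2 (fun k => w (i, k)) <= l2 w.
  rewrite -(ler_pXn2r (ltn0Sn 1)) ?nnegrE//.
  rewrite !l2_sqr (big_pair (fun p => cn (w p) ^+ 2)) (bigD1 i)//= lerDl.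
  by apply: sumr_ge0 => j _; apply: sumr_ge0 => k _; rewrite sqr_ge0.
apply: le_trans (cn_sum _ _ _) _; rewrite -mulrA mulr_suml; apply: ler_sum => i _.
apply: le_trans (cn_sum _ _ _) _; rewrite mulr_suml; apply: ler_sum => j _.
apply: le_trans (opb_bdual _ cF _ _) _.
have b0 := bnorm_ge0 (e i j).
by rewrite -mulrA ler_wpM2l// ler_pM.
Qed.

Lemma contractive0 : contractive (fun _ _ : 'I_0 => 0).
Proof. by split=> [[]//|x y]; rewrite big_ord0 cn0 !mulr_ge0// n2_ge0. Qed.

Lemma mxtens_index_bij n m : bijective (@mxtens_index n m).
Proof. by exists (@mxtens_unindex n m); [exact: mxtens_indexK | exact: mxtens_unindexK]. Qed.

Lemma mxtens_unindex_bij n m : bijective (@mxtens_unindex n m).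
Proof. by exists (@mxtens_index n m); [exact: mxtens_unindexK | exact: mxtens_indexK]. Qed.

Lemma form_mxP n m (F : 'I_m -> 'I_m -> L) (e : 'M[E]_n) C : 0 <= C ->
  mx_opnorm (\matrix_(r < n * m, s < n * m)
    e (mxtens_unindex r).1 (mxtens_unindex s).1
      (F (mxtens_unindex r).2 (mxtens_unindex s).2)) <= C <->
  opb (fun p q : 'I_n * 'I_m => e p.1 q.1 (F p.2 q.2)) C.
Proof.
move=> C0; rewrite opb_le_opnorm//; split=> h.
  apply: (opb_reindex (mxtens_unindex_bij n m) (mxtens_unindex_bij n m)).
  by apply: eq_opb h => r s; rewrite mxE.
apply: (opb_reindex (mxtens_index_bij n m) (mxtens_index_bij n m)).
by apply: eq_opb h => p q; rewrite mxE !mxtens_indexK.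
Qed.

Lemma form_norms_ub n m (F : 'I_m -> 'I_m -> L) (e : 'M[E]_n) : contractive F ->
  mx_opnorm (\matrix_(r < n * m, s < n * m)
    e (mxtens_unindex r).1 (mxtens_unindex s).1
      (F (mxtens_unindex r).2 (mxtens_unindex s).2)) <= form_norms e.
Proof.
move=> cF; apply: ub_le_sup; last by exists m, F.
exists (\sum_i \sum_j bnorm (e i j)) => _ [m' [F' [cF' ->]]].
apply/form_mxP; last exact: opb_bdual_mx.
by do 2! (apply: sumr_ge0 => ? _); exact: bnorm_ge0.
Qed.

Lemma form_normsP n (e : 'M[E]_n) C : 0 <= C -> form_norms e <= C <->
  forall m (F : 'I_m -> 'I_m -> L), contractive F ->
    opb (fun p q : 'I_n * 'I_m => e p.1 q.1 (F p.2 q.2)) C.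
Proof.
move=> C0.
split=> [h m F cF|h].
  by apply/form_mxP => //; apply: le_trans h; exact: form_norms_ub.
apply: ge_sup; last by move=> _ [m [F [cF ->]]]; apply/form_mxP => //; exact: h.
by eexists; exists 0%N, (fun _ _ => 0); split; first exact: contractive0.
Qed.

Lemma form_norms_ge0 n (e : 'M[E]_n) : 0 <= form_norms e.
Proof.
exact: (le_trans (mx_opnorm_ge0 _) (form_norms_ub e contractive0)).
Qed.

Lemma contractive_of_ball (F : L) : bform_ball F -> contractive (fun _ _ : 'I_1 => F).
Proof.
move=> [SF hF]; split=> // x y; rewrite !big_ord1 mul1r; apply: le_trans (hF _ _) _.
by rewrite /n2 /l2 !big_ord1 !sqrtr_sqr !cn_real !normr_id !ger0_norm.
Qed.

Lemma form_norms_operator_space : is_operator_space form_norms.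
Proof.
pose J := {m : nat & 'I_m -> 'I_m -> L}.
pose D := [set j : J | contractive (projT2 j)].
apply: (@concrete_operator_space _ _ _ J D (@projT1 _ _)
  (fun j e k l => (e : E) (projT2 j k l))).
- by [].
- by move=> n e; exact: form_norms_ge0.
- move=> n e C C0; rewrite form_normsP//; split=> [h [m F] /= cF|h m F cF].
    exact: h cF.
  exact: (h (existT _ m F) cF).
move=> e; apply/le_anti/andP; split.
  apply/form_normsP => // m F cF.
  have bpr : bijective (@snd 'I_1 'I_m).
    by exists (fun k => (ord0, k)) => // -[i k]; rewrite (ord1 i).
  have bk : bijective (fun k : 'I_m => (ord0 : 'I_1, k)).
    by exists (@snd 'I_1 'I_m) => // -[i k]; rewrite (ord1 i).
  apply: (opb_reindex bk bk); apply: eq_opb (opb_bdual e cF) => k l.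
  by rewrite /= mxE.
rewrite rnorm_bdual; apply: bnorm_le => F BF.
have h := (form_normsP (const_mx e : 'M[E]_1) (form_norms_ge0 _)).1 (lexx _).
by have := opb_entry (ord0, ord0) (ord0, ord0) (h _ _ (contractive_of_ball BF)); rewrite mxE.
Qed.

Lemma bformZ c F : is_bform F -> is_bform (c *: F).
Proof. by move=> SF; rewrite -[_ *: F]addr0; apply: bform_lin => //; exact: bform0. Qed.

Lemma form_norms_opb n (K : finType) (G : K -> K -> L) (e : 'M[E]_n) C : 0 <= C ->
  (forall k l, is_bform (G k l)) -> contr G C ->
  opb (fun p q : 'I_n * K => e p.1 q.1 (G p.2 q.2)) (form_norms e * C).
Proof.
move=> C0 SG cG v u; apply/ler_addgt0Pr => d d0.
pose B := form_norms e * l2 v * l2 u.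
have B0 : 0 <= B by rewrite !mulr_ge0// form_norms_ge0.
(* C may be 0, so that the forms are divided by a slightly larger c; the excess changes the estimate
   by at most d. *)
pose c := C + d / (B + 1).
have cp : 0 < c by rewrite ltr_wpDl// divr_gt0// ltr_wpDl.
pose F (i j : 'I_#|K|) : L := c^-1%:C *: G (enum_val i) (enum_val j).
have cF : contractive F.
  split=> [k l|x y]; first exact: bformZ.
  have -> : \sum_k \sum_l F k l (x l) (y k) =
      c^-1%:C * \sum_k \sum_l G k l (x (enum_rank l)) (y (enum_rank k)).
    rewrite mulr_sumr (reindex (@enum_val K K)) /=; last first.
      by apply: onW_bij; exact: enum_val_bij.
    apply: eq_bigr => k _; rewrite mulr_sumr (reindex (@enum_val K K)) /=; last first.
      by apply: onW_bij; exact: enum_val_bij.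
    by apply: eq_bigr => l _; rewrite !enum_valK.
  rewrite cnM cn_real ger0_norm ?invr_ge0 ?(ltW cp)// ler_pdivrMl//.
  apply: le_trans (cG _ _) _; rewrite mul1r [leRHS]mulrA.
  have n2E (z : 'I_#|K| -> V) : n2 (fun k => z (enum_rank k)) = n2 z.
    by rewrite /n2 (l2_reindex (fun i => (nr (z i))%:C))//; exact: enum_rank_bij.
  rewrite !n2E !ler_wpM2r ?n2_ge0//.
  by rewrite lerDl divr_ge0 ?addr_ge0// (ltW d0).
have h := (form_normsP e (form_norms_ge0 e)).1 (lexx _) _ _ cF.
have bf : bijective (fun p : 'I_n * 'I_#|K| => (p.1, enum_val p.2)).
  exists (fun p : 'I_n * K => (p.1, enum_rank p.2)) => -[i k] /=.
    by rewrite enum_valK.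
  by rewrite enum_rankK.
have h2 : opb (fun p q : 'I_n * K => e p.1 q.1 (G p.2 q.2)) (c * form_norms e).
  apply: (opb_reindex bf bf).
  rewrite -(gtr0_norm cp) -cn_real; apply: eq_opb (opbZ c%:C h) => p q /=.
  rewrite bdualZ; last exact: SG.
  by rewrite mulrA -real_complexM mulfV ?gt_eqF// mul1r.
apply: le_trans (h2 v u) _; rewrite /c mulrDl !mulrDl [X in X + _](_ : _ = form_norms e * C * l2 v * l2 u).
  rewrite lerD2l.
  have -> : d / (B + 1) * form_norms e * l2 v * l2 u = d * (B / (B + 1)) by rewrite /B; ring.
  by rewrite ler_piMr ?(ltW d0)// ler_pdivrMr ?ltr_wpDl// mul1r lerDl.
by ring.
Qed.

End BoundedForms.

(** * Splitting by operator amenability *)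

Section Splitting.
Variables (R : realType) (A : completeNormedModType R[i]) (mul : A -> A -> A).
Variables (V : lmodType R[i]) (nr : V -> R) (W : set V) (act : A -> V -> V).
Hypothesis mulC : commutative mul.
Hypothesis nr_ge0 : forall x, 0 <= nr x.
Hypothesis nrZ : forall c x, nr (c *: x) = cn c * nr x.
Hypothesis act_linr : forall a, linear (act a).
Hypothesis act_linl : forall x, linear (act^~ x).
Hypothesis act_mul : forall a b x, act (mul a b) x = act a (act b x).
Hypothesis actW : forall a x, W x -> W (act a x).
Hypothesis nr_act : forall a x, nr (act a x) <= rnorm a * nr x.
Hypothesis act_mx : forall n (a : 'M[A]_n) (x : 'I_n -> V),
  n2 nr (fun i => \sum_j act (a i j) (x j)) <= min_norms a * n2 nr x.
Hypothesis act_mxT : forall n (a : 'M[A]_n) (x : 'I_n -> V),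
  n2 nr (fun j => \sum_i act (a i j) (x i)) <= min_norms a * n2 nr x.

Local Notation L := (V -> V -> R[i]).
Local Notation X := (bform_space W nr_ge0).
Local Notation E := (bdual X).
Local Notation nuE := (@form_norms R V nr W nr_ge0).
Local Notation is_bform := (is_bform nr W).

Definition lact_form (a : A) (F : L) : L := fun x y => F (act a x) y.
Definition ract_form (a : A) (F : L) : L := fun x y => F x (act a y).

Lemma lact_bform a F : is_bform F -> is_bform (lact_form a F).
Proof.
move=> [Fl Fr Fwl Fwr [M hM]]; split=> [y c u v|x|x y Wx|x y Wy|].
- by rewrite /lact_form act_linr (Fl y).
- exact: Fr.
- by apply: Fwl; exact: actW.
- exact: Fwr.
exists (`|M| * rnorm a) => x y; apply: le_trans (hM _ _) _.
rewrite ler_wpM2r//; apply: (@le_trans _ _ (`|M| * nr (act a x))).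
  by rewrite ler_wpM2r// ler_norm.
by rewrite -mulrA ler_wpM2l.
Qed.

Lemma ract_bform a F : is_bform F -> is_bform (ract_form a F).
Proof.
move=> [Fl Fr Fwl Fwr [M hM]]; split=> [y|x c u v|x y Wx|x y Wy|].
- exact: Fl.
- by rewrite /ract_form act_linr (Fr x).
- exact: Fwl.
- by apply: Fwr; exact: actW.
exists (`|M| * rnorm a) => x y; apply: le_trans (hM _ _) _.
apply: (@le_trans _ _ (`|M| * nr x * nr (act a y))).
  by rewrite !ler_wpM2r// ler_norm.
have -> : `|M| * rnorm a * nr x * nr y = `|M| * nr x * (rnorm a * nr y) by ring.
by rewrite ler_wpM2l ?mulr_ge0.
Qed.

Let ball_of_bound C F : 0 < C -> is_bform F ->
  (forall x y, cn (F x y) <= C * (nr x * nr y)) -> bs_ball X (C^-1%:C *: F).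
Proof.
move=> C0 SF h; split; first exact: bformZ.
move=> x y; rewrite [X in cn X](_ : _ = C^-1%:C * F x y)// cnM cn_real.
by rewrite gtr0_norm ?invr_gt0// ler_pdivrMl.
Qed.

Lemma lact_form_ball a : exists2 C : R, 0 < C &
  forall F, bs_ball X F -> bs_ball X (C^-1%:C *: lact_form a F).
Proof.
exists (rnorm a + 1) => [|F [SF hF]]; first by rewrite ltr_wpDl.
apply: ball_of_bound; rewrite ?ltr_wpDl//; first exact: lact_bform.
move=> x y; apply: le_trans (hF _ _) _; rewrite mulrA ler_wpM2r//.
by apply: le_trans (nr_act _ _) _; rewrite ler_wpM2r// lerDl.
Qed.

Lemma ract_form_ball a : exists2 C : R, 0 < C &
  forall F, bs_ball X F -> bs_ball X (C^-1%:C *: ract_form a F).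
Proof.
exists (rnorm a + 1) => [|F [SF hF]]; first by rewrite ltr_wpDl.
apply: ball_of_bound; rewrite ?ltr_wpDl//; first exact: ract_bform.
move=> x y; apply: le_trans (hF _ _) _; rewrite mulrCA ler_wpM2l//.
by apply: le_trans (nr_act _ _) _; rewrite ler_wpM2r// lerDl.
Qed.

Definition lactE (a : A) (e : E) : E :=
  @pullback R _ X (lact_form a) (fun _ _ _ => erefl) (@lact_bform a) (lact_form_ball a) e.
Definition ractE (e : E) (a : A) : E :=
  @pullback R _ X (ract_form a) (fun _ _ _ => erefl) (@ract_bform a) (ract_form_ball a) e.

Lemma lactEE a e F : is_bform F -> lactE a e F = e (lact_form a F).
Proof. by move=> SF; rewrite /lactE pullbackE. Qed.
Lemma ractEE a e F : is_bform F -> ractE e a F = e (ract_form a F).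
Proof. by move=> SF; rewrite /ractE pullbackE. Qed.

Let blin (e : E) c F G : is_bform F -> is_bform G -> e (c *: F + G) = c * e F + e G.
Proof. by case: (bdualP e) => _ h _; exact: h. Qed.

(** Commutativity of A makes the action through the second argument of a form a right action; the
    two actions commute because they touch different arguments. *)
Lemma E_bimodule : is_bimodule mul lactE ractE.
Proof.
split.
- split=> [a c e f|e c a b]; apply: bdual_ext => F SF.
    by rewrite lactEE// !bdualDE !bdualZE !lactEE.
  rewrite bdualDE bdualZE !lactEE// -blin; do ?exact: lact_bform.
  congr (bdual_fun e _); apply/funext => x; apply/funext => y.
  by rewrite /lact_form act_linl (bform_linl SF y).
- split=> [e c a b|a c e f]; apply: bdual_ext => F SF.
    rewrite bdualDE bdualZE !ractEE// -blin; do ?exact: ract_bform.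
    congr (bdual_fun e _); apply/funext => x; apply/funext => y.
    by rewrite /ract_form act_linl (bform_linr SF x).
  by rewrite ractEE// !bdualDE !bdualZE !ractEE.
- move=> a b e; apply: bdual_ext => F SF.
  rewrite !lactEE//; try exact: lact_bform.
  congr (bdual_fun e _); apply/funext => x; apply/funext => y.
  by rewrite /lact_form act_mul.
- move=> e a b; apply: bdual_ext => F SF.
  rewrite !ractEE//; try exact: ract_bform.
  congr (bdual_fun e _); apply/funext => x; apply/funext => y.
  by rewrite /ract_form mulC act_mul.
move=> a e b; apply: bdual_ext => F SF.
by rewrite !lactEE// !ractEE//; do ?[exact: lact_bform | exact: ract_bform]; rewrite lactEE//; exact: ract_bform.
Qed.

Lemma contr_sum (K I : finType) (F : K -> K -> L) (x y : I -> K -> V) : contr nr F 1 ->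
  cn (\sum_i \sum_k \sum_l F k l (x i l) (y i k)) <=
  n2 nr (fun p : I * K => x p.1 p.2) * n2 nr (fun p : I * K => y p.1 p.2).
Proof.
move=> cF; apply: le_trans (cn_sum _ _ _) _.
apply: (@le_trans _ _ (\sum_i n2 nr (x i) * n2 nr (y i))).
  by apply: ler_sum => i _; rewrite -[n2 nr (x i)]mul1r; exact: cF.
exact: (sum_l2_l2 (fun i k => (nr (x i k))%:C) (fun i k => (nr (y i k))%:C)).
Qed.

Lemma n2_pair_le (I K : finType) (x y : I * K -> V) C : 0 <= C ->
  (forall k, n2 nr (fun i => x (i, k)) <= C * n2 nr (fun i => y (i, k))) ->
  n2 nr x <= C * n2 nr y.
Proof.
move=> C0 h; apply: l2_le => //; rewrite !l2_pairE mulr_sumr; apply: ler_sum => k _.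
by rewrite -exprMn ler_pXn2r ?nnegrE ?mulr_ge0//; exact: h.
Qed.

Let bsum_linl F (I : finType) (x : I -> V) y : is_bform F ->
  F (\sum_i x i) y = \sum_i F (x i) y.
Proof. by move=> SF; rewrite (scalar_sum (bform_linl SF y)). Qed.
Let bsum_linr F (I : finType) x (y : I -> V) : is_bform F ->
  F x (\sum_i y i) = \sum_i F x (y i).
Proof. by move=> SF; rewrite (scalar_sum (bform_linr SF x)). Qed.

Lemma lact_contr p (a : 'M[A]_p) m (F : 'I_m -> 'I_m -> L) : contractive nr W F ->
  contr nr (fun r s : 'I_p * 'I_m => lact_form (a r.1 s.1) (F r.2 s.2)) (min_norms a).
Proof.
move=> [SF cF] x y.
pose z i l := \sum_j act (a i j) (x (j, l)).
have -> : \sum_k \sum_l lact_form (a k.1 l.1) (F k.2 l.2) (x l) (y k) =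
    \sum_i \sum_k \sum_l F k l (z i l) (y (i, k)).
  rewrite big_pair; apply: eq_bigr => i _; apply: eq_bigr => k _.
  rewrite big_pair exchange_big; apply: eq_bigr => l _.
  by rewrite bsum_linl.
apply: le_trans (contr_sum (fun i k => z i k) (fun i k => y (i, k)) cF) _.
apply: ler_pM; rewrite ?n2_ge0//; last by rewrite /n2 (eq_l2 (v := fun k => (nr (y k))%:C))//; case.
by apply: n2_pair_le => [|k]; [exact: min_norms_ge0 | exact: (act_mx a (fun j => x (j, k)))].
Qed.

(** The entries of a reach y through the row index, that is by the transposed matrix; hence
    [act_mxT] in place of [act_mx]. *)
Lemma ract_contr p (a : 'M[A]_p) m (F : 'I_m -> 'I_m -> L) : contractive nr W F ->
  contr nr (fun r s : 'I_p * 'I_m => ract_form (a r.1 s.1) (F r.2 s.2)) (min_norms a).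
Proof.
move=> [SF cF] x y.
pose z j k := \sum_i act (a i j) (y (i, k)).
have -> : \sum_k \sum_l ract_form (a k.1 l.1) (F k.2 l.2) (x l) (y k) =
    \sum_j \sum_k \sum_l F k l (x (j, l)) (z j k).
  rewrite big_pair exchange_big.
  under eq_bigr => k _ do under eq_bigr => i _ do rewrite big_pair.
  under eq_bigr => k _ do rewrite exchange_big.
  rewrite exchange_big /=; apply: eq_bigr => j _; apply: eq_bigr => k _.
  by rewrite exchange_big /=; apply: eq_bigr => l _; rewrite bsum_linr.
apply: le_trans (contr_sum (fun j k => x (j, k)) (fun j k => z j k) cF) _.
rewrite mulrAC mulrC; apply: ler_pM; rewrite ?n2_ge0//.
  by apply: n2_pair_le => [|k]; [exact: min_norms_ge0 | exact: (act_mxT a (fun i => y (i, k)))].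
by rewrite /n2 (eq_l2 (v := fun k => (nr (x k))%:C))//; case.
Qed.

Lemma E_operator_bimodule :
  is_operator_bimodule mul (@min_norms R A) nuE lactE ractE.
Proof.
split.
- exact: form_norms_operator_space.
- exact: E_bimodule.
- exists 1 => p q a e; rewrite mul1r.
  apply/(form_normsP nrZ) => [|m F cF]; first by rewrite mulr_ge0 ?min_norms_ge0 ?(form_norms_ge0 nrZ).
  (* Regroups the indices so that the size p of a joins the size m of the form matrix: a acting on F
     is a matrix of forms indexed by pairs, bounded by the min norm of a, and e is paired with
     it. *)
  pose h (t : ('I_q * ('I_p * 'I_m))) : 'I_(p * q) * 'I_m := (mxtens_index (t.2.1, t.1), t.2.2).
  have bh : bijective h.
    exists (fun t : 'I_(p * q) * 'I_m => ((mxtens_unindex t.1).2, ((mxtens_unindex t.1).1, t.2))).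
      move=> [k [i r]]; rewrite -[LHS]/((mxtens_unindex (mxtens_index (i, k))).2,
        ((mxtens_unindex (mxtens_index (i, k))).1, r)).
      by rewrite mxtens_indexK.
    move=> [ik r]; rewrite /h; congr (_, _).
    by rewrite -surjective_pairing mxtens_unindexK.
  apply: (opb_reindex bh bh); rewrite mulrC.
  have SG (k l : 'I_p * 'I_m) : is_bform (lact_form (a k.1 l.1) (F k.2 l.2)).
    by apply: lact_bform; exact: cF.1.
  apply: eq_opb (form_norms_opb nrZ e (min_norms_ge0 a) SG (lact_contr a cF)) => t s /=.
  by rewrite !mxE !mxtens_indexK /= lactEE//; exact: cF.1.
exists 1 => q p e a; rewrite mul1r.
apply/(form_normsP nrZ) => [|m F cF]; first by rewrite mulr_ge0 ?min_norms_ge0 ?(form_norms_ge0 nrZ).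
pose h (t : ('I_q * ('I_p * 'I_m))) : 'I_(q * p) * 'I_m := (mxtens_index (t.1, t.2.1), t.2.2).
have bh : bijective h.
  exists (fun t : 'I_(q * p) * 'I_m => ((mxtens_unindex t.1).1, ((mxtens_unindex t.1).2, t.2))).
    move=> [k [i r]]; rewrite -[LHS]/((mxtens_unindex (mxtens_index (k, i))).1,
      ((mxtens_unindex (mxtens_index (k, i))).2, r)).
    by rewrite mxtens_indexK.
  move=> [ik r]; rewrite /h; congr (_, _).
  by rewrite -surjective_pairing mxtens_unindexK.
apply: (opb_reindex bh bh).
have SG (k l : 'I_p * 'I_m) : is_bform (ract_form (a k.1 l.1) (F k.2 l.2)).
  by apply: ract_bform; exact: cF.1.
apply: eq_opb (form_norms_opb nrZ e (min_norms_ge0 a) SG (ract_contr a cF)) => t s /=.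
by rewrite !mxE !mxtens_indexK /= ractEE//; exact: cF.1.
Qed.

Variable Q0 : L.
Variable K0 : R.
Hypothesis K0_ge0 : 0 <= K0.
Hypothesis Q0_linl : forall y, scalar (Q0^~ y).
Hypothesis Q0_linr : forall x, scalar (Q0 x).
Hypothesis Q0_bounded : forall x y, cn (Q0 x y) <= K0 * (nr x * nr y).
Hypothesis Q0_Wl : forall x y, W x -> Q0 x y = 0.
Hypothesis Q0_Wr : forall a x y, W y -> Q0 (act a x) y = Q0 x (act a y).

(** The coboundary of [Q0]. Since [Q0] need not vanish on V x W, it is not itself one of the forms
    underlying E, although its coboundary is; amenability supplies a primitive among those forms. *)
Definition defect (a : A) : L := fun x y => Q0 x (act a y) - Q0 (act a x) y.

Lemma defect_bform a : is_bform (defect a).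
Proof.
split=> [y c u v|x c u v|x y Wx|x y Wy|].
- by rewrite /defect act_linr (Q0_linl (act a y)) (Q0_linl y); ring.
- by rewrite /defect act_linr (Q0_linr x) (Q0_linr (act a x)); ring.
- by rewrite /defect !Q0_Wl ?subrr//; exact: actW.
- by rewrite /defect Q0_Wr ?subrr.
exists (K0 * (rnorm a + rnorm a)) => x y; apply: le_trans (cnB _ _) _.
apply: le_trans (lerD (Q0_bounded _ _) (Q0_bounded _ _)) _.
rewrite -mulrDr -!mulrA ler_wpM2l// mulrDl lerD//.
  by rewrite mulrCA ler_wpM2l// nr_act.
by rewrite mulrA ler_wpM2r// nr_act.
Qed.

(** Summing over one index first leaves two diagonal sums of [Q0], one with the matrix a acting on x
    and one with its transpose acting on y. Each contributes K0 times the min norm, hence the factor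
    2. *)
Lemma defect_contr n (a : 'M[A]_n) :
  contr nr (fun k l => defect (a k l)) (2 * K0 * min_norms a).
Proof.
move=> x y.
have Q0_sum (z w : 'I_n -> V) : cn (\sum_k Q0 (z k) (w k)) <= K0 * (n2 nr z * n2 nr w).
  apply: le_trans (cn_sum _ _ _) _.
  apply: le_trans (_ : \sum_k K0 * (nr (z k) * nr (w k)) <= _).
    by apply: ler_sum => k _; exact: Q0_bounded.
  by rewrite -mulr_sumr ler_wpM2l// sum_nr_nr.
have -> : \sum_k \sum_l defect (a k l) (x l) (y k) =
    \sum_l Q0 (x l) (\sum_k act (a k l) (y k)) -
    \sum_k Q0 (\sum_l act (a k l) (x l)) (y k).
  under [in RHS]eq_bigr do rewrite (scalar_sum (Q0_linr _)).
  under [X in _ = _ - X]eq_bigr do rewrite (scalar_sum (Q0_linl _)).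
  rewrite [X in _ = X - _]exchange_big -sumrB /=.
  by apply: eq_bigr => k _; rewrite -sumrB.
apply: le_trans (cnB _ _) _; apply: le_trans (lerD (Q0_sum _ _) (Q0_sum _ _)) _.
have m0 := min_norms_ge0 a.
apply: (@le_trans _ _ (K0 * (n2 nr x * (min_norms a * n2 nr y)) +
                       K0 * (min_norms a * n2 nr x * n2 nr y))).
  by apply: lerD; rewrite ler_wpM2l//; [rewrite ler_wpM2l ?n2_ge0 | rewrite ler_wpM2r ?n2_ge0].
by apply: le_of_eq; ring.
Qed.

Definition defect_derivation (a : A) (e : E) : R[i] := e (defect a).

Lemma defect_dual_derivation : is_dual_derivation mul lactE ractE defect_derivation.
Proof.
split.
- move=> a; have [C C0 hC] := @bnorm_absorb R L X (defect a).
  by apply: (dual_intro _ hC).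
- move=> e c a b; rewrite /defect_derivation -blin; do ?exact: defect_bform.
  congr (bdual_fun e _); apply/funext => x; apply/funext => y.
  rewrite [RHS](_ : _ = c * defect a x y + defect b x y)//.
  by rewrite /defect !act_linl (Q0_linr x) (Q0_linl y); ring.
move=> a b e; rewrite /dual_lact /dual_ract /defect_derivation.
rewrite ractEE ?lactEE; do ?exact: defect_bform.
rewrite -[X in X + _]mul1r -blin; [|exact/ract_bform/defect_bform|exact/lact_bform/defect_bform].
congr (bdual_fun e _); apply/funext => x; apply/funext => y.
rewrite [RHS](_ : _ = 1 * defect b x (act a y) + defect a (act b x) y)//.
by rewrite /defect mulC act_mul (mulC b) act_mul; ring.
Qed.

Lemma defect_cb : completely_bounded (@min_norms R A) (dual_norms nuE) defect_derivation.
Proof.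
exists (2 * K0) => n a; have m0 := min_norms_ge0 a.
apply: ge_sup.
  (* The empty matrix shows that the supremum is taken over a nonempty set. *)
  by eexists; exists 0%N, 0; split; first by rewrite (le_trans _ ler01)//; apply/(form_normsP nrZ) => // m F _ v u; rewrite /bil big1 ?cn0 ?mul0r// => -[[]].
move=> _ [m [e [e1 ->]]]; apply: mx_opnorm_le; first by rewrite !mulr_ge0.
apply: (opb_reindex (mxtens_index_bij m n) (mxtens_index_bij m n)).
apply: (@opb_le _ _ _ _ (form_norms e * (2 * K0 * min_norms a))).
  by rewrite ler_piMl ?mulr_ge0.
have SG (k l : 'I_n) : is_bform (defect (a k l)) by exact: defect_bform.
apply: eq_opb (form_norms_opb nrZ e _ SG (defect_contr a)); last by rewrite !mulr_ge0.
by move=> p q; rewrite !mxE !mxtens_indexK.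
Qed.

Lemma tensor_bdual x y : is_bdual X (fun F => if `[< is_bform F >] then F x y else 0).
Proof.
split=> [F SF|c F G SF SG|]; first by case: asboolP.
  by rewrite !asboolT//; exact: bform_lin.
by exists (nr x * nr y) => F [SF hF]; rewrite asboolT.
Qed.

Definition tensor x y : E := bdual_mk (tensor_bdual x y).

Lemma tensorE x y F : is_bform F -> tensor x y F = F x y.
Proof. by move=> SF; rewrite /tensor /bdual_fun /= asboolT. Qed.

(* Innerness, tested on elementary tensors, turns the defect of [Q0] into the
   defect of a form vanishing on [W]. *)
Lemma splitting : operator_amenable mul (@min_norms R A) ->
  exists2 Q1, is_bform Q1 & forall a x y,
    Q1 x (act a y) - Q1 (act a x) y = Q0 x (act a y) - Q0 (act a x) y.
Proof.
move=> /(_ E nuE lactE ractE E_operator_bimodule _ defect_dual_derivation defect_cb).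
move=> [Phi dPhi inner]; exists (fun x y => Phi (tensor x y)).
  split.
  - move=> y c u v; rewrite -dPhi.1; congr Phi; apply: bdual_ext => F SF.
    by rewrite bdualDE bdualZE !tensorE// (bform_linl SF y).
  - move=> x c u v; rewrite -dPhi.1; congr Phi; apply: bdual_ext => F SF.
    by rewrite bdualDE bdualZE !tensorE// (bform_linr SF x).
  - move=> x y Wx; rewrite -(scalar0 dPhi.1); congr Phi; apply: bdual_ext => F SF.
    by rewrite tensorE// (bform_Wl SF).
  - move=> x y Wy; rewrite -(scalar0 dPhi.1); congr Phi; apply: bdual_ext => F SF.
    by rewrite tensorE// (bform_Wr SF).
  have [C C0 hC] := dual_bounded dPhi; exists C => x y.
  apply: le_trans (hC _) _; rewrite -mulrA ler_wpM2l//.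
  by apply: bnorm_le => F [SF hF]; rewrite tensorE.
move=> a x y; have := inner a (tensor x y).
rewrite /defect_derivation tensorE; last exact: defect_bform.
move=> h; rewrite -[RHS]/(defect a x y) h /dual_lact /dual_ract.
congr (Phi _ - Phi _); apply: bdual_ext => F SF.
  by rewrite ractEE// !tensorE//; exact: ract_bform.
by rewrite lactEE// !tensorE//; exact: lact_bform.
Qed.

End Splitting.

(** * Projection and commutation in L2 of a mean *)

Section Projection.
Variables (R : realType) (V : lmodType R[i]) (ip : V -> V -> R) (W : set V).
Variable I : V -> V -> R[i].
Hypothesis ipD : forall x y z, ip (x + y) z = ip x z + ip y z.
Hypothesis ipC : forall x y, ip x y = ip y x.
Hypothesis ipZ : forall c x y, ip (c *: x) y = ip x (c^* *: y).
Hypothesis ipR : forall (r : R) x y, ip (r%:C *: x) y = r * ip x y.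
Hypothesis ip_ge0 : forall x, 0 <= ip x x.

Definition ipnorm x := Num.sqrt (ip x x).
Local Notation nr := ipnorm.

Hypothesis nrZ : forall c x, nr (c *: x) = cn c * nr x.
Hypothesis W_lin : forall c x y, W x -> W y -> W (c *: x + y).
Hypothesis W0 : W 0.
Hypothesis I_linl : forall y, scalar (I^~ y).
Hypothesis I_linr : forall x, scalar (I x).
Hypothesis I_bounded : forall x y, cn (I x y) <= nr x * nr y.
Hypothesis I_W : forall x y, W x -> W y -> I x y = 0.

Let nr_ge0 x : 0 <= nr x. Proof. exact: sqrtr_ge0. Qed.
Let nr_sqr x : nr x ^+ 2 = ip x x. Proof. by rewrite sqr_sqrtr. Qed.
Let ipN x y : ip (- x) y = - ip x y.
Proof.
have := ipR (-1) x y; rewrite (rmorphN (real_complex R)) rmorph1 scaleN1r => ->.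
by rewrite mulN1r.
Qed.
Let ipB x y z : ip (x - y) z = ip x z - ip y z.
Proof. by rewrite ipD ipN. Qed.
Let WZ c x : W x -> W (c *: x).
Proof. by move=> Wx; rewrite -[_ *: x]addr0; exact: W_lin. Qed.
Let WB x y : W x -> W y -> W (x - y).
Proof. by move=> Wx Wy; rewrite addrC -scaleN1r; exact: W_lin. Qed.

(** Orthogonality of x - a to W up to e. Unlike near-minimality of the distance, it passes to linear
    combinations directly. Only the real part of the inner product is available as [ip], which
    suffices against a complex subspace. *)
Definition near_projection x a (e : R) :=
  [/\ W a, 0 <= e & forall b, W b -> `|ip (x - a) b| <= e * nr b].

(** With u = a - a' in W, the square of the norm of u is the difference of the products of x - a'
    and of x - a with u, both small. *)
Lemma near_projection_uniq x a a' e e' :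
  near_projection x a e -> near_projection x a' e' -> nr (a - a') <= e + e'.
Proof.
move=> [Wa e0 ha] [Wa' e0' ha']; pose u := a - a'; have Wu : W u by exact: WB.
have [->|u0] := eqVneq (nr u) 0; first by rewrite addr_ge0.
have up : 0 < nr u by rewrite lt_def u0 nr_ge0.
rewrite -(ler_pM2r up) -expr2 nr_sqr.
have -> : ip u u = ip (x - a') u - ip (x - a) u.
  by rewrite -ipB opprB addrC addrA subrK.
rewrite mulrDl [leRHS]addrC lerD//; first exact: le_trans (ler_norm _) (ha' u Wu).
by rewrite -ipN; apply: le_trans (ler_norm _) _; rewrite ipN normrN; exact: ha.
Qed.

Lemma near_projection_lin c x x' a a' e e' : near_projection x a e ->
  near_projection x' a' e' -> near_projection (c *: x + x') (c *: a + a') (cn c * e + e').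
Proof.
move=> [Wa e0 ha] [Wa' e0' ha']; split; [exact: W_lin | by rewrite addr_ge0 ?mulr_ge0 |].
move=> b Wb; rewrite opprD addrACA -scalerBr ipD ipZ mulrDl.
apply: le_trans (ler_normD _ _) _; rewrite lerD ?ha'//.
apply: le_trans (ha _ (WZ _ Wb)) _.
by rewrite nrZ cn_conj mulrCA mulrA.
Qed.

(** Let a minimize the squared distance from x to W up to e^2. Comparison with a + t b gives a
    nonnegative quadratic polynomial in t with constant term e^2, and its discriminant bounds the
    cross term. Comparison with 0 gives the second bound, which keeps the projected form
    contractive. *)
Lemma exists_near_projection x e : 0 < e ->
  exists2 a, near_projection x a e & nr (x - a) <= nr x + e.
Proof.
move=> e0; pose D := [set ip (x - a) (x - a) | a in W].
have lbD : has_lbound D by exists 0 => _ [a _ <-].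
have [_ [a Wa <-] hd] : exists2 r, D r & r < inf D + e ^+ 2.
  by apply: inf_adherent; [rewrite exprn_gt0 | split=> //; exists (ip (x - 0) (x - 0)), 0].
exists a.
  split=> [//||b Wb]; first exact: ltW.
  rewrite -(ler_pXn2r (ltn0Sn 1)) ?nnegrE ?mulr_ge0// ?(ltW e0)//.
  rewrite real_normK ?num_real// exprMn nr_sqr -[in X in X <= _]sqrrN.
  apply: quadratic_discr => // t.
  have h : inf D <= ip (x - (a + t%:C *: b)) (x - (a + t%:C *: b)).
    apply: ge_inf => //; exists (a + t%:C *: b) => //.
    by rewrite addrC; exact: W_lin.
  have e1 : ip (x - (a + t%:C *: b)) (x - (a + t%:C *: b)) =
      ip (x - a) (x - a) + 2 * - ip (x - a) b * t + t ^+ 2 * ip b b.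
    rewrite opprD addrA; move: (x - a) (t%:C *: b) (ipR t b) => z tb htb.
    have h1 w : ip (z - tb) w = ip z w - t * ip b w by rewrite ipB htb.
    rewrite h1 (ipC z (z - tb)) (ipC b (z - tb)) !h1 (ipC z b); ring.
  move: h; rewrite e1; move: hd; rewrite (mulrC (t ^+ 2)); lra.
rewrite -(ler_pXn2r (ltn0Sn 1)) ?nnegrE ?addr_ge0// ?(ltW e0)// nr_sqr.
apply: (@le_trans _ _ (nr x ^+ 2 + e ^+ 2)); last first.
  rewrite sqrrD lerD2r lerDl mulrn_wge0// mulr_ge0//; exact: ltW.
apply: le_trans (ltW hd) _; rewrite lerD2r nr_sqr.
by apply: ge_inf => //; exists 0; rewrite ?subr0.
Qed.

Let I0l y : I 0 y = 0. Proof. exact: (scalar0 (I_linl y)). Qed.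

(* The form [I (x - P x) y], with [P] the orthogonal projection onto the closure
   of [W]; the completion is avoided by taking limits along near projections. *)
Lemma exists_projected_form : exists Q0 : V -> V -> R[i],
  [/\ forall y, scalar (Q0^~ y), forall x, scalar (Q0 x),
      forall x y, cn (Q0 x y) <= nr x * nr y,
      forall x y, W x -> Q0 x y = 0 &
      forall x y, W y -> Q0 x y = I x y].
Proof.
have ex x y : exists l, forall a e, near_projection x a e ->
    cn (l - I (x - a) y) <= 2 * (e * nr y).
  have [a0 na0 _] := exists_near_projection x ltr01.
  pose J := {p : V * R | near_projection x p.1 p.2}.
  have [l hl] : exists l, forall j : J, cn (l - I (x - (sval j).1) y) <= 2 * ((sval j).2 * nr y).
    apply: (complex_limit (exist _ (a0, 1) na0 : J)) => -[[a e] /= na] [[a' e'] /= na'].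
    rewrite -(scalarB (I_linl y)) opprB addrC addrA subrK; apply: le_trans (I_bounded _ _) _.
    by rewrite -mulrDl ler_wpM2r// [leRHS]addrC; exact: near_projection_uniq na' na.
  by exists l => a e na; exact: (hl (exist _ (a, e) na)).
have /choice[Q hQ] : forall p : V * V, exists l, forall a e, near_projection p.1 a e ->
    cn (l - I (p.1 - a) p.2) <= 2 * (e * nr p.2) by move=> [x y]; exact: ex.
have {}hQ x y a e : near_projection x a e -> cn (Q (x, y) - I (x - a) y) <= 2 * (e * nr y).
  exact: (hQ (x, y)).
(* A scalar approximated along near projections up to O(e) must be the limit. Linearity and the
   values on W are checked through this; C leaves room for the errors of linear combinations. *)
have Quniq x y l C D : (forall e, 0 < e -> exists a, exists2 e',
    near_projection x a e' & e' <= C * e /\ cn (l - I (x - a) y) <= D * e) -> l = Q (x, y).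
  move=> h; apply/eqP; rewrite -subr_eq0; apply/eqP/cn0_eq0/le_anti; rewrite cn_ge0 andbT.
  apply: (le_geometric (C := D + 2 * C * nr y)) => n; rewrite add0r.
  have [|a [e' na [e'C ha]]] := h (2^-1 ^+ n); first by rewrite exprn_gt0// invr_gt0.
  have -> : l - Q (x, y) = (l - I (x - a) y) - (Q (x, y) - I (x - a) y).
    by rewrite opprB addrA subrK.
  apply: le_trans (cnB _ _) _; apply: le_trans (lerD ha (hQ _ y _ _ na)) _.
  have -> : (D + 2 * C * nr y) * 2^-1 ^+ n = D * 2^-1 ^+ n + 2 * (C * 2^-1 ^+ n * nr y) by ring.
  by rewrite lerD2l ler_wpM2l// ler_wpM2r.
exists (fun x y => Q (x, y)); split.
- move=> y c x x'.
  apply/esym/(Quniq _ _ _ (cn c + 1) ((cn c + 1) * (2 * nr y))) => e e0.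
  have [a na _] := exists_near_projection x e0.
  have [a' na' _] := exists_near_projection x' e0.
  exists (c *: a + a'), (cn c * e + e); first exact: near_projection_lin.
  split; first by rewrite mulrDl mul1r.
  rewrite opprD addrACA -scalerBr (I_linl y) opprD addrACA -mulrBr.
  apply: le_trans (cnD _ _) _; rewrite cnM.
  apply: le_trans (lerD (ler_wpM2l (cn_ge0 c) (hQ _ y _ _ na)) (hQ _ y _ _ na')) _.
  by apply: le_of_eq; ring.
- move=> x c y y'.
  apply/esym/(Quniq _ _ _ 1 (cn c * (2 * nr y) + 2 * nr y')) => e e0.
  have [a na _] := exists_near_projection x e0.
  exists a, e => //; split; first by rewrite mul1r.
  rewrite (I_linr (x - a)) opprD addrACA -mulrBr.
  apply: le_trans (cnD _ _) _; rewrite cnM.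
  apply: le_trans (lerD (ler_wpM2l (cn_ge0 c) (hQ _ y _ _ na)) (hQ _ y' _ _ na)) _.
  by apply: le_of_eq; ring.
- move=> x y; apply: (le_geometric (C := 3 * nr y)) => n.
  have [|a na ha] := @exists_near_projection x (2^-1 ^+ n).
    by rewrite exprn_gt0// invr_gt0.
  rewrite -[Q (x, y)](subrK (I (x - a) y)).
  apply: le_trans (cnD _ _) _; apply: le_trans (lerD (hQ _ y _ _ na) (I_bounded _ _)) _.
  apply: le_trans (lerD (lexx _) (ler_wpM2r (nr_ge0 y) ha)) _.
  by apply: le_of_eq; ring.
(* A point x of W is its own projection, with error 0. *)
- move=> x y Wx; apply/esym/(Quniq _ _ _ 1 0) => e e0; exists x, 0.
    split=> // b _; rewrite subrr mul0r.
    by have := ipB 0 0 b; rewrite !subrr => ->; rewrite normr0.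
  by rewrite mul1r (ltW e0) subrr I0l subrr cn0 mul0r.
move=> x y Wy; apply/esym/(Quniq _ _ _ 1 0) => e e0.
have [a na _] := exists_near_projection x e0; exists a, e => //.
rewrite mul1r lexx (scalarB (I_linl y)) opprB addrC subrK; split=> //.
by case: na => Wa _ _; rewrite I_W// cn0 mul0r.
Qed.

End Projection.

Section BoundedFunctions.
Variables (R : realType) (T : Type).

Definition bfun_pred : {pred T -> R[i]} := [pred f | `[< cbounded f >]].

Lemma bfun_predE f : (f \in bfun_pred) = `[< cbounded f >].
Proof. by []. Qed.

Lemma bfun_submod : submod_closed bfun_pred.
Proof.
split=> [|c f g]; rewrite !bfun_predE.
  by apply/asboolP; exists 0 => t; rewrite cn0.
move=> /asboolP bf /asboolP bg; apply/asboolP.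
exact: (cboundedD (cboundedM (cbounded_cst T c) bf) bg).
Qed.

HB.instance Definition _ := GRing.isSubmodClosed.Build _ _ bfun_pred bfun_submod.

Definition bfun := {f | f \in bfun_pred}.

HB.instance Definition _ := Choice.on bfun.
HB.instance Definition _ := [isSub of bfun for @sval _ _].
HB.instance Definition _ := [SubChoice_isSubLmodule of bfun by <:].

Definition bfun_fun (f : bfun) : T -> R[i] := val f.
Coercion bfun_fun : bfun >-> Funclass.

Lemma bfunP (f : bfun) : cbounded f.
Proof. by have := valP f; rewrite bfun_predE => /asboolP. Qed.

Definition bfun_mk f (hf : cbounded f) : bfun := exist _ f (asboolT hf).

Lemma bfun_ext (f g : bfun) : f =1 g -> f = g.
Proof. by move=> fg; apply/val_inj/funext. Qed.

Lemma bfunDE (f g : bfun) t : (f + g : bfun) t = f t + g t. Proof. by []. Qed.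
Lemma bfunZE c (f : bfun) t : (c *: f : bfun) t = c * f t. Proof. by []. Qed.
Lemma bfunNE (f : bfun) t : (- f : bfun) t = - f t. Proof. by []. Qed.
Lemma bfun_sumE (I : finType) (f : I -> bfun) t : (\sum_i f i : bfun) t = \sum_i f i t.
Proof. by elim/big_rec2: _ => // i x y _ <-. Qed.

Definition bmul (f g : bfun) : bfun := bfun_mk (cboundedM (bfunP f) (bfunP g)).

Lemma bmulE f g t : bmul f g t = f t * g t. Proof. by []. Qed.

Lemma cbounded_conj (f : T -> R[i]) : cbounded f -> cbounded (fun t => (f t)^*).
Proof. by move=> [M hM]; exists M => t; rewrite cn_conj. Qed.

Definition bconj (f : bfun) : bfun := bfun_mk (cbounded_conj (bfunP f)).

Lemma cbounded_cut (P : pred T) (f : T -> R[i]) : cbounded f ->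
  cbounded (fun t => if P t then f t else 0).
Proof.
move=> [M hM]; exists M => t; case: ifP => // _.
by rewrite cn0 (le_trans (cn_ge0 _) (hM t)).
Qed.

Definition bcut (P : pred T) (f : bfun) : bfun := bfun_mk (cbounded_cut P (bfunP f)).

Lemma bcutE P f t : bcut P f t = if P t then f t else 0. Proof. by []. Qed.

Definition bone : bfun := bfun_mk (cbounded_cst T 1).

Variable m : (T -> R) -> R.
Hypothesis hm : is_mean m.

Definition bip (f g : bfun) : R := m (fun t => complex.Re (f t * (g t)^*)).

Lemma bip_bounded (f g : bfun) : bounded_fun (fun t => complex.Re (f t * (g t)^*)).
Proof. exact: (cbounded_Re (bfunP (bmul f (bconj g)))). Qed.
Hint Resolve bip_bounded : core.

Lemma bipD f g h : bip (f + g) h = bip f h + bip g h.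
Proof.
rewrite /bip -(meanD hm)//; congr m; apply/funext => t.
by rewrite bfunDE mulrDl raddfD.
Qed.

Lemma Re_mul_conj (z w : R[i]) : complex.Re (z * w^*) =
  complex.Re z * complex.Re w + complex.Im z * complex.Im w.
Proof. by case: z w => a b [c d] /=; rewrite mulrN opprK. Qed.

Lemma bipC f g : bip f g = bip g f.
Proof. by congr m; apply/funext => t; rewrite !Re_mul_conj; ring. Qed.

Lemma cconjM (z w : R[i]) : (z * w)^* = z^* * w^*.
Proof. exact: rmorphM. Qed.

Lemma cconjK (z : R[i]) : z^*^* = z.
Proof. exact: conjCK. Qed.

Lemma bipZ c f g : bip (c *: f) g = bip f (c^* *: g).
Proof.
congr m; apply/funext => t; by rewrite !bfunZE cconjM cconjK mulrCA mulrA.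
Qed.

Lemma bipR (r : R) f g : bip (r%:C *: f) g = r * bip f g.
Proof.
rewrite /bip -(meanZ hm)//; congr m; apply/funext => t.
by rewrite bfunZE -mulrA complex_ReM /= mul0r subr0.
Qed.

Definition bsq (f : bfun) : T -> R := fun t => cn (f t) ^+ 2.

Lemma bsq_bounded f : bounded_fun (bsq f).
Proof.
have [M hM] := bfunP f; exists (M ^+ 2) => t.
rewrite ger0_norm ?sqr_ge0// ler_pXn2r ?nnegrE//.
exact: le_trans (cn_ge0 _) (hM t).
Qed.
Hint Resolve bsq_bounded : core.

Lemma bipE f : bip f f = m (bsq f).
Proof. by congr m; apply/funext => t; rewrite -cn_sqrE. Qed.

Lemma mean_ge0 f : bounded_fun f -> (forall t, 0 <= f t) -> 0 <= m f.
Proof.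
move=> bf f0; rewrite -(mean_cst hm 0); apply: (mean_homo hm) => //.
exact: bounded_fun_cst.
Qed.

Lemma bip_ge0 f : 0 <= bip f f.
Proof. by rewrite bipE; apply: mean_ge0 => // t; rewrite sqr_ge0. Qed.

Local Notation nr := (ipnorm bip).

Lemma bnr_ge0 f : 0 <= nr f. Proof. exact: sqrtr_ge0. Qed.

Lemma bnr_sqr f : nr f ^+ 2 = m (bsq f).
Proof. by rewrite sqr_sqrtr ?bip_ge0// bipE. Qed.

Lemma bnr_le (f g : bfun) C : 0 <= C -> (forall t, cn (f t) ^+ 2 <= C ^+ 2 * cn (g t) ^+ 2) ->
  nr f <= C * nr g.
Proof.
move=> C0 h; rewrite -(ler_pXn2r (ltn0Sn 1)) ?nnegrE ?mulr_ge0 ?bnr_ge0//.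
rewrite exprMn !bnr_sqr -(meanZ hm)//; apply: (mean_homo hm) => //.
exact: bounded_funZ.
Qed.

Lemma bnr_le1 (f g : bfun) C : 0 <= C -> (forall t, cn (f t) <= C * cn (g t)) -> nr f <= C * nr g.
Proof.
move=> C0 h; apply: bnr_le => // t.
by rewrite -exprMn ler_pXn2r ?nnegrE ?mulr_ge0.
Qed.

Lemma bnrZ c f : nr (c *: f) = cn c * nr f.
Proof.
apply/le_anti/andP; split; first by apply: bnr_le1 => // t; rewrite bfunZE cnM.
have [->|c0] := eqVneq c 0; first by rewrite cn0 mul0r bnr_ge0.
have cp : 0 < cn c by rewrite lt_def cn_eq0 c0 cn_ge0.
rewrite -ler_pdivlMl//; apply: bnr_le1 => [|t]; first by rewrite invr_ge0.
by rewrite bfunZE cnM mulKf// gt_eqF.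
Qed.

Lemma mean_cauchy_schwarz (f g : bfun) : m (fun t => cn (f t) * cn (g t)) <= nr f * nr g.
Proof.
have bfg : bounded_fun (fun t => cn (f t) * cn (g t)).
  have [M hM] := bfunP (bmul f g); exists M => t.
  by rewrite ger0_norm ?mulr_ge0// -cnM; exact: hM.
apply: le_sqrtM; rewrite ?bip_ge0// !bipE; apply: quadratic_discr.
  by rewrite -bipE bip_ge0.
move=> r; set h := fun t => _.
have -> : m (bsq f) + 2 * m h * r + m (bsq g) * r ^+ 2 =
    m (bsq f + (2 * r) *: h + r ^+ 2 *: bsq g).
  rewrite !(meanD hm); do ?[exact: bounded_funZ | apply: bounded_funD => //; exact: bounded_funZ | by []].
  by rewrite !(meanZ hm)//; ring.
apply: mean_ge0.
  by do !apply: bounded_funD => //; exact: bounded_funZ.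
move=> t; rewrite [leRHS](_ : _ = (cn (f t) + r * cn (g t)) ^+ 2) ?sqr_ge0//.
rewrite [LHS](_ : _ = cn (f t) ^+ 2 + 2 * r * (cn (f t) * cn (g t)) + r ^+ 2 * cn (g t) ^+ 2)//.
ring.
Qed.

End BoundedFunctions.

(** The infimum i of the right-hand sides satisfies i <= q i with q < 1, so that i <= 0. *)
Lemma le0_geometric (R : realType) (c C q : R) : 0 <= C -> 0 <= q -> q < 1 ->
  (forall n, c <= C * q ^+ n) -> c <= 0.
Proof.
move=> C0 q0 q1 h.
have N0 : [set: nat] !=set0 by exists 0%N.
have f0 n : 0 <= C * q ^+ n by rewrite mulr_ge0 ?exprn_ge0.
pose i := infv setT (fun n => C * q ^+ n).
have i0 : 0 <= i by exact: infv_ge0.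
have hi : i <= q * i.
  apply: le_mulr_infv => // n _; rewrite mulrCA -exprS.
  exact: (@infv_le _ _ _ (fun n => C * q ^+ n) n.+1).
apply: (@le_trans _ _ i); first by apply: le_infv => // n _.
nra.
Qed.

Section CommutingForm.
Variables (R : realType) (T : Type) (m : (T -> R) -> R).
Hypothesis hm : is_mean m.
Local Notation bfun := (bfun R T).
Local Notation nr := (ipnorm (bip m)).
Variables (Q : bfun -> bfun -> R[i]) (M : R).
Hypothesis Q_linl : forall y, scalar (Q^~ y).
Hypothesis Q_linr : forall x, scalar (Q x).
Hypothesis M0 : 0 <= M.
Hypothesis Q_bounded : forall x y, cn (Q x y) <= M * nr x * nr y.

Let nr0 x : 0 <= nr x. Proof. exact: bnr_ge0. Qed.
Let Q0l y : Q 0 y = 0. Proof. exact: (scalar0 (Q_linl y)). Qed.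
Let Q0r x : Q x 0 = 0. Proof. exact: (scalar0 (Q_linr x)). Qed.

Section Partition.
Variables (h : T -> R) (H : R).
Hypothesis h_ge0 : forall t, 0 <= h t.
Hypothesis h_le : forall t, h t <= H.

Lemma cbounded_real : cbounded (fun t => (h t)%:C).
Proof. by exists H => t; rewrite cn_real ger0_norm. Qed.

Definition breal : bfun := bfun_mk cbounded_real.

Hypothesis separated : forall s r (f k : bfun), s < r ->
  (forall t, f t != 0 -> h t <= s) -> (forall t, k t != 0 -> r <= h t) ->
  Q f k = 0 /\ Q k f = 0.

Lemma bmulDr (f g k : bfun) : bmul f (g + k) = bmul f g + bmul f k.
Proof. by apply: bfun_ext => t; rewrite bmulE !bfunDE !bmulE mulrDr. Qed.

Lemma bmul_sumr (I : finType) (f : bfun) (g : I -> bfun) :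
  bmul f (\sum_i g i) = \sum_i bmul f (g i).
Proof. by apply: bfun_ext => t; rewrite bmulE !bfun_sumE mulr_sumr. Qed.

Lemma bmul_eq0 (f g : bfun) t : g t = 0 -> bmul f g t = 0.
Proof. by rewrite bmulE => ->; rewrite mulr0. Qed.

(* By [separated], only the part of [y] over the values of [h] in
   [u - d, u + 2 d] meets [x], and there [h] is within [2 d] of the constant [u]. *)
Lemma cell_commutator u d (x y : bfun) : 0 < d ->
  (forall t, x t != 0 -> u <= h t <= u + d) ->
  cn (Q (bmul breal x) y - Q x (bmul breal y)) <= 3 * M * d * nr x * nr y.
Proof.
move=> d0 hx.
pose lo : pred T := fun t => h t <= u - d; pose hi : pred T := fun t => u + 2 * d <= h t.
pose y1 := bcut lo y; pose y2 := bcut (predC lo) (bcut (predC hi) y).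
pose y3 := bcut (predC lo) (bcut hi y).
have ey : y = y1 + (y3 + y2).
  apply: bfun_ext => t; rewrite !bfunDE !bcutE /=.
  by case: (lo t); case: (hi t); rewrite /= ?addr0 ?add0r.
have supp (z : bfun) t : (forall t, x t = 0 -> z t = 0) -> z t != 0 -> u <= h t <= u + d.
  by move=> zx zt; apply: hx; apply: contra zt => /eqP /zx ->.
have far_lo (z w : bfun) : (forall t, x t = 0 -> z t = 0) ->
    (forall t, w t != 0 -> lo t) -> Q z w = 0.
  move=> zx wlo; apply: (separated (s := u - d) (r := u) (f := w) (k := z) _ _ _).2.
  - lra.
  - by move=> t /wlo.
  by move=> t /(supp _ _ zx)/andP[].
have far_hi (z w : bfun) : (forall t, x t = 0 -> z t = 0) ->
    (forall t, w t != 0 -> hi t) -> Q z w = 0.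
  move=> zx whi; apply: (separated (s := u + d) (r := u + 2 * d) (f := z) (k := w) _ _ _).1.
  - lra.
  - by move=> t /(supp _ _ zx)/andP[].
  by move=> t /whi.
have lo1 t : y1 t != 0 -> lo t by rewrite bcutE; case: (lo t); rewrite ?eqxx.
have hi3 t : y3 t != 0 -> hi t.
  by rewrite !bcutE /=; case: (lo t); case: (hi t); rewrite /= ?eqxx.
have mulsupp (w : bfun) t : bmul breal w t != 0 -> w t != 0.
  by apply: contra => /eqP /bmul_eq0 ->.
have xx t : x t = 0 -> x t = 0 by [].
have hxx t : x t = 0 -> bmul breal x t = 0 by exact: bmul_eq0.
have -> : Q (bmul breal x) y = Q (bmul breal x) y2.
  rewrite ey !(scalarD (Q_linr _)) (far_lo _ _ hxx lo1) (far_hi _ _ hxx hi3).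
  by rewrite !add0r.
have -> : Q x (bmul breal y) = Q x (bmul breal y2).
  rewrite {1}ey !bmulDr !(scalarD (Q_linr _)).
  rewrite (far_lo _ _ xx (fun t h => lo1 t (mulsupp _ _ h))) add0r.
  by rewrite (far_hi _ _ xx (fun t h => hi3 t (mulsupp _ _ h))) add0r.
(* Constants cancel in the commutator, so that [breal] may be replaced by its deviation from u: at
   most d on the support of x and 2 d on that of [y2], hence the 3 in the bound. *)
pose b : bfun := breal - u%:C *: bone R T.
have bE t : b t = (h t - u)%:C.
  rewrite bfunDE bfunNE bfunZE (_ : bone R T t = 1)// mulr1.
  exact: esym (rmorphB (real_complex R) (h t) u).
have -> : Q (bmul breal x) y2 - Q x (bmul breal y2) = Q (bmul b x) y2 - Q x (bmul b y2).
  have e (w : bfun) : bmul breal w = bmul b w + u%:C *: w.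
    by apply: bfun_ext => t; rewrite bfunDE bfunZE !bmulE bE -mulrDl -real_complexD subrK.
  rewrite !e (scalarD (Q_linl _)) (scalarD (Q_linr _)).
  by rewrite (scalarZ (Q_linl _)) (scalarZ (Q_linr _)) opprD addrACA subrr addr0.
have y2y : nr y2 <= nr y.
  rewrite -[nr y]mul1r; apply: (bnr_le1 hm) => // t; rewrite mul1r !bcutE /=.
  by case: ifP => // _; [case: ifP => // _; rewrite cn0 | rewrite cn0].
apply: le_trans (cnB _ _) _.
apply: le_trans (lerD (Q_bounded _ _) (Q_bounded _ _)) _.
have bx : nr (bmul b x) <= d * nr x.
  apply: (bnr_le1 hm) => [|t]; first exact: ltW.
  have [x0|x0] := eqVneq (x t) 0; first by rewrite bmulE x0 mulr0 cn0 mulr0.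
  rewrite bmulE cnM ler_wpM2r// bE cn_real ger0_norm; have := hx t x0; lra.
have by2 : nr (bmul b y2) <= 2 * d * nr y.
  apply: (bnr_le1 hm) => [|t]; first by rewrite mulr_ge0// ltW.
  rewrite bmulE !bcutE /= bE; case: ifP => [nlo|_]; last by rewrite mulr0 cn0 !mulr_ge0// ltW.
  case: ifP => [nhi|_]; last by rewrite mulr0 cn0 !mulr_ge0// ltW.
  rewrite cnM ler_wpM2r// cn_real ler_norml.
  by move: nlo nhi; rewrite /lo /hi -!ltNge => ? ?; lra.
apply: (@le_trans _ _ (M * (d * nr x) * nr y + M * nr x * (2 * d * nr y))).
  apply: lerD; last by rewrite ler_wpM2l ?mulr_ge0.
  apply: ler_pM; rewrite ?mulr_ge0//; by rewrite ler_wpM2l.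
by apply: le_of_eq; ring.
Qed.

(* Cutting [x] into [n] level slabs of [h] of width [d = 2 H / n] costs
   [\sum_i nr (xi i) <= sqrt n * nr x], so that the commutator is of order
   [1 / sqrt n]; [n = k^2] is taken to be a square. *)
Lemma breal_commutes x y : Q (bmul breal x) y = Q x (bmul breal y).
Proof.
have [H0|H0] := ltP 0 H; last first.
  have -> : breal = 0.
    by apply: bfun_ext => t; congr (_%:C); apply/le_anti; rewrite h_ge0 (le_trans (h_le t) H0).
  have m0 (w : bfun) : bmul 0 w = 0 by apply: bfun_ext => t; rewrite bmulE mul0r.
  by rewrite !m0 Q0l Q0r.
apply/eqP; rewrite -subr_eq0; apply/eqP/cn0_eq0/le_anti; rewrite cn_ge0 andbT.
(* The slabs contribute 3 M d k with d = 2 H / k^2, that is 6 M H / k, and k = 2^j. *)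
apply: (le_geometric (C := 6 * M * H * nr x * nr y)) => j; rewrite add0r.
pose k := (2 ^ j)%N; pose n := (k * k)%N; pose d := 2 * H / n%:R.
have k0 : 0 < k%:R :> R by rewrite ltr0n expn_gt0.
have n0 : 0 < n%:R :> R by rewrite natrM mulr_gt0.
have d0 : 0 < d by rewrite divr_gt0 ?mulr_gt0.
pose idx t := Num.truncn (h t / d).
have hd t : 0 <= h t / d by rewrite divr_ge0// ltW.
have idx_itv t : (idx t)%:R * d <= h t < (idx t).+1%:R * d.
  by rewrite -ler_pdivlMr// -ltr_pdivrMr//; exact: truncn_itv.
have idx_lt t : (idx t < n)%N.
  (* The factor 2 in d makes n d = 2 H exceed H, so that the index stays below n even where h equals
     H. *)
  have /andP[h1 _] := idx_itv t; rewrite -(ltr_nat R) -(ltr_pM2r d0).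
  apply: le_lt_trans h1 _; rewrite /d mulrCA divff ?gt_eqF// mulr1.
  by apply: le_lt_trans (h_le t) _; rewrite mulr_natl mulr2n ltrDl.
pose xi (i : 'I_n) := bcut (fun t => idx t == i) x.
have ex : x = \sum_i xi i.
  apply: bfun_ext => t; rewrite bfun_sumE (bigD1 (Ordinal (idx_lt t)))//= bcutE eqxx.
  rewrite big1 ?addr0// => i /eqP ni; rewrite bcutE ifF//.
  by apply/eqP => e; apply: ni; apply: val_inj; rewrite /= e.
have sq : \sum_i nr (xi i) ^+ 2 = nr x ^+ 2.
  rewrite (bnr_sqr hm); under eq_bigr do rewrite (bnr_sqr hm).
  rewrite -(mean_sum hm); last by move=> i; exact: bsq_bounded.
  congr m; apply/funext => t; rewrite fct_sumE (bigD1 (Ordinal (idx_lt t)))//=.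
  rewrite /bsq bcutE eqxx big1 ?addr0// => i /eqP ni; rewrite bcutE ifF ?cn0 ?expr0n//.
  by apply/eqP => e; apply: ni; apply: val_inj; rewrite /= e.
have sm : \sum_i nr (xi i) <= k%:R * nr x.
  have := cauchy_schwarz_sum (fun=> 1) (fun i => nr (xi i)).
  rewrite sq sqrtr_sqr (ger0_norm (nr0 x)).
  under eq_bigr do rewrite mul1r.
  under [X in Num.sqrt X]eq_bigr do rewrite expr1n.
  by rewrite sumr_const card_ord natrM -expr2 sqrtr_sqr ger0_norm// ltW.
have -> : Q (bmul breal x) y - Q x (bmul breal y) =
    \sum_i (Q (bmul breal (xi i)) y - Q (xi i) (bmul breal y)).
  rewrite {1 2}ex bmul_sumr (scalar_sum (Q_linl _)) (scalar_sum (Q_linl _)).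
  by rewrite -sumrB.
apply: le_trans (cn_sum _ _ _) _.
apply: (@le_trans _ _ (\sum_i 3 * M * d * nr y * nr (xi i))).
  apply: ler_sum => i _; rewrite [leRHS]mulrAC.
  apply: (cell_commutator (u := i%:R * d)) => // t; rewrite bcutE.
  case: (idx t =P i) => [e _|]; last by rewrite eqxx.
  have /andP[h1 h2] := idx_itv t; rewrite -e h1 /=.
  by apply: le_trans (ltW h2) _; rewrite -natr1 mulrDl mul1r.
have c0 : 0 <= 3 * M * d * nr y.
  by apply: mulr_ge0 => //; apply: mulr_ge0; [rewrite mulr_ge0 | exact: ltW].
rewrite -mulr_sumr; apply: le_trans (ler_wpM2l c0 sm) _.
have -> : 2^-1 ^+ j = k%:R^-1 :> R by rewrite exprVn natrX.
apply: le_of_eq.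
by rewrite /d natrM; field; rewrite gt_eqF.
Qed.

End Partition.

End CommutingForm.

Section Separation.
Variables (R : realType) (T : Type) (m : (T -> R) -> R).
Hypothesis hm : is_mean m.
Local Notation bfun := (bfun R T).
Local Notation nr := (ipnorm (bip m)).
Variables (Q : bfun -> bfun -> R[i]) (M : R) (g : bfun).
Hypothesis M0 : 0 <= M.
Hypothesis Q_bounded : forall x y, cn (Q x y) <= M * nr x * nr y.
Hypothesis Q_comm : forall x y, Q (bmul g x) y = Q x (bmul g y).

(* [Q f k = Q (g^n f) (g^-n k)] decays like [(s / r)^n]. *)
Lemma separated_supports s r (f k : bfun) : 0 <= s -> s < r ->
  (forall t, f t != 0 -> cn (g t) <= s) -> (forall t, k t != 0 -> r <= cn (g t)) ->
  Q f k = 0.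
Proof.
move=> s0 sr; have r0 : 0 < r by exact: le_lt_trans sr.
have nr0 x : 0 <= nr x by exact: bnr_ge0.
have key n : forall f k : bfun, (forall t, f t != 0 -> cn (g t) <= s) ->
    (forall t, k t != 0 -> r <= cn (g t)) ->
    cn (Q f k) <= M * nr f * nr k * (s / r) ^+ n.
  elim: n => [|n ih] {}f {}k hf hk; first by rewrite mulr1.
  have kr t : cn (k t / g t) <= r^-1 * cn (k t).
    have [-> |k0] := eqVneq (k t) 0; first by rewrite mul0r cn0 mulr0.
    rewrite cnM cnV mulrC ler_wpM2r// lef_pV2 ?posrE ?hk//.
    exact: lt_le_trans r0 (hk t k0).
  have bk : cbounded (fun t => k t / g t).
    have [N hN] := bfunP k; exists (r^-1 * N) => t.
    by apply: le_trans (kr t) _; rewrite ler_wpM2l// invr_ge0 ltW.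
  pose k' : bfun := bfun_mk bk.
  have ek : k = bmul g k'.
    apply: bfun_ext => t; rewrite bmulE (_ : k' t = k t / g t)//.
    have [-> |k0] := eqVneq (k t) 0; first by rewrite mul0r mulr0.
    rewrite mulrC divfK// -cn_eq0 gt_eqF//; exact: lt_le_trans r0 (hk t k0).
  rewrite {1}ek -Q_comm; apply: le_trans (ih _ _ _ _) _.
  - move=> t; rewrite bmulE; case: (eqVneq (f t) 0) => [->|/hf//].
    by rewrite mulr0 eqxx.
  - move=> t; rewrite (_ : k' t = k t / g t)//; case: (eqVneq (k t) 0) => [->|/hk//].
    by rewrite mul0r eqxx.
  have h1 : nr (bmul g f) <= s * nr f.
    apply: (bnr_le1 hm) => // t; rewrite bmulE cnM.
    by have [->|/hf h] := eqVneq (f t) 0; rewrite ?cn0 ?mulr0// ler_wpM2r.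
  have h2 : nr k' <= r^-1 * nr k by apply: (bnr_le1 hm) => //; rewrite invr_ge0 ltW.
  rewrite exprS [leRHS]mulrA ler_wpM2r ?exprn_ge0 ?divr_ge0 ?(ltW r0)//.
  apply: (@le_trans _ _ (M * (s * nr f) * (r^-1 * nr k))).
    by rewrite ler_pM ?mulr_ge0// ler_wpM2l.
  by apply: le_of_eq; ring.
move=> hf hk; apply/cn0_eq0/le_anti; rewrite cn_ge0 andbT.
apply: (le0_geometric (C := M * nr f * nr k) (q := s / r)) => //.
- by rewrite !mulr_ge0.
- by rewrite divr_ge0// ltW.
- by rewrite ltr_pdivrMr// mul1r.
by move=> n; exact: key.
Qed.

End Separation.

Section Fuglede.
Variables (R : realType) (T : Type) (m : (T -> R) -> R).
Hypothesis hm : is_mean m.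
Local Notation bfun := (bfun R T).
Local Notation nr := (ipnorm (bip m)).
Variables (Q : bfun -> bfun -> R[i]) (M : R).
Hypothesis Q_linl : forall y, scalar (Q^~ y).
Hypothesis Q_linr : forall x, scalar (Q x).
Hypothesis M0 : 0 <= M.
Hypothesis Q_bounded : forall x y, cn (Q x y) <= M * nr x * nr y.

Let Q0l y : Q 0 y = 0. Proof. exact: (scalar0 (Q_linl y)). Qed.
Let Q0r x : Q x 0 = 0. Proof. exact: (scalar0 (Q_linr x)). Qed.

(** By [separated_supports], Q vanishes on functions supported on separated level sets of |g|, in
    either order because the transpose of Q satisfies the same hypotheses. [breal_commutes] then
    applies to |g|^2; square roots translate its levels into levels of |g|. *)
Lemma commutes_norm_sq (g : bfun) : (forall x y, Q (bmul g x) y = Q x (bmul g y)) ->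
  forall x y, Q (bmul (bmul g (bconj g)) x) y = Q x (bmul (bmul g (bconj g)) y).
Proof.
move=> Q_comm.
have [N hN] : exists N, forall t, bsq g t <= N.
  by have [N hN] := bsq_bounded g; exists N => t; apply: le_trans (ler_norm _) (hN t).
have h0 t : 0 <= bsq g t by rewrite sqr_ge0.
have -> : bmul g (bconj g) = breal h0 hN.
  by apply: bfun_ext => t; rewrite bmulE -[RHS]/((cn (g t) ^+ 2)%:C) cn_sqrE.
apply: (breal_commutes hm Q_linl Q_linr M0 Q_bounded) => s r f k sr hf hk.
have [s0|s0] := ltP s 0.
  have -> : f = 0.
    apply: bfun_ext => t; apply/eqP; apply: contraTT (h0 t) => /hf hs.
    by rewrite -ltNge (le_lt_trans hs).
  by rewrite Q0l Q0r.
have r0 : 0 < r by exact: le_lt_trans sr.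
have hf' t : f t != 0 -> cn (g t) <= Num.sqrt s.
  move=> /hf hs; rewrite -[cn (g t)](ger0_norm (cn_ge0 _)) -sqrtr_sqr.
  exact: ler_wsqrtr.
have hk' t : k t != 0 -> Num.sqrt r <= cn (g t).
  move=> /hk hr; rewrite -[cn (g t)](ger0_norm (cn_ge0 _)) -sqrtr_sqr.
  exact: ler_wsqrtr.
have srr : Num.sqrt s < Num.sqrt r by rewrite ltr_sqrt.
split; first exact: (separated_supports hm M0 Q_bounded Q_comm (sqrtr_ge0 s) srr hf' hk').
apply: (separated_supports hm M0 (Q := fun x y => Q y x) _ _ (sqrtr_ge0 s) srr hf' hk').
  by move=> x y; rewrite mulrAC; exact: Q_bounded.
by move=> x y; rewrite Q_comm.
Qed.

(** Q commutes with g - 1 as well, and conj g = |g|^2 - |g - 1|^2 - g + 1. *)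
Lemma commutes_conj (g : bfun) : (forall x y, Q (bmul g x) y = Q x (bmul g y)) ->
  forall x y, Q (bmul (bconj g) x) y = Q x (bmul (bconj g) y).
Proof.
move=> Q_comm x y; pose g1 : bfun := g - bone R T.
have bmulDl (f h k : bfun) : bmul (f + h) k = bmul f k + bmul h k.
  by apply: bfun_ext => t; rewrite bfunDE !bmulE bfunDE mulrDl.
have bmulNl (f k : bfun) : bmul (- f) k = - bmul f k.
  by apply: bfun_ext => t; rewrite bfunNE !bmulE bfunNE mulNr.
have bmul1 (k : bfun) : bmul (bone R T) k = k.
  by apply: bfun_ext => t; rewrite bmulE (_ : bone R T t = 1)// mul1r.
have Q_comm1 u v : Q (bmul g1 u) v = Q u (bmul g1 v).
  rewrite !bmulDl !bmulNl !bmul1 (scalarB (Q_linl _)) (scalarB (Q_linr _)).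
  by rewrite Q_comm.
have c0 := commutes_norm_sq Q_comm x y; have c1 := commutes_norm_sq Q_comm1 x y.
have e (k : bfun) : bmul (bconj g) k =
    bmul (bmul g (bconj g)) k - bmul (bmul g1 (bconj g1)) k - bmul g k + k.
  apply: bfun_ext => t; rewrite !bfunDE !bfunNE !bmulE.
  rewrite (_ : bconj g1 t = (g t - 1)^*)// (_ : g1 t = g t - 1)//.
  rewrite (_ : bconj g t = (g t)^*)// rmorphB rmorph1; ring.
rewrite !e !(scalarD (Q_linl _)) !(scalarN (Q_linl _)) !(scalarD (Q_linr _)).
by rewrite !(scalarN (Q_linr _)) c0 c1 Q_comm.
Qed.

End Fuglede.

(** * Closure under conjugation *)

Section SeparatingMean.
Variables (R : realType) (A : completeNormedModType R[i]) (mul : A -> A -> A).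
Hypothesis hA : uniform_algebra mul.
Local Notation character := (is_character mul).

Lemma character0 : character (fun=> 0).
Proof. by split=> [c x y|x y|x]; rewrite ?mulr0 ?add0r ?cn0 ?rnorm_ge0. Qed.

Lemma character_inj a b : (forall chi, character chi -> chi a = chi b) -> a = b.
Proof.
move=> h; have [chi hchi n] := uniform_algebra_character hA (a - b).
apply/eqP; rewrite -subr_eq0 -rnorm_eq0 -n; have [lin _ _] := hchi.
by rewrite (scalarB lin) h// subrr cn0.
Qed.

Variable a0 : A.
Hypothesis no_conj : ~ exists a, forall chi, character chi -> chi a = (chi a0)^*.

(* The scalars are controlled by evaluating at the zero character, so that
   approximants [a + lambda] of the conjugate give a Cauchy sequence in [A]. *)
Lemma conj_distance : exists2 d, 0 < d & forall a lambda e,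
  (forall chi, character chi -> cn (chi a + lambda + (chi a0)^*) <= e) -> d <= e.
Proof.
apply: contrapT => no; apply: no_conj.
have /choice[u hu] : forall n : nat, exists p : A * R[i], forall chi, character chi ->
    cn (chi p.1 + p.2 + (chi a0)^*) <= 2^-1 ^+ n.
  move=> n; apply: contrapT => hn; apply: no; exists (2^-1 ^+ n).
    by rewrite exprn_gt0// invr_gt0.
  move=> a lambda e h; rewrite leNgt; apply/negP => en; apply: hn; exists (a, lambda) => chi hchi.
  exact: le_trans (h _ hchi) (ltW en).
have hl n : cn (u n).2 <= 2^-1 ^+ n.
  by have := hu n _ character0; rewrite add0r rmorph0 addr0.
have hc n chi : character chi -> cn (chi (u n).1 + (chi a0)^*) <= 2 * 2^-1 ^+ n.
  move=> hchi; have -> : chi (u n).1 + (chi a0)^* =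
    chi (u n).1 + (u n).2 + (chi a0)^* - (u n).2 by ring.
  by apply: le_trans (cnB _ _) _; rewrite mulrDl mul1r lerD ?hu ?hl.
have [m n nm|e e0|l hlim] := @complete_seq _ _ (fun n => (u n).1) (fun n => 4 * 2^-1 ^+ n).
- have [chi hchi <-] := uniform_algebra_character hA ((u m).1 - (u n).1).
  have [lin _ _] := hchi; rewrite (scalarB lin).
  have -> : chi (u m).1 - chi (u n).1 =
    chi (u m).1 + (chi a0)^* - (chi (u n).1 + (chi a0)^*) by ring.
  apply: le_trans (cnB _ _) _; apply: le_trans (lerD (hc m _ hchi) (hc n _ hchi)) _.
  have : 2^-1 ^+ m <= 2^-1 ^+ n :> R.
    by apply: ler_wiXn2l => //; lra.
  lra.
- exact: geometric_small.
exists (- l) => chi hchi; have [lin _ ub] := hchi; rewrite (scalarN lin).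
apply/eqP; rewrite eqr_oppLR -addr_eq0; apply/eqP/cn0_eq0/le_anti; rewrite cn_ge0 andbT.
apply: (le_geometric (C := 6)) => n; rewrite add0r.
have -> : chi l + (chi a0)^* = chi (l - (u n).1) + (chi (u n).1 + (chi a0)^*).
  by rewrite (scalarB lin); ring.
apply: le_trans (cnD _ _) _; apply: le_trans (lerD (le_trans (ub _) (hlim n)) (hc n _ hchi)) _.
by rewrite -mulrDl; lra.
Qed.

(* The second component makes every unimodular scalar available as a [phase] over
   each character, so that [sup_t Re (phase t * f t.1)] is the supremum of [|f|]. *)
Definition spectrum := {chi : A -> R[i] | character chi}.
Definition circle_bundle := (spectrum * R[i])%type.
Definition phase (t : circle_bundle) : R[i] := csgn t.2.
Definition gelfand a (t : circle_bundle) : R[i] := sval t.1 a.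

Lemma cbounded_phase : cbounded phase.
Proof. by exists 1 => t; rewrite cn_csgn. Qed.

Lemma cbounded_gelfand a : cbounded (gelfand a).
Proof. by exists (rnorm a) => -[[chi [? ? ub]] z]; exact: ub. Qed.

Lemma gelfand_lin c a b t : gelfand (c *: a + b) t = c * gelfand a t + gelfand b t.
Proof. by case: t => -[chi [lin ? ?]] z; rewrite /gelfand /= lin. Qed.

Lemma gelfand0 t : gelfand 0 t = 0.
Proof. by case: t => -[chi [lin ? ?]] z; exact: scalar0. Qed.

Lemma gelfandZ c a t : gelfand (c *: a) t = c * gelfand a t.
Proof. by rewrite -[_ *: _]addr0 gelfand_lin gelfand0 addr0. Qed.

(** In the cone K, the constraints with s = 0 hold on a complex space and so force the mean to
    vanish on A + C; the one with s = 1 and a = 0 gives at least d at the conjugate of a0. They are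
    consistent by [conj_distance], as the phases turn a supremum of real parts into one of
    moduli. *)
Lemma exists_separating_mean : exists2 m : (circle_bundle -> R) -> R, is_mean m &
  (forall a lambda, cmean m (fun t => phase t * (gelfand a t + lambda)) = 0) /\
  cmean m (fun t => phase t * (gelfand a0 t)^*) <> 0.
Proof.
have [d d0 hd] := conj_distance.
have bconj0 : cbounded (fun t => (gelfand a0 t)^*).
  by have [M hM] := cbounded_gelfand a0; exists M => t; rewrite cn_conj.
have bw a lambda : cbounded (fun t => phase t * (gelfand a t + lambda)).
  apply: cboundedM; first exact: cbounded_phase.
  by apply: cboundedD; [exact: cbounded_gelfand|exact: cbounded_cst].
pose k a lambda (s : R) t := phase t * (gelfand a t + lambda + s%:C * (gelfand a0 t)^*).
have bk a lambda s : cbounded (k a lambda s).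
  apply: cboundedM; first exact: cbounded_phase.
  apply: cboundedD; last by apply: cboundedM => //; exact: cbounded_cst.
  by apply: cboundedD; [exact: cbounded_gelfand|exact: cbounded_cst].
pose K f c := exists a lambda s,
  [/\ 0 <= s, f = (fun t => complex.Re (k a lambda s t)) & c = s * d].
have [|||||m hm hK] := @exists_mean R circle_bundle K (exist _ _ character0, 0).
- by move=> _ _ [a [lambda [s [_ -> _]]]]; exact: cbounded_Re.
- exists 0, 0, 0; rewrite mul0r; split=> //; apply/funext => t.
  by rewrite /k gelfand0 mul0r !addr0 mulr0.
- move=> _ _ _ _ [a [l [s [s0 -> ->]]]] [a' [l' [s' [s0' -> ->]]]].
  exists (1 *: a + a'), (l + l'), (s + s'); split; [exact: addr_ge0| |by rewrite mulrDl].
  apply/funext => t.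
  have -> : k (1 *: a + a') (l + l') (s + s') t = k a l s t + k a' l' s' t.
    by rewrite /k gelfand_lin real_complexD; ring.
  by rewrite raddfD.
- move=> r _ _ r0 [a [l [s [s0 -> ->]]]].
  exists (r%:C *: a), (r%:C * l), (r * s); split; [by rewrite mulr_ge0// ltW| |by rewrite mulrA].
  apply/funext => t; rewrite [LHS]/(_ *: _) /=.
  have -> : k (r%:C *: a) (r%:C * l) (r * s) t = r%:C * k a l s t.
    by rewrite /k gelfandZ real_complexM; ring.
  by rewrite (complex_ReM r%:C) /= mul0r subr0.
- move=> _ _ e [a [l [s [s0 -> ->]]]] h.
  have {}h chi : character chi -> cn (chi a + l + s%:C * (chi a0)^*) <= e.
    (* The second coordinate is the value itself, so that its phase turns this value into its
       modulus. *)
    move=> hchi; have := h (exist _ chi hchi, chi a + l + s%:C * (chi a0)^*).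
    by rewrite /k /phase /gelfand /= csgnM.
  have [->|sn0] := eqVneq s 0.
    by rewrite mul0r; exact: le_trans (cn_ge0 _) (h _ character0).
  have sp : 0 < s by rewrite lt_def sn0.
  rewrite mulrC -ler_pdivlMr//; apply: (hd (s^-1%:C *: a) (s^-1%:C * l)) => chi hchi.
  have [lin _ _] := hchi; rewrite (scalarZ lin) ler_pdivlMr// mulrC.
  rewrite -[in X in X * _](ger0_norm s0) -cn_real -cnM.
  have ss : s%:C * s^-1%:C = 1 by rewrite -real_complexM divff.
  by rewrite !mulrDr !mulrA ss !mul1r; exact: h.
exists m => //; split=> [a lambda|].
  set w := cmean m _.
  have hw c : 0 <= complex.Re (c * w).
    have -> : c * w = cmean m (k (c *: a) (c * lambda) 0).
      rewrite -cmeanZ//; congr cmean; apply/funext => t.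
      by rewrite /k gelfandZ mul0r addr0; ring.
    by apply: hK; exists (c *: a), (c * lambda), 0; rewrite mul0r.
  (* The multiplier is minus the conjugate of w, which turns w into - |w|^2. *)
  have := hw (- w^*); rewrite mulNr mulrC -cn_sqrE raddfN /= oppr_ge0 => h.
  apply/cn0_eq0/eqP; rewrite -sqrf_eq0; apply/eqP/le_anti.
  by rewrite h sqr_ge0.
move=> w0; have := hK (fun t => complex.Re (phase t * (gelfand a0 t)^*)) d.
have -> : m (fun t => complex.Re (phase t * (gelfand a0 t)^*)) = 0.
  by move/(congr1 (@complex.Re R)): w0.
rewrite leNgt d0 => h; suff : ~~ true by [].
apply: h; exists 0, 0, 1; rewrite mul1r; split=> //; apply/funext => t; congr complex.Re.
by rewrite /k gelfand0 !add0r mul1r.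
Qed.

End SeparatingMean.

Section ConjugateClosed.
Variables (R : realType) (A : completeNormedModType R[i]) (mul : A -> A -> A).
Hypothesis hA : uniform_algebra mul.
Hypothesis op_amenable : operator_amenable mul (@min_norms R A).
Local Notation T := (circle_bundle mul).
Local Notation bfun := (bfun R T).

Lemma operator_amenable_conj_closed (a0 : A) :
  exists a, forall chi, is_character mul chi -> chi a = (chi a0)^*.
Proof.
apply: contrapT => no; have [m hm [psiW psi0]] := exists_separating_mean hA no.
pose ia a : bfun := bfun_mk (@cbounded_gelfand _ _ mul a).
pose W : set bfun := [set x | exists a lambda, forall t, x t = gelfand a t + lambda].
pose act a x := bmul (ia a) x.
pose I (x y : bfun) := cmean m (fun t => phase t * bmul x y t).
have bI (x : bfun) : cbounded (fun t => phase t * x t).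
  by apply: cboundedM; [exact: cbounded_phase | exact: bfunP].
pose nr := ipnorm (bip m).
have nr_ge0 x : 0 <= nr x by exact: bnr_ge0.
have ba := uniform_algebra_banach hA; have mulC := uniform_algebra_comm hA.
have gelfandM a b (t : T) : gelfand (mul a b) t = gelfand a t * gelfand b t :> R[i].
  by case: t => -[chi [? chiM ?]] z; rewrite /gelfand /= chiM.
have I_linl y : scalar (I^~ y).
  move=> c x x'; rewrite /I -(cmeanZ hm)// -(cmeanD hm)//; last first.
    by apply: cboundedM => //; exact: cbounded_cst.
  congr cmean; apply/funext => t; rewrite !bmulE bfunDE bfunZE; ring.
have I_linr x : scalar (I x).
  move=> c y y'; rewrite /I -(cmeanZ hm)// -(cmeanD hm)//; last first.
    by apply: cboundedM => //; exact: cbounded_cst.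
  congr cmean; apply/funext => t; rewrite !bmulE bfunDE bfunZE; ring.
have I_bounded x y : cn (I x y) <= nr x * nr y.
  apply: le_trans (cn_cmean_le hm (bI _)) _.
  have -> : (fun t => cn (phase t * bmul x y t)) = (fun t => cn (x t) * cn (y t)).
    by apply/funext => t; rewrite bmulE !cnM cn_csgn mul1r.
  exact: mean_cauchy_schwarz.
have I_W x y : W x -> W y -> I x y = 0.
  move=> [a [l hx]] [b [l' hy]].
  (* W is closed under products: this is (a + l) (b + l') expanded in A + C. *)
  rewrite -(psiW (mul a b + (l' *: a + l *: b)) (l * l')).
  congr cmean; apply/funext => t; rewrite bmulE hx hy.
  have := gelfand_lin 1 (mul a b) (l' *: a + l *: b) t; rewrite scale1r => ->.
  by rewrite gelfand_lin gelfandZ gelfandM; ring.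
have W_lin c x y : W x -> W y -> W (c *: x + y).
  move=> [a [l hx]] [b [l' hy]]; exists (c *: a + b), (c * l + l') => t.
  by rewrite bfunDE bfunZE hx hy gelfand_lin; ring.
have W0 : W 0 by exists 0, 0 => t; rewrite gelfand0 addr0.
have W1 : W (bone R T) by exists 0, 1 => t; rewrite gelfand0 add0r.
have [Q0 [Q0_linl Q0_linr Q0_bounded Q0_Wl Q0_Wr]] :=
  exists_projected_form (bipD hm) (@bipC _ _ m) (@bipZ _ _ m) (bipR hm) (bip_ge0 hm)
    (bnrZ hm) W_lin W0 I_linl I_linr I_bounded I_W.
have act_linr a : linear (act a).
  by move=> c x y; apply: bfun_ext => t; rewrite bfunDE bfunZE !bmulE bfunDE bfunZE; ring.
have act_linl x : linear (act^~ x).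
  move=> c a b; apply: bfun_ext => t; rewrite bfunDE bfunZE !bmulE.
  by rewrite [ia _ t]gelfand_lin mulrDl mulrA.
have act_mul a b x : act (mul a b) x = act a (act b x).
  by apply: bfun_ext => t; rewrite !bmulE [ia _ t]gelfandM mulrA.
have actW a x : W x -> W (act a x).
  move=> [b [l hx]]; exists (l *: a + mul a b), 0 => t.
  by rewrite bmulE hx gelfand_lin gelfandM (_ : ia a t = gelfand a t)//; ring.
have nr_act a x : nr (act a x) <= rnorm a * nr x.
  apply: (bnr_le1 hm) => [|t]; first exact: rnorm_ge0.
  rewrite bmulE cnM ler_wpM2r//.
  by case: t => -[chi [? ? ub]] z; exact: ub.
(* At each point of the bundle the action is a scalar matrix, bounded by C through the character
   there; the mean preserves this pointwise inequality between squares. *)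
have act_sum n (X : 'I_n -> 'I_n -> A) (x : 'I_n -> bfun) C : 0 <= C ->
    (forall chi, is_character mul chi -> opb (fun i j => chi (X i j)) C) ->
    n2 nr (fun i => \sum_j act (X i j) (x j)) <= C * n2 nr x.
  move=> C0 hX; rewrite -(ler_pXn2r (ltn0Sn 1)) ?nnegrE ?mulr_ge0 ?l2_ge0//.
  have n2E (y : 'I_n -> bfun) : n2 nr y ^+ 2 = m (\sum_i bsq (y i)).
    rewrite (n2_sqr nr_ge0) (mean_sum hm) => [|i]; last exact: bsq_bounded.
    by apply: eq_bigr => i _; rewrite (bnr_sqr hm).
  have bS (y : 'I_n -> bfun) : bounded_fun (\sum_i bsq (y i)).
    by elim/big_ind: _ => [|f g|i _];
      [exact: bounded_fun_cst | exact: bounded_funD | exact: bsq_bounded].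
  rewrite exprMn !n2E -(meanZ hm)//; apply: (mean_homo hm) => [//||t].
    exact: bounded_funZ.
  have -> : (C ^+ 2 *: \sum_i bsq (x i)) t = (C * l2 (fun i => x i t)) ^+ 2.
    rewrite exprMn l2_sqr [LHS]/(_ *: _) /=; congr (_ * _).
    by rewrite fct_sumE.
  have -> : (\sum_i bsq (\sum_j act (X i j) (x j))) t =
      l2 (fun i => \sum_j sval t.1 (X i j) * x j t) ^+ 2.
    rewrite l2_sqr fct_sumE; apply: eq_bigr => i _; congr (cn _ ^+ 2).
    by rewrite bfun_sumE; apply: eq_bigr.
  rewrite ler_pXn2r ?nnegrE ?mulr_ge0//.
  by apply: opb_vec => //; exact: (hX _ (svalP t.1)).
have act_mx n (a : 'M[A]_n) (x : 'I_n -> bfun) :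
    n2 nr (fun i => \sum_j act (a i j) (x j)) <= min_norms a * n2 nr x.
  apply: act_sum; first exact: min_norms_ge0.
  by move=> chi [lin _ ub]; exact: min_norms_opb.
have act_mxT n (a : 'M[A]_n) (x : 'I_n -> bfun) :
    n2 nr (fun j => \sum_i act (a i j) (x i)) <= min_norms a * n2 nr x.
  apply: act_sum; first exact: min_norms_ge0.
  by move=> chi [lin _ ub]; apply: opb_tr; exact: min_norms_opb.
have Q0_bounded1 x y : cn (Q0 x y) <= 1 * (nr x * nr y) by rewrite mul1r.
(* For y in W both sides are values of I, whose integrand does not see in which argument a
   stands. *)
have Q0_act a x y : W y -> Q0 (act a x) y = Q0 x (act a y).
  move=> Wy; rewrite (Q0_Wr _ _ Wy) (Q0_Wr _ _ (actW a y Wy)).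
  by congr cmean; apply/funext => t; rewrite !bmulE; ring.
have [Q1 Q1_form Q1_comm] := splitting mulC nr_ge0 (bnrZ hm) act_linr act_linl act_mul actW
   nr_act act_mx act_mxT ler01 Q0_linl Q0_linr Q0_bounded1 Q0_Wl Q0_act op_amenable.
have [M hM] := bform_bounded Q1_form.
pose Q x y := Q0 x y - Q1 x y.
have Q_linl y : scalar (Q^~ y).
  by move=> c x x'; rewrite /Q (Q0_linl y) (bform_linl Q1_form y); ring.
have Q_linr x : scalar (Q x).
  by move=> c y y'; rewrite /Q (Q0_linr x) (bform_linr Q1_form x); ring.
have M0 : 0 <= 1 + `|M| by rewrite addr_ge0.
have Q_bounded x y : cn (Q x y) <= (1 + `|M|) * nr x * nr y.
  apply: le_trans (cnB _ _) _; rewrite !mulrDl mul1r lerD//; apply: le_trans (hM _ _) _.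
  by rewrite -!mulrA ler_wpM2r ?mulr_ge0// ler_norm.
have Q_comm x y : Q (bmul (ia a0) x) y = Q x (bmul (ia a0) y).
  apply/eqP; rewrite -subr_eq0; apply/eqP; rewrite /Q.
  transitivity (Q1 x (act a0 y) - Q1 (act a0 x) y - (Q0 x (act a0 y) - Q0 (act a0 x) y)).
    by rewrite /act; ring.
  by rewrite Q1_comm subrr.
have := commutes_conj hm Q_linl Q_linr M0 Q_bounded Q_comm (bone R T) (bone R T).
rewrite /Q (Q0_Wl _ _ W1) (bform_Wl Q1_form _ W1) (bform_Wr Q1_form _ W1) (Q0_Wr _ _ W1).
rewrite !subr0 => h; apply: psi0; rewrite -h.
by congr cmean; apply/funext => t; rewrite !bmulE !mulr1.
Qed.

(** Characters separate points and norm A, so that each law of the involution may be checked on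
    characters, where [star] is complex conjugation. *)
Lemma operator_amenable_cstar : commutative_cstar_algebra mul.
Proof.
have ba := uniform_algebra_banach hA; have mulC := uniform_algebra_comm hA.
split=> //; have /choice[star hstar] := operator_amenable_conj_closed.
exists star; split.
- move=> c a b; apply: (character_inj hA) => chi hchi; have [lin _ _] := hchi.
  by rewrite hstar// !lin !hstar// rmorphD rmorphM.
- by move=> a; apply: (character_inj hA) => chi hchi; rewrite !hstar// conjCK.
- move=> a b; apply: (character_inj hA) => chi hchi; have [_ chiM _] := hchi.
  by rewrite hstar// !chiM !hstar// rmorphM mulrC.
move=> a; rewrite !rnormE -[_ ^+ 2]/(_ * _) -real_complexM; congr (_%:C); rewrite -expr2.
apply/le_anti/andP; split.
  have [chi hchi <-] := uniform_algebra_character hA (mul (star a) a).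
  have [_ chiM ub] := hchi; rewrite chiM hstar// cnM cn_conj -expr2.
  by rewrite ler_pXn2r ?nnegrE ?rnorm_ge0// ub.
have [chi hchi <-] := uniform_algebra_character hA a.
have [_ chiM ub] := hchi; rewrite expr2 -{1}(cn_conj (chi a)) -cnM -hstar// -chiM.
exact: ub.
Qed.

End ConjugateClosed.

Theorem corollary1 (R : realType) (A : completeNormedModType R[i])
    (mul : A -> A -> A) (hA : uniform_algebra mul) :
  [<-> operator_amenable mul (@min_norms R A);
       forall nu : matrix_norms R A,
         is_cc_banach_algebra mul nu -> operator_amenable mul nu;
       amenable mul;
       commutative_cstar_algebra mul].
Proof.
have min_cstar := operator_amenable_cstar hA.
have cstar_am : commutative_cstar_algebra mul -> amenable mul.
  move=> [ba mulC [star hstar]].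
  exact: cstar_amenable (ba_bilinear ba) (ba_assoc ba) mulC (submult_rnorm ba) hstar.
have am_op : amenable mul -> forall nu : matrix_norms R A,
    is_cc_banach_algebra mul nu -> operator_amenable mul nu.
  by move=> am nu [_ os _]; exact: amenable_operator_amenable.
have op_min : (forall nu : matrix_norms R A,
    is_cc_banach_algebra mul nu -> operator_amenable mul nu) ->
    operator_amenable mul (@min_norms R A).
  by apply; exact: min_norms_cc_banach_algebra.
(* The available implications form the cycle (i) => (iv) => (iii) => (ii) => (i); those in the order
   of the statement are composed from it. *)
tfae; [| | |]; auto.
Qed.
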